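(* Let $G<\mathrm{GL}(2,\mathbb{C})$ be a nontrivial finite subgroup acting without pseudo-reflections, let $\mathrm{Sp}$ be the set of special irreducible representations of $G$, with $\rho_0\in\mathrm{Sp}$ the trivial representation, and let $T_{\mathrm{Sp}}=\bigoplus_{\rho\in\mathrm{Sp}}T_\rho$ be the reconstruction bundle on the $G$-Hilbert scheme. For $\rho\in\mathrm{Sp}\setminus\{\rho_0\}$ put $[\rho]=\{\rho_0,\rho\}$ and $T_{[\rho]}=T_{\rho_0}\oplus T_\rho$. Then the product of the cornering morphisms $$\mathcal{M}(T_{\mathrm{Sp}})\longrightarrow\prod_{\rho\in\mathrm{Sp}\setminus\{\rho_0\}}\mathcal{M}(T_{[\rho]})$$ is a closed immersion.
   Context: We work over $\mathbb{C}$; modules are left modules and products of schemes are over $\mathbb{C}$. The bundles. The $G$-Hilbert scheme is the fine moduli space of $G$-equivariant coherent sheaves of the form $\mathcal{O}_Z$ with $Z\subset\mathbb{A}^2$ and $\Gamma(\mathcal{O}_Z)$ isomorphic to the regular representation of $G$. It is projective over $\mathbb{A}^2/G$ and carries a tautological bundle $T=\bigoplus_{\rho\in\mathrm{Irr}(G)}T_\rho^{\oplus\dim\rho}$, decomposed according to the isomorphism classes $\mathrm{Irr}(G)$ of irreducible representations; $T_\rho$ has rank $\dim\rho$, each $T_\rho$ is globally generated, and $T_{\rho_0}$ is the trivial line bundle. A representation $\rho\in\mathrm{Irr}(G)$ is special if $H^1(T_\rho^\vee)=0$; $\mathrm{Sp}$ is the set of special $\rho$ (it contains $\rho_0$). Multigraded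 linear series. Let $Y$ be a projective scheme over a finitely generated $\mathbb{C}$-algebra, and let $E=\bigoplus_{i\in I}E_i$ be a finite direct sum of globally generated vector bundles on $Y$ with a distinguished index $0\in I$ such that $E_0=\mathcal{O}_Y$. Put $B=\mathrm{End}_Y(E)$, let $e_i\in B$ be the idempotent projecting to $E_i$, and put $v=(\mathrm{rk}\,E_i)_{i\in I}$. The multigraded linear series $\mathcal{M}(E)$ is the fine moduli space of $0$-generated $B$-modules $M$ of dimension vector $v$, i.e. $\dim e_iM=v_i$ for all $i$ and there is a surjection $Be_0\to M$. Equivalently, it is King's moduli space of $\theta$-stable $B$-modules of dimension vector $v$ for $\theta$ a positive multiple of $\theta'$, where $\theta'_i=1$ for $i\neq0$ and $\sum_i\theta'_iv_i=0$; here $M$ is $\theta$-stable if $\theta(N)>0$ for every nonzero proper submodule $N\subset M$. It carries a tautological bundle $\bigoplus_{i\in I}T_i$ of $B$-modules, normalized by $T_0=\mathcal{O}$. Cornering. For $\{0\}\subseteq I'\subseteq I$, put $E_{I'}=\bigoplus_{i\in I'}E_i$ and $e=\sum_{i\in I'}e_i$, so that $\mathrm{End}(E_{I'})\simeq eBe$. The cornering morphism $\mathcal{M}(E)\to\mathcal{M}(E_{I'})$ is the morphism induced by the universal property from the family $\bigoplus_{i\in I'}T_i$ of $eBe$-modules on $\mathcal{M}(E)$; on closed points it is $M\mapsto eM$. In the claim this is applied with $Y$ the $G$-Hilbert scheme, $E=T_{\mathrm{Sp}}$, distinguished index $\rho_0$, and $I'=[\rho]$. Known facts that may be used: $\mathcal{M}(T_{\mathrm{Sp}})$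 is isomorphic to the minimal resolution of $\mathbb{A}^2/G$ (Craw–Ito–Karmazyn, Theorem 4.4); in particular it is reduced. *)

(* Defs.v *)
(* Schemes over k are given by their functors of points on commutative
   k-algebras.  A scheme is determined by its functor of points, and a fine
   moduli space represents its moduli functor, so G-Hilb and M(E) below are
   their moduli functors.  Points are not quotiented by isomorphism: a
   [moduli] consists of the families over each Spec A, together with the
   cartesian arrows, i.e. the ways in which a family over A' is the pullback
   of a family over A along phi : A -> A'.  In both instances families have
   no nontrivial automorphisms, so the functor of points is the functor of
   isomorphism classes.  Test algebras are nonzero; the zero ring carries no
   information, since a sheaf has exactly one point over it. *)

From HB Require Import structures.
From mathcomp Require Import all_boot all_order all_algebra all_fingroup.
From mathcomp Require Import mxrepresentation mpoly.
From mathcomp Require Import boolp reals complex.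

Set Implicit Arguments.
Unset Strict Implicit.
Unset Printing Implicit Defensive.

Import GRing.Theory.
Local Open Scope ring_scope.

Section Modules.

Definition semilinear (A A' : comNzRingType) (phi : A -> A')
    (M : lmodType A) (N : lmodType A') (u : M -> N) : Prop :=
  forall a m n, u (a *: m + n) = phi a *: u m + u n.

(* u : M -> M' exhibits M' as the tensor product of M with A' over A. *)
Definition base_change (A A' : comNzRingType) (phi : A -> A')
    (M : lmodType A) (M' : lmodType A') (u : M -> M') : Prop :=
  semilinear phi u /\
  forall (N : lmodType A') (h : M -> N), semilinear phi h ->
    exists h' : {linear M' -> N},
      (forall m, h' (u m) = h m) /\
      forall h'' : {linear M' -> N}, (forall m, h'' (u m) = h m) -> h'' =1 h'.

Definition generates_unit_ideal (A : comNzRingType) (S : A -> Prop) : Prop :=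
  exists (n : nat) (c s : 'I_n -> A),
    (forall i, S (s i)) /\ \sum_i c i * s i = 1.

Definition ideal (A : comNzRingType) (I : A -> Prop) : Prop :=
  [/\ I 0, forall a b, I a -> I b -> I (a + b) & forall a b, I b -> I (a * b)].

(* The images of the b t form a basis of the localization M_f over A_f. *)
Definition local_basis (A : comNzRingType) (M : lmodType A) (f : A)
    (T : finType) (b : T -> M) : Prop :=
  (forall m, exists (N : nat) (c : T -> A), f ^+ N *: m = \sum_t c t *: b t) /\
  (forall c : T -> A, \sum_t c t *: b t = 0 ->
     exists N : nat, forall t, f ^+ N * c t = 0).

Definition locally_free (A : comNzRingType) (M : lmodType A) (n : nat) : Prop :=
  exists S : A -> Prop, generates_unit_ideal S /\
    forall f, S f -> exists b : 'I_n -> M, local_basis f b.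

Lemma locally_free_iso (A : comNzRingType) (M N : lmodType A) (n : nat)
  (g : {linear M -> N}) (h : N -> M) :
  cancel g h -> cancel h g -> locally_free M n -> locally_free N n.
Proof.
move=> gK hK [S [S1 Sb]]; exists S; split=> // f /Sb[b [span indep]].
exists (g \o b); split=> [m|c c0].
  have [e [c hc]] := span (h m); exists e, c.
  rewrite -[m in LHS]hK -linearZZ hc linear_sum.
  by apply: eq_bigr => t _; rewrite linearZZ.
apply: indep; apply: (can_inj gK); rewrite linear0 -[RHS]c0 linear_sum.
by apply: eq_bigr => t _; rewrite linearZZ.
Qed.

Section FixedSubmodule.
Variables (A : comNzRingType) (M : lmodType A) (e : {linear M -> M}).

Definition fixed_pred : {pred M} := [pred m | e m == m].

Fact fixed_closed : submod_closed fixed_pred.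
Proof.
split=> [|a u v]; first by rewrite inE linear0.
by rewrite !inE => /eqP eu /eqP ev; rewrite linearP eu ev.
Qed.

HB.instance Definition _ :=
  GRing.isSubmodClosed.Build A M fixed_pred fixed_closed.

(* For e idempotent this is the image eM. *)
Definition fixed := {m : M | m \in fixed_pred}.
HB.instance Definition _ := SubType.on fixed.
HB.instance Definition _ := Choice.on fixed.
HB.instance Definition _ := [SubChoice_isSubLmodule of fixed by <:].

Lemma val_fixedP a (m n : fixed) : val (a *: m + n) = a *: val m + val n.
Proof. exact: linearP. Qed.

End FixedSubmodule.
End Modules.

Section Moduli.
Variable k : closedFieldType.

Record moduli := Moduli {
  fam :> comAlgType k -> Type;
  arr : forall (A A' : comAlgType k) (phi : {lrmorphism A -> A'}),
    fam A -> fam A' -> Type }.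

Record morphism (F G : moduli) := Morphism {
  on_fam :> forall A : comAlgType k, F A -> G A;
  on_arr : forall (A A' : comAlgType k) (phi : {lrmorphism A -> A'})
    (x : F A) (y : F A'), arr phi x y -> arr phi (on_fam x) (on_fam y) }.

Definition isomorphic (F : moduli) (A : comAlgType k) (x y : F A) : Prop :=
  inhabited (arr (idfun : {lrmorphism A -> A}) x y).

Definition prod_moduli (J : Type) (G : J -> moduli) : moduli :=
  {| fam := fun A => forall j, G j A;
     arr := fun A A' phi x y => forall j, arr phi (x j) (y j) |}.

Definition prod_morphism (J : Type) (F : moduli) (G : J -> moduli)
    (f : forall j, morphism F (G j)) : morphism F (prod_moduli G) :=
  @Morphism F (prod_moduli G) (fun A x j => f j A x)
    (fun A A' phi x y u j => on_arr (f j) u).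

(* f is representable by closed immersions: for every y : Spec A -> G, the
   projection of the fibre product of F and Spec A over G is the inclusion of
   Spec (A / I) for some ideal I of A. *)
Definition closed_immersion (F G : moduli) (f : morphism F G) : Prop :=
  forall (A : comAlgType k) (y : G A), exists I : A -> Prop, ideal I /\
    forall (A' : comAlgType k) (phi : {lrmorphism A -> A'}),
      ((forall a, I a -> phi a = 0) <->
         exists x : F A', inhabited (arr phi y (f A' x))) /\
      (forall x x' : F A', inhabited (arr phi y (f A' x)) ->
         inhabited (arr phi y (f A' x')) -> isomorphic x x').

(* Infinitesimal lifting along square-zero extensions of affine schemes. *)
Definition formally_smooth (X : moduli) : Prop :=
  forall (B B' : comAlgType k) (q : {lrmorphism B -> B'}),
    (forall b', exists b, q b = b') ->
    (forall a b, q a = 0 -> q b = 0 -> a * b = 0) ->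
    forall x' : X B', exists x : X B, inhabited (arr q x x').

(* A quasi-coherent sheaf on Y is given by the modules of sections of its
   pullbacks along the points Spec A -> Y and by the restriction maps; a
   homomorphism of such sheaves is a compatible family of A-linear maps. *)
Record omodule (Y : moduli) := OModule {
  sec :> forall A : comAlgType k, Y A -> lmodType A;
  res : forall (A A' : comAlgType k) (phi : {lrmorphism A -> A'})
    (x : Y A) (y : Y A'), arr phi x y -> sec x -> sec y;
  res_semilinear : forall (A A' : comAlgType k) (phi : {lrmorphism A -> A'})
    (x : Y A) (y : Y A') (u : arr phi x y), semilinear phi (res u) }.

Section Cohomology.
Variable Y : moduli.

Definition subfunctor := forall A : comAlgType k, Y A -> Prop.

(* The pullback of an open U to Spec A is the union of the D(s), s in S. *)
Definition is_open (U : subfunctor) : Prop :=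
  forall (A : comAlgType k) (x : Y A), exists S : A -> Prop,
    forall (A' : comAlgType k) (phi : {lrmorphism A -> A'}) (x' : Y A'),
      arr phi x x' ->
      (U A' x' <->
         generates_unit_ideal (fun a' => exists2 s, S s & a' = phi s)).

Definition is_cover (J : Type) (U : J -> subfunctor) : Prop :=
  forall K : comAlgType k, (forall a : K, a != 0 -> exists b, a * b = 1) ->
    forall x : Y K, exists j, U j K x.

(* Sections over U of the dual of E, i.e. homomorphisms from the restriction
   of E to U to the structure sheaf of U; values off U are irrelevant. *)
Definition dual_cochain (E : omodule Y) :=
  forall (A : comAlgType k) (x : Y A), E A x -> A.

Definition is_dual_section (E : omodule Y) (U : subfunctor)
    (xi : dual_cochain E) : Prop :=
  (forall (A : comAlgType k) (x : Y A), U A x ->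
     forall (a : A) (s t : E A x), xi A x (a *: s + t) = a * xi A x s + xi A x t)
  /\
  (forall (A A' : comAlgType k) (phi : {lrmorphism A -> A'})
     (x : Y A) (y : Y A') (u : arr phi x y), U A x ->
     forall s : E A x, xi A' y (res u s) = phi (xi A x s)).

(* H^1 of the dual of E vanishes.  H^1 is the colimit of the Cech groups
   over all open covers, and each of these injects into it in degree 1, so
   H^1 = 0 means that every 1-cocycle of every open cover is a coboundary. *)
Definition H1_dual_vanishes (E : omodule Y) : Prop :=
  forall (J : Type) (U : J -> subfunctor),
    (forall j, is_open (U j)) -> is_cover U ->
  forall c : J -> J -> dual_cochain E,
    (forall i j, is_dual_section (fun A x => U i A x /\ U j A x) (c i j)) ->
    (forall i j l (A : comAlgType k) (x : Y A),
       U i A x -> U j A x -> U l A x ->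
       forall s, c i j A x s + c j l A x s = c i l A x s) ->
  exists b : J -> dual_cochain E,
    (forall j, is_dual_section (U j) (b j)) /\
    (forall i j (A : comAlgType k) (x : Y A), U i A x -> U j A x ->
       forall s, c i j A x s = b j A x s - b i A x s).

End Cohomology.

Section EndomorphismAlgebra.
Variables (Y : moduli) (I : finType) (E : I -> omodule Y).

(* A section over x of the direct sum of the E i. *)
Definition dsum_sec (A : comAlgType k) (x : Y A) := forall i, E i A x.

(* The elements of End_Y(E), for E the direct sum of the E i. *)
Record endo := Endo {
  endo_fun :> forall (A : comAlgType k) (x : Y A), dsum_sec x -> dsum_sec x;
  endo_linear : forall (A : comAlgType k) (x : Y A) (a : A) (s t : dsum_sec x) i,
    endo_fun (fun j => a *: s j + t j) i = a *: endo_fun s i + endo_fun t i;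
  endo_res : forall (A A' : comAlgType k) (phi : {lrmorphism A -> A'})
    (x : Y A) (y : Y A') (u : arr phi x y) (s : dsum_sec x) i,
    endo_fun (fun j => res u (s j)) i = res u (endo_fun s i) }.

Lemma endo_ext (f g : endo) :
  (forall (A : comAlgType k) (x : Y A) s i, f A x s i = g A x s i) -> f = g.
Proof.
case: f g => [f fl fr] [g gl gr] /= fg.
have {}fg : f = g.
  apply: functional_extensionality_dep => A.
  apply: functional_extensionality_dep => x.
  apply: functional_extensionality_dep => s.
  by apply: functional_extensionality_dep => i; apply: fg.
by move: fl fr gl gr; rewrite fg => *; congr Endo; apply: Prop_irrelevance.
Qed.

Definition endo_id : endo.
Proof. by exists (fun A x s => s). Defined.

Definition endo_comp (f g : endo) : endo.
Proof.
exists (fun A x s => f A x (g A x s)) => [A x a s t i|A A' phi x y u s i].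
  rewrite -endo_linear; congr (f A x _ i).
  by apply: functional_extensionality_dep => j; rewrite endo_linear.
rewrite -endo_res; congr (f A' y _ i).
by apply: functional_extensionality_dep => j; rewrite endo_res.
Defined.

Lemma res_add (F : omodule Y) (A A' : comAlgType k) (phi : {lrmorphism A -> A'})
  (x : Y A) (y : Y A') (u : arr phi x y) (s t : F A x) :
  res u (s + t) = res u s + res u t.
Proof. by have := res_semilinear u 1 s t; rewrite !scale1r rmorph1 scale1r. Qed.

Lemma res_0 (F : omodule Y) (A A' : comAlgType k) (phi : {lrmorphism A -> A'})
  (x : Y A) (y : Y A') (u : arr phi x y) : res u (0 : F A x) = 0.
Proof. by apply: (addIr (res u 0)); rewrite -res_add !add0r. Qed.

Lemma res_scale (F : omodule Y) (A A' : comAlgType k) (phi : {lrmorphism A -> A'})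
  (x : Y A) (y : Y A') (u : arr phi x y) a (s : F A x) :
  res u (a *: s) = phi a *: res u s.
Proof. by have := res_semilinear u a s 0; rewrite res_0 !addr0. Qed.

Definition endo_add (f g : endo) : endo.
Proof.
exists (fun A x s i => f A x s i + g A x s i) => [A x a s t i|A A' phi x y u s i].
  by rewrite !endo_linear scalerDr addrACA.
by rewrite !endo_res res_add.
Defined.

Definition endo_scale (c : k) (f : endo) : endo.
Proof.
exists (fun A x s i => c%:A *: f A x s i) => [A x a s t i|A A' phi x y u s i].
  by rewrite endo_linear scalerDr !scalerA [c%:A * a]mulrC.
by rewrite endo_res res_scale rmorph_alg.
Defined.

(* The idempotent projecting onto the summands indexed by P. *)
Definition proj_endo (P : {set I}) : endo.
Proof.
exists (fun A x s i => if i \in P then s i else 0) => [A x a s t i|A A' phi x y u s i].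
  by case: ifP; rewrite ?scaler0 ?addr0.
by case: ifP; rewrite ?res_0.
Defined.

End EndomorphismAlgebra.

Section MultigradedLinearSeries.
Variables (Y : moduli) (I : finType) (E : I -> omodule Y).
Variables (v : I -> nat) (o : I).

(* Families over Spec A of o-generated B-modules of dimension vector v, for
   B = End_Y(E), with tautological bundle trivialized at o. *)
Record mls_fam (A : comAlgType k) := MlsFam {
  car :> lmodType A;
  act : endo E -> {linear car -> car};
  act_id : forall m, act (endo_id E) m = m;
  act_comp : forall b c m, act (endo_comp b c) m = act b (act c m);
  act_add : forall b c m, act (endo_add b c) m = act b m + act c m;
  act_scale : forall c b m, act (endo_scale c b) m = c%:A *: act b m;
  mls_rank : forall i, locally_free (fixed (act (proj_endo E [set i]))) (v i);
  gen : car;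
  gen_fixed : act (proj_endo E [set o]) gen = gen;
  gen_basis : forall m, act (proj_endo E [set o]) m = m -> exists! a, m = a *: gen;
  gen_generates : forall m, exists (n : nat) (a : 'I_n -> A) (b : 'I_n -> endo E),
    m = \sum_j a j *: act (b j) gen }.

Record mls_arr (A A' : comAlgType k) (phi : {lrmorphism A -> A'})
    (M : mls_fam A) (M' : mls_fam A') := MlsArr {
  mls_fun :> M -> M';
  mls_fun_base_change : base_change phi mls_fun;
  mls_fun_act : forall b m, mls_fun (act M b m) = act M' b (mls_fun m);
  mls_fun_gen : mls_fun (gen M) = gen M' }.

Definition mls : moduli := {| fam := mls_fam; arr := mls_arr |}.

End MultigradedLinearSeries.

Section Cornering.
Variables (Y : moduli) (I : finType) (E : I -> omodule Y).
Variables (v : I -> nat) (o : I) (I' : {set I}) (oI' : o \in I').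

Let J := {i : I | i \in I'}.
Let EJ (j : J) := E (val j).
Let vJ (j : J) := v (val j).
Let oJ : J := exist _ o oI'.

Definition dsum_restrict (A : comAlgType k) (x : Y A) (s : dsum_sec E x) :
  dsum_sec EJ x := fun j => s (val j).

Definition dsum_extend (A : comAlgType k) (x : Y A) (s : dsum_sec EJ x) :
    dsum_sec E x :=
  fun i => (if i \in I' as b return (i \in I') = b -> E i A x
            then fun h => s (exist _ i h) else fun=> 0) erefl.

Lemma dsum_extend_in (A : comAlgType k) (x : Y A) (s : dsum_sec EJ x) i
  (h : i \in I') : dsum_extend s i = s (exist _ i h).
Proof.
rewrite /dsum_extend; move: (erefl (i \in I')).
case: {2 3}(i \in I') => h'; first by rewrite (bool_irrelevance h' h).
by case/negP: (negbT h').
Qed.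

Lemma dsum_extend_out (A : comAlgType k) (x : Y A) (s : dsum_sec EJ x) i
  (h : i \notin I') : dsum_extend s i = 0.
Proof.
rewrite /dsum_extend; move: (erefl (i \in I')).
by case: {2 3}(i \in I') => h' //; case/negP: h.
Qed.

Lemma dsum_extendK (A : comAlgType k) (x : Y A) (s : dsum_sec EJ x) :
  dsum_restrict (dsum_extend s) = s.
Proof.
apply: functional_extensionality_dep => -[i h].
by rewrite /dsum_restrict /= (dsum_extend_in _ h).
Qed.

Lemma dsum_restrictK (A : comAlgType k) (x : Y A) (s : dsum_sec E x) :
  dsum_extend (dsum_restrict s) = proj_endo E I' A x s.
Proof.
apply: functional_extensionality_dep => i /=.
case: (boolP (i \in I')) => h; first by rewrite dsum_extend_in.
by rewrite dsum_extend_out.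
Qed.

Lemma dsum_extend_linear (A : comAlgType k) (x : Y A) a (s t : dsum_sec EJ x) :
  dsum_extend (fun j => a *: s j + t j) =
  fun i => a *: dsum_extend s i + dsum_extend t i.
Proof.
apply: functional_extensionality_dep => i.
case: (boolP (i \in I')) => h; first by rewrite !(dsum_extend_in _ h).
by rewrite !dsum_extend_out // scaler0 addr0.
Qed.

Lemma dsum_extend_res (A A' : comAlgType k) (phi : {lrmorphism A -> A'})
  (x : Y A) (y : Y A') (u : arr phi x y) (s : dsum_sec EJ x) :
  dsum_extend (fun j => res u (s j)) = fun i => res u (dsum_extend s i).
Proof.
apply: functional_extensionality_dep => i.
case: (boolP (i \in I')) => h; first by rewrite !(dsum_extend_in _ h).
by rewrite !dsum_extend_out // res_0.
Qed.

(* The isomorphism between End(E_I') and eBe, for e = proj_endo I'. *)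
Definition endo_extend (b : endo EJ) : endo E.
Proof.
exists (fun A x s => dsum_extend (b A x (dsum_restrict s)))
  => [A x a s t i|A A' phi x y u s i].
  rewrite -(congr1 (fun f => f i) (dsum_extend_linear _ _ _)).
  congr (dsum_extend _ i); apply: functional_extensionality_dep => j.
  by rewrite -endo_linear.
rewrite -(congr1 (fun f => f i) (dsum_extend_res _ _)).
congr (dsum_extend _ i); apply: functional_extensionality_dep => j.
by rewrite -endo_res.
Defined.

Definition endo_compress (b : endo E) : endo EJ.
Proof.
exists (fun A x s => dsum_restrict (b A x (dsum_extend s)))
  => [A x a s t j|A A' phi x y u s j]; rewrite /dsum_restrict.
  by rewrite dsum_extend_linear endo_linear.
by rewrite dsum_extend_res endo_res.
Defined.

Lemma endo_extend_id : endo_extend (endo_id EJ) = proj_endo E I'.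
Proof. by apply: endo_ext => A x s i /=; rewrite dsum_restrictK. Qed.

Lemma endo_extend_comp b c :
  endo_extend (endo_comp b c) = endo_comp (endo_extend b) (endo_extend c).
Proof. by apply: endo_ext => A x s i /=; rewrite dsum_extendK. Qed.

Lemma endo_extend_add b c :
  endo_extend (endo_add b c) = endo_add (endo_extend b) (endo_extend c).
Proof.
apply: endo_ext => A x s i /=.
case: (boolP (i \in I')) => h; first by rewrite !(dsum_extend_in _ h).
by rewrite !dsum_extend_out // addr0.
Qed.

Lemma endo_extend_scale c b :
  endo_extend (endo_scale c b) = endo_scale c (endo_extend b).
Proof.
apply: endo_ext => A x s i /=.
case: (boolP (i \in I')) => h; first by rewrite !(dsum_extend_in _ h).
by rewrite !dsum_extend_out // scaler0.
Qed.

Lemma endo_extend_proj (j : J) :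
  endo_extend (proj_endo EJ [set j]) = proj_endo E [set val j].
Proof.
apply: endo_ext => A x s i /=; rewrite !inE.
case: (boolP (i \in I')) => h; first by rewrite (dsum_extend_in _ h) inE -val_eqE.
by rewrite dsum_extend_out //; case: eqP => // ij; rewrite ij (valP j) in h.
Qed.

Lemma endo_extend_compress b :
  endo_extend (endo_compress b) =
  endo_comp (proj_endo E I') (endo_comp b (proj_endo E I')).
Proof. by apply: endo_ext => A x s i /=; rewrite !dsum_restrictK. Qed.

Lemma proj_endo_extend b :
  endo_comp (proj_endo E I') (endo_extend b) = endo_extend b.
Proof.
rewrite -endo_extend_id -endo_extend_comp.
by congr endo_extend; apply: endo_ext.
Qed.

Section OnFamilies.
Variables (A : comAlgType k) (M : mls_fam E v o A).

Let eM : lmodType A := fixed (act M (proj_endo E I')).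

Fact corner_act_subproof (b : endo EJ) (m : eM) :
  act M (endo_extend b) (val m) \in fixed_pred (act M (proj_endo E I')).
Proof. by rewrite inE -act_comp proj_endo_extend. Qed.

Definition corner_act_fun (b : endo EJ) (m : eM) : eM :=
  exist _ (act M (endo_extend b) (val m)) (corner_act_subproof b m).

Fact corner_act_linear b : linear (corner_act_fun b).
Proof.
move=> a m n; apply: val_inj.
by rewrite val_fixedP /= -linearP -val_fixedP.
Qed.

HB.instance Definition _ b :=
  GRing.isLinear.Build A eM eM _ (corner_act_fun b) (corner_act_linear b).

Definition corner_act (b : endo EJ) : {linear eM -> eM} := corner_act_fun b.

Lemma act_proj_sub (i : I) (m : M) : i \in I' ->
  act M (proj_endo E I') (act M (proj_endo E [set i]) m)
  = act M (proj_endo E [set i]) m.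
Proof.
move=> Ii; rewrite -act_comp; congr (act M _ m).
apply: endo_ext => B x s j /=; rewrite inE.
by case: eqP => [->|_]; [rewrite Ii | case: ifP].
Qed.

Section Rank.
Variable j : J.
Let ejM : lmodType A := fixed (act M (proj_endo E [set val j])).
Let ejeM : lmodType A := fixed (corner_act (proj_endo EJ [set j])).

Fact rank_fwd_subproof (m : ejM) :
  val m \in fixed_pred (act M (proj_endo E I')).
Proof.
have /eqP mj : act M (proj_endo E [set val j]) (val m) == val m := valP m.
by rewrite inE -mj act_proj_sub ?(valP j).
Qed.

Fact rank_fwd_subproof2 (m : ejM) :
  (exist _ (val m) (rank_fwd_subproof m) : eM)
    \in fixed_pred (corner_act (proj_endo EJ [set j])).
Proof. by rewrite inE -val_eqE /= endo_extend_proj; apply: (valP m). Qed.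

Definition rank_fwd (m : ejM) : ejeM :=
  exist (fun n => n \in fixed_pred (corner_act (proj_endo EJ [set j]))) _
    (rank_fwd_subproof2 m).

Fact rank_bwd_subproof (m : ejeM) :
  val (val m) \in fixed_pred (act M (proj_endo E [set val j])).
Proof.
have /eqP/(congr1 val) mj : corner_act (proj_endo EJ [set j]) (val m) == val m
  := valP m.
by rewrite inE; apply/eqP; rewrite -[RHS]mj /= endo_extend_proj.
Qed.

Definition rank_bwd (m : ejeM) : ejM :=
  exist (fun n => n \in fixed_pred (act M (proj_endo E [set val j]))) _
    (rank_bwd_subproof m).

Fact rank_fwd_linear : linear rank_fwd.
Proof.
move=> a m n; do 2 apply: val_inj.
by rewrite !val_fixedP; apply: val_fixedP.
Qed.

HB.instance Definition _ :=
  GRing.isLinear.Build A ejM ejeM _ rank_fwd rank_fwd_linear.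

Lemma corner_rank : locally_free ejeM (vJ j).
Proof.
apply: (@locally_free_iso _ ejM ejeM _ rank_fwd rank_bwd) => [m|m|].
- exact: val_inj.
- by do 2 apply: val_inj.
- exact: mls_rank.
Qed.
End Rank.

Fact to_corner_subproof (m : M) :
  act M (proj_endo E I') m \in fixed_pred (act M (proj_endo E I')).
Proof.
rewrite inE -act_comp; apply/eqP; congr (act M _ m).
by apply: endo_ext => B x s j /=; case: (j \in I').
Qed.

Definition to_corner (m : M) : eM :=
  exist (fun n => n \in fixed_pred (act M (proj_endo E I'))) _
    (to_corner_subproof m).

Fact to_corner_linear : linear to_corner.
Proof. by move=> a m n; apply: val_inj; rewrite val_fixedP /= linearP. Qed.

HB.instance Definition _ :=
  GRing.isLinear.Build A M eM _ to_corner to_corner_linear.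

Fact corner_gen_subproof : gen M \in fixed_pred (act M (proj_endo E I')).
Proof. by rewrite inE -{1}gen_fixed act_proj_sub // gen_fixed. Qed.

Definition corner_gen : eM := exist _ (gen M) corner_gen_subproof.

Definition corner : mls_fam EJ vJ oJ A.
Proof.
exists eM corner_act corner_gen.
- move=> m; apply: val_inj; rewrite /= endo_extend_id.
  exact/eqP/(valP m).
- by move=> b c m; apply: val_inj; rewrite /= endo_extend_comp act_comp.
- by move=> b c m; apply: val_inj; rewrite /= endo_extend_add act_add.
- by move=> c b m; apply: val_inj; rewrite /= endo_extend_scale act_scale.
- exact: corner_rank.
- by apply: val_inj; rewrite /= endo_extend_proj gen_fixed.
- move=> m /(congr1 val); rewrite /= endo_extend_proj.
  move=> /gen_basis[a [ma ua]]; exists a; split; first exact: val_inj.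
  by move=> a' /(congr1 val) /= /ua.
- move=> m; have [n [a [b mab]]] := gen_generates (val m).
  exists n, a, (fun j => endo_compress (b j)); apply: val_inj.
  have /eqP <- : act M (proj_endo E I') (val m) == val m := valP m.
  rewrite {1}mab !linear_sum; apply: eq_bigr => j _.
  rewrite linearZ; congr (_ *: _).
  rewrite [RHS]/= endo_extend_compress !act_comp.
  by have /eqP -> := corner_gen_subproof.
Defined.

End OnFamilies.

Section OnArrows.
Variables (A A' : comAlgType k) (phi : {lrmorphism A -> A'}).
Variables (M : mls_fam E v o A) (M' : mls_fam E v o A') (u : mls_arr phi M M').

Fact corner_arr_subproof (m : corner M) :
  u (val m) \in fixed_pred (act M' (proj_endo E I')).
Proof. by rewrite inE -mls_fun_act (eqP (valP m)). Qed.

Definition corner_arr_fun (m : corner M) : corner M' :=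
  exist _ (u (val m)) (corner_arr_subproof m).

Fact corner_arr_base_change : base_change phi corner_arr_fun.
Proof.
have [ulin uuniv] := mls_fun_base_change u.
split=> [a m n|N h hlin].
  by apply: val_inj; rewrite val_fixedP /= -ulin -val_fixedP.
have [|h' [h'u h'uniq]] := uuniv N (fun m => h (to_corner m)).
  by move=> a m n; rewrite linearP hlin.
exists (h' \o (val : corner M' -> M')); split=> [m|h'' h''u n] /=.
  by rewrite h'u; congr (h _); apply: val_inj; apply/eqP/(valP m).
have h'E : h'' \o @to_corner _ M' =1 h'.
  apply: h'uniq => m /=; rewrite -h''u; congr (h'' _); apply: val_inj.
  by rewrite /= mls_fun_act.
rewrite -h'E /=; congr (h'' _); apply: val_inj.
exact/esym/eqP/(valP n).
Qed.

Definition corner_arr : mls_arr phi (corner M) (corner M').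
Proof.
exists corner_arr_fun; first exact: corner_arr_base_change.
  by move=> b m; apply: val_inj; rewrite /= mls_fun_act.
by apply: val_inj; rewrite /= mls_fun_gen.
Defined.

End OnArrows.

Definition cornering : morphism (mls E v o) (mls EJ vJ oJ) :=
  @Morphism (mls E v o) (mls EJ vJ oJ) corner corner_arr.

End Cornering.
End Moduli.

Section GHilbertScheme.
Variables (k : closedFieldType) (gT : finGroupType).
Variable V : mx_representation k [set: gT] 2.

(* The left action (g . p)(w) = p(g^-1 w) on functions on the plane. *)
Definition coord_act (A : comAlgType k) (g : gT) (p : {mpoly A[2]}) : {mpoly A[2]} :=
  p \mPo [tuple \sum_(j < 2) ((V g^-1%g i j)%:A : A) *: 'X_j | i < 2].

(* Families over Spec A of G-equivariant sheaves O_Z, with Z a closed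
   subscheme of the plane and Gamma(O_Z) the regular representation of G:
   Gamma(O_Z) is an equivariant quotient of A[x, y] which is locally on
   Spec A isomorphic to the group ring of G. *)
Record ghilb_fam (A : comAlgType k) := GHilbFam {
  gamma :> comAlgType A;
  quo : {lrmorphism {mpoly A[2]} -> gamma};
  quo_surj : forall q, exists p, quo p = q;
  gact : gT -> gamma -> gamma;
  gact_quo : forall g p, gact g (quo p) = quo (coord_act g p);
  gamma_regular : exists S : A -> Prop, generates_unit_ideal S /\
    forall f, S f -> exists q : gamma, local_basis f (fun g => gact g q) }.

Record ghilb_arr (A A' : comAlgType k) (phi : {lrmorphism A -> A'})
    (Z : ghilb_fam A) (Z' : ghilb_fam A') := GHilbArr {
  ghilb_fun :> Z -> Z';
  ghilb_fun_base_change : base_change phi ghilb_fun;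
  ghilb_fun_quo : forall p, ghilb_fun (quo Z p) = quo Z' (map_mpoly phi p) }.

Definition ghilb : moduli k := {| fam := ghilb_fam; arr := ghilb_arr |}.

Lemma coord_act_map (A A' : comAlgType k) (phi : {lrmorphism A -> A'}) g p :
  map_mpoly phi (coord_act g p) = coord_act g (map_mpoly phi p).
Proof.
rewrite /coord_act.
elim/mpolyind: p => [|c m p _ _ IHp]; first by rewrite !raddf0.
rewrite !raddfD /= IHp; congr (_ + _).
rewrite map_mpolyZ map_mpolyX !comp_mpolyZ map_mpolyZ; congr (_ *: _).
rewrite !comp_mpolyX rmorph_prod; apply: eq_bigr => i _.
rewrite rmorphXn; congr (_ ^+ _); rewrite !tnth_mktuple raddf_sum.
apply: eq_bigr => j _; rewrite /= map_mpolyZ map_mpolyX.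
by congr (_ *: _); exact: rmorph_alg.
Qed.

Lemma gact_linear (A : comAlgType k) (Z : ghilb_fam A) g : linear (@gact A Z g).
Proof.
move=> a q q'; have [p <-] := quo_surj q; have [p' <-] := quo_surj q'.
rewrite -linearP !gact_quo -linearP /coord_act.
by rewrite comp_mpolyD comp_mpolyZ.
Qed.

Section Tautological.
Variables (n : nat) (W : mx_representation k [set: gT] n).

Section Sections.
Variables (A : comAlgType k) (Z : ghilb_fam A).

(* s j is the image of the j-th basis vector of W under a linear map to
   Gamma(O_Z), which is required to be G-equivariant. *)
Definition equivariant : {pred {ffun 'I_n -> Z}} :=
  [pred s : {ffun 'I_n -> Z} | [forall g, [forall j,
    gact g (s j) == \sum_i ((W g i j)%:A : A) *: s i]]].

Fact equivariant_closed : submod_closed equivariant.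
Proof.
split=> [|a s t].
  rewrite inE; apply/forallP=> g; apply/forallP=> j; rewrite ffunE.
  have := gact_linear g (-1) 0 (0 : Z); rewrite scaler0 add0r scaleN1r addNr => ->.
  by rewrite big1 // => i _; rewrite ffunE scaler0.
rewrite !inE => /forallP es /forallP et; apply/forallP=> g; apply/forallP=> j.
rewrite !ffunE gact_linear (eqP (forallP (es g) j)) (eqP (forallP (et g) j)).
rewrite scaler_sumr -big_split; apply/eqP/eq_bigr => i _ /=.
by rewrite !ffunE scalerDr !scalerA mulrC.
Qed.

HB.instance Definition _ :=
  GRing.isSubmodClosed.Build A {ffun 'I_n -> Z} equivariant equivariant_closed.

Definition taut_sec := {s : {ffun 'I_n -> Z} | s \in equivariant}.
HB.instance Definition _ := SubType.on taut_sec.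
HB.instance Definition _ := Choice.on taut_sec.
HB.instance Definition _ := [SubChoice_isSubLmodule of taut_sec by <:].

Lemma val_tautP a (s t : taut_sec) : val (a *: s + t) = a *: val s + val t.
Proof. exact: linearP. Qed.

End Sections.

Section Restriction.
Variables (A A' : comAlgType k) (phi : {lrmorphism A -> A'}).
Variables (Z : ghilb_fam A) (Z' : ghilb_fam A') (u : ghilb_arr phi Z Z').

Fact taut_res_subproof (s : taut_sec Z) :
  [ffun j => u (val s j)] \in @equivariant A' Z'.
Proof.
rewrite inE; apply/forallP=> g; apply/forallP=> j; rewrite ffunE.
have u_act q : u (gact g q) = gact g (u q).
  have [p <-] := quo_surj q.
  by rewrite gact_quo !ghilb_fun_quo coord_act_map gact_quo.
have [ulin _] := ghilb_fun_base_change u.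
have u0 : u 0 = 0 by apply: (addIr (u 0)); have := ulin 1 0 0;
  rewrite scale1r rmorph1 scale1r !add0r => <-.
have uD x y : u (x + y) = u x + u y.
  by have := ulin 1 x y; rewrite !scale1r rmorph1 scale1r.
have uZ a x : u (a *: x) = phi a *: u x by have := ulin a x 0; rewrite u0 !addr0.
rewrite -u_act (eqP (forallP (forallP (valP s) g) j)).
rewrite (big_morph u uD u0); apply/eqP/eq_bigr => i _.
by rewrite uZ rmorph_alg ffunE.
Qed.

Definition taut_res (s : taut_sec Z) : taut_sec Z' :=
  exist (fun t => t \in @equivariant A' Z') _ (taut_res_subproof s).

Fact taut_res_semilinear : semilinear phi taut_res.
Proof.
move=> a s t; apply: val_inj; rewrite val_tautP; apply/ffunP=> j.
have [ulin _] := ghilb_fun_base_change u.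
by rewrite !ffunE ulin.
Qed.

End Restriction.

(* T_W = Hom_G(W, Gamma(O_Z)), the multiplicity bundle of W in the
   tautological bundle. *)
Definition taut : omodule ghilb :=
  @OModule k ghilb (fun A Z => taut_sec Z) taut_res taut_res_semilinear.

End Tautological.

(* Irreducible representations up to isomorphism are indexed by the isotypic
   components of the regular representation. *)
Definition Irr : irrType k [set: gT] := DecSocleType (regular_repr k [set: gT]).

Definition special (rho : Irr) : Prop := H1_dual_vanishes (taut (irr_repr rho)).

Definition Sp := {rho : Irr | `[< special rho >]}.
HB.instance Definition _ := Finite.on Sp.

Definition taut_Sp (rho : Sp) : omodule ghilb := taut (irr_repr (val rho)).

Definition rank_Sp (rho : Sp) : nat := irr_degree (val rho).

(* A pseudo-reflection is a nontrivial element fixing a line pointwise. *)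
Definition no_pseudoreflections : Prop :=
  forall g, \rank (V g - 1%:M) <> 1%N.

End GHilbertScheme.

(* Main.v *)
(* If some special rho differs from rho_0: a 0-generated module M is spanned by
   Be_0, so it is determined by the kernels of e_i Be_0 -> e_i M, hence by its
   corners.  Families (M_rho) of corners glue if and only if the characters of
   e_0 B e_0 on the e_0 M_rho agree and the submodule of relations in Be_0 is
   B-stable.  As the e_i M_rho are locally direct summands of free modules,
   these are equations between functions on the base: they cut out a closed
   subscheme, over which the family is the image of an idempotent matrix.

   If rho_0 were the only special representation, then B = H^0(O) for the
   G-Hilbert scheme.  Since G acts freely off the origin, regular functions
   restrict to the punctured plane, so by Hartogs the multiplication map
   S^G -> B, where S = C[x, y], has a left inverse B -> S^G, and formal
   smoothness of M(T_Sp) passes to S^G.  Let f be an invariant containing a monomial m of the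
   least positive degree.  The coefficient of m is a derivation of S^G at the
   origin; it lifts to a derivation D : S^G -> S, so (D f)(0) <> 0.  Because
   S^G -> S is etale off the origin, D = a d/dx + b d/dy with a, b in S by
   Hartogs; and the gradient of f vanishes at 0, as G fixes no linear form.
   This is a contradiction. *)

From Pilot Require Import Defs.
From HB Require Import structures.
From mathcomp Require Import all_boot all_order all_algebra all_fingroup.
From mathcomp Require Import mxrepresentation mpoly fraction.
From mathcomp Require Import boolp reals complex ring.
Import Pilot.Defs.

Set Implicit Arguments.
Unset Strict Implicit.
Unset Printing Implicit Defensive.

Import GRing.Theory.
Local Open Scope ring_scope.

(** * Locally free modules *)

(** A second special representation supplies a corner from which the character of e_0 B e_0 can be
    read; without one the target is the empty product, and the case has to be refuted. In the
    gluing, bundles have bases only locally while the equations must be global: a partition of unity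
    turns local bases into a finite dual basis with global functionals. The vectors of this dual
    basis must also make sense in all families at once; 0-generation lets them be c gen with c in B,
    so one finite list of c's serves the given corners, every family with these corners, and the
    glued module. In the refutation B is never computed. An endomorphism is known through its action
    on families, and it is evaluated at free orbits, defined over the localizations of S at a
    coordinate and over its fraction field. Etaleness off the origin takes an explicit form:
    differentials of traces of monomials, with coefficients found by interpolation along an orbit,
    generate X_i^N dX_l. That a derivation is linear in the gradient comes from the algebraic
    dependence of any three polynomials in two variables. *)

Section CommutativeAlgebra.
Variable A : comNzRingType.

(** The radical of J is an ideal containing S, hence contains 1. For J an annihilator this turns
    local vanishing into vanishing; for J generated by powers it yields partitions of unity. *)
Lemma radical_unit_ideal (S J : A -> Prop) :
  generates_unit_ideal S -> ideal J ->
  (forall f, S f -> exists N, J (f ^+ N)) -> J 1.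
Proof.
move=> [n [c [s [Ss s1]]]] [J0 JD JM] SJ.
pose rad a := exists N, J (a ^+ N).
have radM a b : rad b -> rad (a * b).
  by move=> [N JN]; exists N; rewrite exprMn; apply/JM.
have radD a b : rad a -> rad b -> rad (a + b).
  move=> [N JN] [P JP]; exists (N + P)%N; rewrite exprDn.
  elim/big_ind: _ => //= -[i /= ltiNP] _.
  rewrite -mulr_natl; apply/JM; have [leiP|ltPi] := leqP i P.
    have -> : (N + P - i = (P - i) + N)%N by rewrite addnC addnBAC.
    by rewrite exprD mulrAC; apply/JM.
  by rewrite -(subnKC (ltnW ltPi)) exprD mulrA mulrAC; apply/JM.
have [N] : rad 1.
  rewrite -s1; elim/big_ind: _ => [|//|i _]; first by exists 1%N; rewrite expr1.
  by apply/radM; apply/SJ.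
by rewrite expr1n.
Qed.

Lemma locally_zero (M : lmodType A) (S : A -> Prop) (m : M) :
  generates_unit_ideal S ->
  (forall f, S f -> exists N, f ^+ N *: m = 0) -> m = 0.
Proof.
move=> S1 Sm; rewrite -[m]scale1r.
apply: (radical_unit_ideal (J := fun a => a *: m = 0) S1) => //.
split=> [|a b am bm|a b bm]; first by rewrite scale0r.
  by rewrite scalerDl am bm addr0.
by rewrite -scalerA bm scaler0.
Qed.

Lemma generates_powers (n : nat) (c f : 'I_n -> A) (N : 'I_n -> nat) :
  \sum_i c i * f i = 1 -> exists c', \sum_i c' i * f i ^+ N i = 1.
Proof.
move=> cf; pose J a := exists c', a = \sum_i c' i * f i ^+ N i.
suff [c' ->] : J 1 by exists c'.
apply: (@radical_unit_ideal (fun a => exists i, a = f i)).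
- by exists n, c, f; split=> // i; exists i.
- split=> [|a b [ca ->] [cb ->]|a b [cb ->]].
  + by exists (fun=> 0); rewrite big1 // => i _; rewrite mul0r.
  + exists (fun i => ca i + cb i); rewrite -big_split.
    by apply: eq_bigr => i _; rewrite mulrDl.
  + exists (fun i => a * cb i); rewrite mulr_sumr.
    by apply: eq_bigr => i _; rewrite mulrA.
- move=> _ [i ->]; exists (N i), (fun j => (j == i)%:R).
  rewrite (bigD1 i) //= eqxx mul1r big1 ?addr0 // => j /negPf->.
  by rewrite mul0r.
Qed.

Definition linear_of (M N : lmodType A) (h : M -> N) (hl : linear h) :
    {linear M -> N} :=
  HB.pack h (GRing.isLinear.Build A M N *:%R h hl).

(** Exponents that clear denominators are found one index at a time; since they may be raised,
    finitely many indices share one. *)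
Lemma uniform_bound (T : finType) (P : T -> nat -> Prop) :
  (forall t n, P t n -> P t n.+1) -> (forall t, exists n, P t n) ->
  exists n, forall t, P t n.
Proof.
move=> PS /choice[N PN]; exists (\max_t N t) => t.
have /subnK <- : (N t <= \max_t N t)%N by apply: leq_bigmax.
by elim: (_ - _)%N => [|p IHp] //; rewrite addSn; apply: PS.
Qed.

Section Combinations.
Variables (M : lmodType A) (n : nat).

Definition comb (c : 'rV[A]_n) (b : 'I_n -> M) : M := \sum_t c 0 t *: b t.

Lemma combD c c' b : comb (c + c') b = comb c b + comb c' b.
Proof.
by rewrite -big_split; apply: eq_bigr => t _; rewrite mxE scalerDl.
Qed.

Lemma combZ a c b : comb (a *: c) b = a *: comb c b.
Proof. by rewrite scaler_sumr; apply: eq_bigr => t _; rewrite mxE scalerA. Qed.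

Lemma combB c c' b : comb (c - c') b = comb c b - comb c' b.
Proof. by rewrite combD -[- c']scaleN1r combZ scaleN1r. Qed.

Lemma comb_sum (T : finType) (a : T -> A) (c : T -> 'rV_n) b :
  comb (\sum_t a t *: c t) b = \sum_t a t *: comb (c t) b.
Proof.
elim/big_rec2: _ => [|t m d _ <-]; last by rewrite combD combZ.
by rewrite /comb big1 // => t _; rewrite mxE scale0r.
Qed.

Lemma comb_delta t b : comb (delta_mx 0 t) b = b t.
Proof.
rewrite /comb (bigD1 t) //= mxE !eqxx scale1r big1 ?addr0 // => s /negPf st.
by rewrite mxE eqxx st scale0r.
Qed.

Lemma comb_mulmx (p : nat) (c : 'rV[A]_p) (D : 'M[A]_(p, n)) b :
  comb (c *m D) b = \sum_s c 0 s *: comb (row s D) b.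
Proof.
rewrite /comb; under eq_bigr do rewrite mxE scaler_suml.
rewrite exchange_big; apply: eq_bigr => s _; rewrite scaler_sumr.
by apply: eq_bigr => t _; rewrite !mxE scalerA.
Qed.

Lemma local_basis_span f b (m : M) : local_basis f b ->
  exists N (c : 'rV_n), f ^+ N *: m = comb c b.
Proof.
move=> [+ _] => /(_ m)[N [c cE]]; exists N, (\row_t c t).
by rewrite cE; apply: eq_bigr => t _; rewrite mxE.
Qed.

Lemma local_basis_indep f b (c : 'rV_n) : local_basis f b ->
  comb c b = 0 -> exists N, f ^+ N *: c = 0.
Proof.
move=> [_ +] => /(_ (fun t => c 0 t)) + cb => /(_ cb)[N fc]; exists N.
by apply/rowP => t; rewrite !mxE fc.
Qed.

Lemma local_basis_transition f b (p : nat) (b' : 'I_p -> M) : local_basis f b ->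
  exists P (D : 'M[A]_(p, n)), forall s, f ^+ P *: b' s = comb (row s D) b.
Proof.
move=> fb; pose Q s P := exists c : 'rV_n, f ^+ P *: b' s = comb c b.
have [] := @uniform_bound 'I_p Q.
- move=> s P [c bc]; exists (f *: c).
  by rewrite combZ -bc exprS scalerA.
- by move=> s; have [N [c ?]] := local_basis_span (b' s) fb; exists N, c.
- move=> P /choice[c cP]; exists P, (\matrix_s c s) => s.
  by rewrite rowK cP.
Qed.

End Combinations.

(* The module of sections of a rank n bundle has, on each member of a cover
   by principal opens, a basis and coordinates that extend to global sections
   after multiplication by a power of f.  The coordinates with respect to b
   are glued from those with respect to the other local bases. *)
Lemma local_coordinates (M : lmodType A) (n r : nat) (a f : 'I_r -> A)
    (b : 'I_r -> 'I_n -> M) (i : 'I_r) :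
  \sum_j a j * f j = 1 -> (forall j, local_basis (f j) (b j)) ->
  exists (g : nat) (z : {linear M -> 'rV[A]_n}),
    (forall m, f i ^+ g *: m = comb (z m) (b i)) /\
    (forall t, z (b i t) = f i ^+ g *: delta_mx 0 t).
Proof.
move=> af fb.
have cover : generates_unit_ideal (fun c => exists j, c = f j).
  by exists r, a, f; split=> // j; exists j.
(* [D j] writes [b j] in terms of [b i] with denominator [f i ^+ P]; [E (j, l)] below writes [b j]
   in terms of [b l] with denominator [f l ^+ P']. *)
have [P DP] : exists P, forall j, exists D : 'M[A]_n,
    forall s, f i ^+ P *: b j s = comb (row s D) (b i).
  apply: (uniform_bound (P := fun j P => exists D : 'M[A]_n,
    forall s, f i ^+ P *: b j s = comb (row s D) (b i))) => [j P [D DE]|j].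
    exists (f i *: D) => s.
    by rewrite linearZ /= combZ -DE exprS scalerA.
  by have [P [D]] := local_basis_transition (b j) (fb i); exists P, D.
have {DP} [D DE] := choice DP.
have [P' EP] : exists P, forall jl : 'I_r * 'I_r, exists E : 'M[A]_n,
    forall s, f jl.2 ^+ P *: b jl.1 s = comb (row s E) (b jl.2).
  apply: (uniform_bound (P := fun (jl : 'I_r * 'I_r) P => exists E : 'M[A]_n,
    forall s, f jl.2 ^+ P *: b jl.1 s = comb (row s E) (b jl.2)))
    => [jl P'' [E EE]|jl].
    exists (f jl.2 *: E) => s.
    by rewrite linearZ /= combZ -EE exprS scalerA.
  by have [P'' [E]] := local_basis_transition (b jl.1) (fb jl.2); exists P'', E.
have {EP} [E EE] := choice EP.
have combDj j (c : 'rV_n) : comb (c *m D j) (b i) = f i ^+ P *: comb c (b j).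
  rewrite comb_mulmx scaler_sumr; apply: eq_bigr => s _.
  by rewrite -DE !scalerA mulrC.
have combEjl j l (c : 'rV_n) :
    comb (c *m E (j, l)) (b l) = f l ^+ P' *: comb c (b j).
  rewrite comb_mulmx scaler_sumr; apply: eq_bigr => s _.
  by rewrite -(EE (j, l)) !scalerA mulrC.
(* The cocycle identity for the transition matrices holds only up to [f i]-power torsion, because
   coordinates in [b i] are unique only up to it; [Q] kills this torsion. *)
have [Q QE] : exists Q, forall jls : 'I_r * 'I_r * 'I_n,
    f i ^+ Q *: row jls.2 (E jls.1 *m D jls.1.2 - f jls.1.2 ^+ P' *: D jls.1.1)
      = 0.
  apply: (uniform_bound (P := fun (jls : 'I_r * 'I_r * 'I_n) Q =>
    f i ^+ Q *: row jls.2
      (E jls.1 *m D jls.1.2 - f jls.1.2 ^+ P' *: D jls.1.1) = 0))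
    => [jls Q fQ|[[j l] s]].
    by rewrite exprS -scalerA fQ scaler0.
  apply: (local_basis_indep (fb i)) => /=.
  rewrite linearB linearZ /= combB combZ row_mul combDj.
  by rewrite -(EE (j, l)) -DE !scalerA mulrC subrr.
have {}QE j l : f i ^+ Q *: (E (j, l) *m D l) = f i ^+ Q *: (f l ^+ P' *: D j).
  apply/row_matrixP => s; apply/eqP; rewrite -subr_eq0 -linearB -scalerBr.
  by rewrite linearZ /= (QE (j, l, s)).
(* On each D(f j), [z] is [f i ^+ (Q + P)] times the [b i]-coordinates of [m], computed through
   [b j]. [Z m z] determines [z] by [Z0], so linearity of the choice made below is automatic. *)
pose Z m (z : 'rV[A]_n) := forall j, exists N c,
  f j ^+ N *: m = comb c (b j) /\ f j ^+ N *: z = f i ^+ Q *: (c *m D j).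
have Zlin x m m' z z' : Z m z -> Z m' z' -> Z (x *: m + m') (x *: z + z').
  move=> mz mz' j; have [N [c [cm cz]]] := mz j; have [N' [c' [cm' cz']]] := mz' j.
  exists (N + N')%N, ((x * f j ^+ N') *: c + f j ^+ N *: c').
  rewrite combD !combZ -cm -cm' !scalerDr mulmxDl -!scalemxAl; split.
    by rewrite !scalerA exprD; congr (_ *: _ + _ *: _); ring.
  have -> : f j ^+ (N + N') *: (x *: z) + f j ^+ (N + N') *: z' =
      (x * f j ^+ N') *: (f j ^+ N *: z) + f j ^+ N *: (f j ^+ N' *: z').
    by rewrite !scalerA exprD; congr (_ *: _ + _ *: _); ring.
  by rewrite cz cz' !scalerDr !scalerA; congr (_ *: _ + _ *: _); ring.
have Z0 z : Z 0 z -> z = 0.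
  move=> z0; apply: (locally_zero cover) => _ [j ->].
  have [N [c [c0 cz]]] := z0 j.
  have [|R fc] := local_basis_indep (c := c) (fb j).
    by rewrite -c0 scaler0.
  exists (R + N)%N; rewrite exprD -scalerA cz !scalerA mulrC -scalerA.
  by rewrite scalemxAl fc mul0mx scaler0.
have Zcomb m z : Z m z -> comb z (b i) = f i ^+ (Q + P) *: m.
  move=> mz; apply/eqP; rewrite -subr_eq0; apply/eqP.
  apply: (locally_zero cover) => _ [j ->].
  have [N [c [cm cz]]] := mz j; exists N.
  rewrite scalerBr -combZ cz combZ combDj -cm !scalerA -exprD.
  by rewrite mulrC subrr.
have Ztot m : exists z, Z m z.
  have [N NE] : exists N, forall j, exists c, f j ^+ N *: m = comb c (b j).
    apply: (uniform_bound (P := fun j N => exists c,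
      f j ^+ N *: m = comb c (b j))) => [j N [c cE]|j].
      by exists (f j *: c); rewrite exprS -scalerA cE combZ.
    by have [N [c cE]] := local_basis_span m (fb j); exists N, c.
  have {NE} [c cE] := choice NE.
  have [R RE] : exists R, forall jl : 'I_r * 'I_r, f jl.2 ^+ R *:
      (f jl.2 ^+ N *: (c jl.1 *m E jl) -
       (f jl.1 ^+ N * f jl.2 ^+ P') *: c jl.2) = 0.
    apply: (uniform_bound (P := fun (jl : 'I_r * 'I_r) R => f jl.2 ^+ R *:
      (f jl.2 ^+ N *: (c jl.1 *m E jl) -
       (f jl.1 ^+ N * f jl.2 ^+ P') *: c jl.2) = 0)) => [jl R fR|[j l]].
      by rewrite exprS -scalerA fR scaler0.
    apply: (local_basis_indep (fb l)); rewrite combB !combZ /= combEjl.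
    rewrite -!cE !scalerA -scalerBl [X in X *: m](_ : _ = 0) ?scale0r //; ring.
  pose z j := f i ^+ Q *: (c j *m D j).
  have zE j l : f l ^+ (R + P') *: (f l ^+ N *: z j)
              = f l ^+ (R + P') *: (f j ^+ N *: z l).
    have := RE (j, l); move/(congr1 (fun w => f i ^+ Q *: (w *m D l))).
    rewrite mul0mx scaler0 -scalemxAl mulmxBl -!scalemxAl -mulmxA.
    rewrite !scalerBr => /eqP; rewrite subr_eq0 => /eqP.
    have -> : f i ^+ Q *: (f l ^+ R *: (f l ^+ N *: (c j *m (E (j, l) *m D l))))
        = f l ^+ R *: (f l ^+ N *: (c j *m (f i ^+ Q *: (E (j, l) *m D l)))).
      by rewrite -scalemxAr !scalerA; congr (_ *: _); ring.
    rewrite QE -!scalemxAr => zz.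
    transitivity (f l ^+ R *: (f l ^+ N *: (f i ^+ Q *: (f l ^+ P' *: (c j *m D j))))).
      by rewrite /z !scalerA exprD; congr (_ *: _); ring.
    by rewrite zz /z !scalerA exprD; congr (_ *: _); ring.
  (* The exponent is the one in [zE]: weighting [z l] by [al l * f l ^+ (R + P')] makes [f j ^+ N]
     times the sum collapse to [z j]. *)
  have [al alE] := generates_powers (fun=> R + P' + N)%N af.
  exists (\sum_l (al l * f l ^+ (R + P')) *: z l) => j.
  exists N, (c j); split=> //.
  rewrite scaler_sumr -[RHS]/(z j) -[RHS]scale1r -alE scaler_suml.
  apply: eq_bigr => l _.
  transitivity (al l *: (f l ^+ (R + P') *: (f j ^+ N *: z l))).
    by rewrite !scalerA; congr (_ *: _); ring.
  by rewrite -zE !scalerA; congr (_ *: _); rewrite /= !exprD; ring.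
have [z zE] := choice Ztot.
have z_lin : linear z.
  move=> x m m'.
  have := Zlin (-1) _ _ _ _ (Zlin x _ _ _ _ (zE m) (zE m')) (zE (x *: m + m')).
  rewrite !scaleN1r addNr => /Z0/eqP.
  by rewrite addr_eq0 eqr_opp => /eqP ->.
(* Independence of [b i] gives the expected coordinates of its own vectors only up to a power of
   [f i], which is absorbed into the final exponent. *)
have [K KE] : exists K, forall t,
    f i ^+ K *: (z (b i t) - f i ^+ (Q + P) *: delta_mx 0 t) = 0.
  apply: (uniform_bound (P := fun t K =>
    f i ^+ K *: (z (b i t) - f i ^+ (Q + P) *: delta_mx 0 t) = 0))
    => [t K fK|t]; first by rewrite exprS -scalerA fK scaler0.
  apply: (local_basis_indep (fb i)).
  by rewrite combB combZ comb_delta (Zcomb _ _ (zE _)) subrr.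
have zK_lin : linear (fun m => f i ^+ K *: z m).
  by move=> x m m'; rewrite z_lin scalerDr !scalerA mulrC.
exists (K + (Q + P))%N, (linear_of zK_lin); split=> [m|t] /=.
  by rewrite combZ (Zcomb _ _ (zE _)) scalerA exprD.
have /eqP := KE t; rewrite scalerBr subr_eq0 => /eqP ->.
by rewrite scalerA -exprD.
Qed.

(** Replacing each [f i] by a power removes all existential exponents. The resulting identities are
    exact, so they can be transported along a ring morphism. *)
Lemma locally_free_coordinates (M : lmodType A) (n : nat) :
  locally_free M n -> exists (r : nat) (a g : 'I_r -> A)
    (b : 'I_r -> 'I_n -> M) (z : 'I_r -> {linear M -> 'rV[A]_n}),
  [/\ \sum_i a i * g i = 1, forall i m, g i *: m = comb (z i m) (b i)
    & forall i t, z i (b i t) = g i *: delta_mx 0 t].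
Proof.
move=> [S [[r [a [f [Sf af]]]] Sb]].
have /choice[b fb] : forall i, exists b : 'I_n -> M, local_basis (f i) b.
  by move=> i; apply: Sb.
have /choice[g gE] := fun i => local_coordinates i af fb.
have /choice[z zE] := gE.
have [a' a'E] := generates_powers g af.
exists r, a', (fun i => f i ^+ g i), b, z; split=> // i.
  by have [] := zE i.
by have [] := zE i.
Qed.

Lemma coordinates_locally_free (M : lmodType A) (n r : nat) (a g : 'I_r -> A)
    (b : 'I_r -> 'I_n -> M) (z : 'I_r -> {linear M -> 'rV[A]_n}) :
  \sum_i a i * g i = 1 -> (forall i m, g i *: m = comb (z i m) (b i)) ->
  (forall i t, z i (b i t) = g i *: delta_mx 0 t) -> locally_free M n.
Proof.
move=> ag gz zb; exists (fun c => exists i, c = g i); split.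
  by exists r, a, g; split=> // i; exists i.
move=> _ [i ->]; exists (b i); split=> [m|c cb].
  by exists 1%N, (z i m 0); rewrite expr1 gz.
exists 1%N => t; have := congr1 (fun m => z i m 0 t) cb.
rewrite linear0 mxE linear_sum summxE => <-; rewrite expr1 (bigD1 t) //=.
rewrite linearZZ zb !mxE !eqxx mulr1 mulrC big1 ?addr0 // => s st.
by rewrite linearZZ zb !mxE eq_sym (negPf st) !mulr0.
Qed.

(** Weighting the local coordinates by the partition of unity [a] gives a dual basis of globally
    defined functionals. *)
Lemma locally_free_projective (M : lmodType A) (n : nat) : locally_free M n ->
  exists (T : finType) (l : T -> {linear M -> A^o}) (b : T -> M),
    forall m, m = \sum_t l t m *: b t.
Proof.
move=> /locally_free_coordinates[r [a [g [b [z [ag gz zb]]]]]].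
have lin (it : 'I_r * 'I_n) : linear (fun m => a it.1 * z it.1 m 0 it.2 : A^o).
  by move=> x m m'; rewrite linearP !mxE mulrDr [x *: _]mulrCA.
exists ('I_r * 'I_n)%type, (fun it => linear_of (lin it)), (fun it => b it.1 it.2).
move=> m; rewrite -[LHS]scale1r -ag scaler_suml.
rewrite -(pair_bigA _ (fun i t => (a i * z i m 0 t) *: b i t)) /=.
apply: eq_bigr => i _; rewrite -scalerA gz scaler_sumr.
by apply: eq_bigr => t _; rewrite scalerA.
Qed.

End CommutativeAlgebra.

(** * Base change and module families *)

Section BaseChange.
Variables (A A' : comNzRingType) (phi : {rmorphism A -> A'}).

Lemma semilinear_sum (M : lmodType A) (N : lmodType A') (u : M -> N)
    (T : finType) (a : T -> A) (m : T -> M) :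
  semilinear phi u -> u (\sum_t a t *: m t) = \sum_t phi (a t) *: u (m t).
Proof.
move=> ul; have u0 : u 0 = 0.
  by apply: (addIr (u 0)); have := ul 1 0 0;
    rewrite scale1r rmorph1 scale1r !add0r => <-.
elim/big_rec2: _ => // t w m' _ <-.
by rewrite ul.
Qed.

Lemma semilinearZ (M : lmodType A) (N : lmodType A') (u : M -> N) a m :
  semilinear phi u -> u (a *: m) = phi a *: u m.
Proof.
move=> ul; have := semilinear_sum (T := 'I_1) (fun=> a) (fun=> m) ul.
by rewrite !big_ord1.
Qed.

(** A dual basis that is carried along [u] determines every semilinear map by its values at the
    [b t]; the universal property then needs no tensor product. *)
Lemma projective_base_change (N : lmodType A) (N' : lmodType A') (u : N -> N')
    (T : finType) (l : T -> N -> A) (b : T -> N)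
    (l' : T -> {linear N' -> A'^o}) :
  semilinear phi u -> (forall n, n = \sum_t l t n *: b t) ->
  (forall t n, l' t (u n) = phi (l t n)) ->
  (forall z, z = \sum_t l' t z *: u (b t)) -> base_change phi u.
Proof.
move=> ul lb l'u l'b; split=> // Q h hl.
have h'l : linear (fun z => \sum_t l' t z *: h (b t)).
  move=> a z z'; rewrite scaler_sumr -big_split; apply: eq_bigr => t _.
  by rewrite linearP scalerDl scalerA.
exists (linear_of h'l); split=> [n|h'' h''u z] /=.
  rewrite [in RHS](lb n) (semilinear_sum _ _ hl).
  by apply: eq_bigr => t _; rewrite l'u.
rewrite {1}(l'b z) linear_sum; apply: eq_bigr => t _.
by rewrite linearZZ h''u.
Qed.

Lemma base_change_functional (N : lmodType A) (N' : lmodType A') (u : N -> N')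
    (l : {linear N -> A^o}) : base_change phi u ->
  exists l' : {linear N' -> A'^o}, forall n, l' (u n) = phi (l n).
Proof.
move=> [_] /(_ A'^o (fun n => phi (l n)))[|l' [l'u _]]; last by exists l'.
by move=> a m n; rewrite linearP rmorphD rmorphM.
Qed.

End BaseChange.

Lemma iso_base_change (A : comNzRingType) (M N : lmodType A)
    (g : {linear M -> N}) (h : {linear N -> M}) :
  cancel g h -> cancel h g -> base_change (idfun : {rmorphism A -> A}) g.
Proof.
move=> gK hK; split=> [a m n|Q q ql]; first exact: linearP.
have qhl : linear (q \o h) by move=> a m n /=; rewrite linearP ql.
exists (linear_of qhl); split=> [m|q' q'g n] /=; first by rewrite gK.
by rewrite -q'g hK.
Qed.


Section FixedProjection.
Variables (A : comNzRingType) (M : lmodType A) (e : {linear M -> M}).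
Lemma fixedE (m : fixed e) : e (val m) = val m.
Proof. exact/eqP/(valP m). Qed.

Lemma val_fixedZ a (m : fixed e) : val (a *: m) = a *: val m.
Proof. exact: linearZ. Qed.

Lemma val_fixed_sum (T : finType) (m : T -> fixed e) :
  val (\sum_t m t) = \sum_t val (m t).
Proof. exact: raddf_sum. Qed.

Hypothesis idem : forall m, e (e m) = e m.

Definition to_fixed_fun (m : M) : fixed e :=
  exist (fun n => n \in fixed_pred e) (e m) (introT eqP (idem m)).

Fact to_fixed_linear : linear to_fixed_fun.
Proof. by move=> a m n; apply: val_inj; rewrite val_fixedP /= linearP. Qed.

Definition to_fixed : {linear M -> fixed e} := linear_of to_fixed_linear.

Lemma to_fixedK (m : fixed e) : to_fixed (val m) = m.
Proof. by apply: val_inj; apply: fixedE. Qed.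

End FixedProjection.

(** * Idempotents acting on families of modules *)

Section ModuleActions.
Variables (k : closedFieldType) (Y : moduli k) (I : finType).
Variables (E : I -> omodule Y).

Lemma endo_compA (b c d : endo E) :
  endo_comp b (endo_comp c d) = endo_comp (endo_comp b c) d.
Proof. exact: endo_ext. Qed.

Lemma endo_comp1l (b : endo E) : endo_comp (endo_id E) b = b.
Proof. exact: endo_ext. Qed.

Lemma endo_comp1r (b : endo E) : endo_comp b (endo_id E) = b.
Proof. exact: endo_ext. Qed.

Lemma endo_compDl (b c d : endo E) :
  endo_comp (endo_add b c) d = endo_add (endo_comp b d) (endo_comp c d).
Proof. exact: endo_ext. Qed.

Lemma endo_compZl x (b c : endo E) :
  endo_comp (endo_scale x b) c = endo_scale x (endo_comp b c).
Proof. exact: endo_ext. Qed.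

Lemma proj_endo_comp P Q :
  endo_comp (proj_endo E P) (proj_endo E Q) = proj_endo E (P :&: Q).
Proof.
by apply: endo_ext => A x s i /=; rewrite inE; case: (i \in P).
Qed.

Variables (v : I -> nat) (o : I).
Section Family.
Variables (A : comAlgType k) (M : mls_fam E v o A).

Lemma act_proj P Q m :
  act M (proj_endo E P) (act M (proj_endo E Q) m) = act M (proj_endo E (P :&: Q)) m.
Proof. by rewrite -act_comp proj_endo_comp. Qed.

Lemma act_proj_idem P m :
  act M (proj_endo E P) (act M (proj_endo E P) m) = act M (proj_endo E P) m.
Proof. by rewrite act_proj setIid. Qed.

Lemma act_projU (P Q : {set I}) m : [disjoint P & Q] ->
  act M (proj_endo E (P :|: Q)) m = act M (proj_endo E P) m + act M (proj_endo E Q) m.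
Proof.
move=> PQ; rewrite -act_add; congr (act M _ m); apply: endo_ext => B x s i /=.
rewrite inE; case: (boolP (i \in P)) => [iP|]; last by rewrite add0r.
by rewrite (disjointFr PQ iP) addr0.
Qed.

Lemma act_proj0 m : act M (proj_endo E set0) m = 0.
Proof.
apply: (addIr (act M (proj_endo E set0) m)).
by rewrite -act_projU ?setU0 ?add0r // -setI_eq0 setI0.
Qed.


Lemma act_sum_proj m : m = \sum_i act M (proj_endo E [set i]) m.
Proof.
have sumP (s : seq I) : uniq s ->
    act M (proj_endo E [set i in s]) m = \sum_(i <- s) act M (proj_endo E [set i]) m.
  elim: s => [_|i s IHs /= /andP[si us]].
    by rewrite big_nil -[RHS](act_proj0 m); congr (act M (proj_endo E _) m).
  rewrite big_cons -IHs // -act_projU; last by rewrite disjoints1 inE.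
  by congr (act M (proj_endo E _) m); apply/setP => j; rewrite !inE.
rewrite -big_enum -sumP ?enum_uniq // -{1}[m]act_id.
congr (act M _ m); apply: endo_ext => B x s i /=.
by rewrite inE mem_enum.
Qed.

Lemma mls_coordinate : exists l : {linear M -> A^o},
  forall m, act M (proj_endo E [set o]) m = l m *: gen M.
Proof.
have lP m : exists a, act M (proj_endo E [set o]) m = a *: gen M.
  have [a [ma _]] := gen_basis (act_proj_idem [set o] m).
  by exists a.
have [l lE] := choice lP.
suff ll : linear (l : M -> A^o) by exists (linear_of ll).
move=> a m n; have [x [_ xu]] := gen_basis (act_proj_idem [set o] (a *: m + n)).
rewrite -(xu _ (lE _)); apply: xu.
by rewrite linearP !lE scalerDl scalerA.
Qed.

Lemma scale_gen_inj (a b : A) : a *: gen M = b *: gen M -> a = b.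
Proof.
move=> ab; have [|x [_ xu]] := @gen_basis _ _ _ _ _ _ _ M (a *: gen M).
  by rewrite linearZZ gen_fixed.
by rewrite -(xu a) // -(xu b).
Qed.

End Family.
End ModuleActions.

(** * Evaluating endomorphisms on a family over a corner *)

Section CornerFamily.
Variables (k : closedFieldType) (Y : moduli k) (I : finType).
Variables (E : I -> omodule Y) (v : I -> nat) (o : I).
Variables (I' : {set I}) (oI' : o \in I').

Let J := {i : I | i \in I'}.
Let EJ (j : J) := E (val j).
Let vJ (j : J) := v (val j).
Let oJ : J := exist _ o oI'.

Lemma endo_extendK (b : endo EJ) : endo_compress I' (endo_extend b) = b.
Proof. by apply: endo_ext => A x s j /=; rewrite !dsum_extendK. Qed.

Lemma endo_compress_projl (P : {set I}) (b : endo E) :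
  endo_compress I' (endo_comp (proj_endo E P) b) =
  endo_comp (proj_endo EJ [set j | val j \in P]) (endo_compress I' b).
Proof. by apply: endo_ext => A x s j /=; rewrite inE. Qed.

Lemma endo_compress_projr (P : {set I}) (b : endo E) :
  endo_compress I' (endo_comp b (proj_endo E P)) =
  endo_comp (endo_compress I' b) (proj_endo EJ [set j | val j \in P]).
Proof.
apply: endo_ext => A x s j /=; congr (b A x _ (val j)).
apply: functional_extensionality_dep => i.
case: (boolP (i \in I')) => iI'; first by rewrite !(dsum_extend_in _ iI') inE.
by rewrite !dsum_extend_out //; case: ifP.
Qed.

Lemma endo_extend_projr (b : endo EJ) :
  endo_comp (endo_extend b) (proj_endo E I') = endo_extend b.
Proof.
rewrite -endo_extend_id -endo_extend_comp.
by congr endo_extend; apply: endo_ext.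
Qed.

Section Values.
Variables (A : comAlgType k) (N : mls_fam EJ vJ oJ A).

(** Only eBe acts on [N], but truncating b to ebe gives every b in B a value. If [N] is the corner
    of a B-module, this value is e b gen. *)
Definition ev (b : endo E) : N := act N (endo_compress I' b) (gen N).

Lemma ev_add b c : ev (endo_add b c) = ev b + ev c.
Proof. by rewrite -act_add; congr (act N _ _); apply: endo_ext. Qed.

Lemma ev_scale x b : ev (endo_scale x b) = x%:A *: ev b.
Proof. by rewrite -act_scale; congr (act N _ _); apply: endo_ext. Qed.

Lemma ev_id : ev (endo_id E) = gen N.
Proof.
rewrite -[RHS](act_id (gen N)); congr (act N _ _).
by apply: endo_ext => B x s j /=; rewrite dsum_extendK.
Qed.

Lemma ev_proj (P : {set I}) b :
  ev (endo_comp (proj_endo E P) b) =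
  act N (proj_endo EJ [set j | val j \in P]) (ev b).
Proof. by rewrite /ev endo_compress_projl act_comp. Qed.

Lemma set_preim1 (j : J) : [set j' : J | val j' \in [set val j]] = [set j].
Proof. by apply/setP => j'; rewrite !inE -val_eqE. Qed.

Lemma ev_projo b : ev (endo_comp b (proj_endo E [set o])) = ev b.
Proof.
rewrite /ev endo_compress_projr act_comp -[o]/(val oJ) set_preim1.
by rewrite gen_fixed.
Qed.

Lemma ev_extend (b : endo EJ) c :
  ev (endo_comp (endo_extend b) c) = act N b (ev c).
Proof.
rewrite -act_comp; congr (act N _ _).
by apply: endo_ext => B x s j /=; rewrite dsum_extendK.
Qed.

Lemma ev_span (n : N) : exists (r : nat) (a : 'I_r -> A) (b : 'I_r -> endo E),
  n = \sum_i a i *: ev (b i).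
Proof.
have [r [a [b ->]]] := gen_generates n; exists r, a, (fun i => endo_extend (b i)).
by apply: eq_bigr => i _; rewrite /ev endo_extendK.
Qed.

Lemma ev_ext (A' : comNzRingType) (phi : {rmorphism A -> A'}) (Q : lmodType A')
    (u w : N -> Q) : semilinear phi u -> semilinear phi w ->
  (forall b, u (ev b) = w (ev b)) -> u =1 w.
Proof.
move=> ul wl uw n; have [r [a [b ->]]] := ev_span n.
rewrite (semilinear_sum _ _ ul) (semilinear_sum _ _ wl).
by apply: eq_bigr => i _; rewrite uw.
Qed.

(** 0-generation expresses the vectors of any dual basis through values [ev]; moving the
    coefficients into the functionals leaves vectors that come from elements of B, which act on all
    families. *)
Lemma corner_dual_basis (j : J) :
  exists (T : finType) (l : T -> {linear N -> A^o}) (c : T -> endo E),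
    [/\ forall t, endo_comp (proj_endo E [set val j]) (c t) = c t,
        forall t n, l t (act N (proj_endo EJ [set j]) n) = l t n
      & forall n, act N (proj_endo EJ [set j]) n = \sum_t l t n *: ev (c t)].
Proof.
have [T [l [b lb]]] := locally_free_projective (mls_rank N j).
have /choice[r /choice[a /choice[c bE]]] :
    forall t, exists (r : nat) (a : nat -> A) (d : nat -> endo E),
    val (b t) = \sum_(i < r) a i *: ev (d i).
  move=> t; have [r [a [d ->]]] := ev_span (val (b t)).
  (* Functions on [nat] keep [r] out of their types, so that [choice] applies; the default values
     beyond [r] are never read. *)
  exists r, (fun i => if insub i is Some i' then a i' else 0).
  exists (fun i => if insub i is Some i' then d i' else endo_id E).
  by apply: eq_bigr => i _; rewrite valK.
pose pj := to_fixed (act_proj_idem (M := N) [set j]).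
have lin (ti : {t : T & 'I_(r t)}) :
    linear (fun n => a (tag ti) (tagged ti) * l (tag ti) (pj n) : A^o).
  by move=> x n n'; rewrite !linearP mulrDr; congr (_ + _); apply: mulrCA.
exists {t : T & 'I_(r t)}, (fun ti => linear_of (lin ti)),
  (fun ti => endo_comp (proj_endo E [set val j]) (c (tag ti) (tagged ti : 'I_(r (tag ti))))).
split=> [ti|ti n|n] /=.
- by rewrite endo_compA proj_endo_comp setIid.
- congr (_ * l _ _); apply: val_inj => /=; exact: act_proj_idem.
- transitivity (act N (proj_endo EJ [set j]) (\sum_t l t (pj n) *: val (b t))).
    rewrite -[LHS]act_proj_idem -[act N _ n]/(val (pj n)) {1}[pj n]lb.
    by rewrite raddf_sum.
  pose F t (i : 'I_(r t)) :=
    (a t i * l t (pj n)) *: ev (endo_comp (proj_endo E [set val j]) (c t i)).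
  transitivity (\sum_t \sum_i F t i); last by rewrite sig_big_dep.
  rewrite linear_sum; apply: eq_bigr => t _; rewrite linearZZ bE linear_sum.
  rewrite scaler_sumr; apply: eq_bigr => i _.
  by rewrite linearZZ scalerA mulrC /F ev_proj set_preim1.
Qed.
End Values.
End CornerFamily.

(** * Gluing along corners *)

Section ProductOfCornerings.
Variables (k : closedFieldType) (Y : moduli k) (I : finType).
Variables (E : I -> omodule Y) (v : I -> nat) (o : I).

Let J := {i : I | i != o}.
Let pt (j : J) : {set I} := [set o; val j].
Let Ej (j : J) (i : {i | i \in pt j}) := E (val i).
Let vj (j : J) (i : {i | i \in pt j}) := v (val i).
Let oj (j : J) : {i | i \in pt j} := exist _ o (set21 o (val j)).
Let jj (j : J) : {i | i \in pt j} := exist _ (val j) (set22 o (val j)).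

Local Notation "b \b c" := (endo_comp b c) (at level 40, left associativity).
Local Notation prj P := (proj_endo E P).

Section Coordinates.
Variable A : comAlgType k.

(** By [coord_proj] the functionals are extended by zero to the component at [o], so both kinds of
    coordinates are defined on all of [N]. *)
Record corner_coordinates (j : J) (N : mls_fam (@Ej j) (@vj j) (oj j) A) := {
  idx : finType;
  unit_coord : {linear N -> A^o};
  coord : idx -> {linear N -> A^o};
  coord_elt : idx -> endo E;
  unit_coordE : forall n,
    act N (proj_endo (@Ej j) [set oj j]) n = unit_coord n *: gen N;
  coord_eltE : forall t, prj [set val j] \b coord_elt t = coord_elt t;
  coord_proj : forall t n,
    coord t (act N (proj_endo (@Ej j) [set jj j]) n) = coord t n;
  coordE : forall n, act N (proj_endo (@Ej j) [set jj j]) n =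
    \sum_t coord t n *: ev N (coord_elt t) }.

Lemma corner_coordinates_exist (j : J) (N : mls_fam (@Ej j) (@vj j) (oj j) A) :
  inhabited (corner_coordinates N).
Proof.
have [u uE] := mls_coordinate N.
have [T [l [c [cE lp lE]]]] := corner_dual_basis N (jj j).
by split; exists T u l c.
Qed.

Variables (y : forall j, mls_fam (@Ej j) (@vj j) (oj j) A) (j0 : J).
Variable D : forall j, corner_coordinates (y j).

(** On e_0 B e_0 this is the character by which it acts on the line e_0 (y j); for general b it
    depends only on e_0 b e_0. *)
Definition chi j b : A := unit_coord (D j) (ev (y j) b).

(* The elements c_s, for s in [gens], generate the universal family as a
   module, and Lam s b is the coordinate of b gen at c_s gen. *)
Definition gens := option {j : J & idx (D j)}.

Definition Lam (s : gens) (b : endo E) : A :=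
  if s is Some jt then coord (tagged jt) (ev (y (tag jt)) b) else chi j0 b.

Definition gen_elt (s : gens) : endo E :=
  if s is Some jt then coord_elt (tagged jt) else prj [set o].

Local Notation gen_at t := (Some (Tagged (fun j => idx (D j)) t)).

Lemma sum_gens (V : nmodType) (F : gens -> V) :
  \sum_s F s = F None + \sum_(j : J) \sum_(t : idx (D j)) F (gen_at t).
Proof.
rewrite (bigD1 None) //= sig_big_dep /=; congr (_ + _).
rewrite (reindex_omap (I := gens) Some id) /=; last by case.
apply: eq_big => [x|[j t] _] //=.
by rewrite eqxx.
Qed.

Lemma Lam_add s b c : Lam s (endo_add b c) = Lam s b + Lam s c.
Proof. by case: s => [[j t]|]; rewrite /Lam /chi ev_add linearD. Qed.

Lemma Lam_scale s x b : Lam s (endo_scale x b) = x%:A * Lam s b.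
Proof. by case: s => [[j t]|]; rewrite /Lam /chi ev_scale linearZZ. Qed.

Lemma Lam_projo s b : Lam s (b \b prj [set o]) = Lam s b.
Proof. by case: s => [[j t]|]; rewrite /Lam /chi ev_projo. Qed.

Lemma unit_coord_gen j : unit_coord (D j) (gen (y j)) = 1.
Proof.
by apply/(scale_gen_inj (M := y j)); rewrite -unit_coordE scale1r gen_fixed.
Qed.

Lemma chi_projo j b : chi j (b \b prj [set o]) = chi j b.
Proof. by rewrite /chi ev_projo. Qed.

Lemma chi1 j : chi j (prj [set o]) = 1.
Proof. by rewrite -[prj _]endo_comp1l chi_projo /chi ev_id unit_coord_gen. Qed.

Lemma unit_coord_proj j n :
  unit_coord (D j) (act (y j) (proj_endo (@Ej j) [set oj j]) n) =
  unit_coord (D j) n.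
Proof.
by rewrite (unit_coordE (D j)) linearZZ unit_coord_gen; apply: mulr1.
Qed.

Lemma chi_proj j (P : {set I}) b :
  chi j (prj P \b b) = if o \in P then chi j b else 0.
Proof.
rewrite /chi ev_proj -unit_coord_proj act_proj.
rewrite (_ : _ :&: _ = if o \in P then [set oj j] else set0).
  by case: ifP => _; rewrite ?unit_coord_proj // act_proj0 linear0.
apply/setP => i; rewrite !inE; case: (i =P oj j) => [->|/eqP/negPf ij] /=.
  by case: ifP; rewrite !inE ?eqxx.
by case: ifP; rewrite !inE ?ij.
Qed.

Lemma coord_proj_set j (t : idx (D j)) (P : {set I}) b :
  coord t (ev (y j) (prj P \b b)) =
  if val j \in P then coord t (ev (y j) b) else 0.
Proof.
rewrite ev_proj -coord_proj act_proj.
rewrite (_ : _ :&: _ = if val j \in P then [set jj j] else set0).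
  by case: ifP => _; rewrite ?coord_proj // act_proj0 linear0.
apply/setP => i; rewrite !inE; case: (i =P jj j) => [->|/eqP/negPf ij] /=.
  by case: ifP; rewrite !inE ?eqxx.
by case: ifP; rewrite !inE ?ij.
Qed.

(** The first condition is agreement of the characters. The second says that the expansion of b0 gen
    in the c_s' gen remains true after acting by b, read in each coordinate s: this is B-stability
    of the relations. *)
Definition obstruction_vanishes (A' : comNzRingType) (phi : A -> A') : Prop :=
  (forall j b, phi (chi j b) = phi (chi j0 b)) /\
  (forall s b b0, phi (Lam s (b \b b0)) =
     \sum_s' phi (Lam s (b \b gen_elt s')) * phi (Lam s' b0)).

(** Taking everything killed by all solutions avoids listing generators. The defining equations are
    differences of elements of [A], and these differences lie in it, so killing it is the same as
    solving them. *)
Definition obstruction_ideal (a : A) : Prop :=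
  forall (A' : comAlgType k) (phi : {lrmorphism A -> A'}),
    obstruction_vanishes phi -> phi a = 0.

Lemma obstruction_idealP : ideal obstruction_ideal.
Proof.
split=> [|a b Ia Ib|a b Ib] A' phi Hphi; first exact: rmorph0.
  by rewrite rmorphD /= (Ia _ _ Hphi) (Ib _ _ Hphi) addr0.
by rewrite rmorphM /= (Ib _ _ Hphi) mulr0.
Qed.

Lemma obstruction_idealE (A' : comAlgType k) (phi : {lrmorphism A -> A'}) :
  (forall a, obstruction_ideal a -> phi a = 0) <-> obstruction_vanishes phi.
Proof.
split=> [Iphi|phi0 a]; last exact.
split=> [j b|s b b0]; apply/eqP; rewrite -subr_eq0; apply/eqP.
  rewrite -rmorphB; apply: Iphi => B psi [psi0 _].
  by rewrite rmorphB /= psi0 subrr.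
under eq_bigr do rewrite -rmorphM.
rewrite -rmorph_sum -rmorphB; apply: Iphi => B psi [_ psi0].
rewrite rmorphB rmorph_sum /= psi0; apply/eqP; rewrite subr_eq0; apply/eqP.
by apply: eq_bigr => s' _; rewrite rmorphM.
Qed.

(** * The equations satisfied by the corners of a given family *)

Section Necessity.
Variables (A' : comAlgType k) (phi : {lrmorphism A -> A'}).
Variable x : mls_fam E v o A'.
Variable w : forall j, mls_arr phi (y j) (corner (set21 o (val j)) x).

Lemma arr_ev j b :
  val (w j (ev (y j) b)) = act x (prj (pt j)) (act x b (gen x)).
Proof.
rewrite /ev mls_fun_act mls_fun_gen /= endo_extend_compress !act_comp.
by rewrite (eqP (corner_gen_subproof (set21 o (val j)) x)).
Qed.

Lemma arr_chi j b :
  act x (prj [set o]) (act x b (gen x)) = phi (chi j b) *: gen x.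
Proof.
have := congr1 (fun n => val (w j n)) (unit_coordE (D j) (ev (y j) b)).
rewrite mls_fun_act /= endo_extend_proj arr_ev act_proj /=.
rewrite (_ : _ :&: _ = [set o]); last first.
  by apply/setP => i; rewrite !inE; case: (i =P o) => [->|]; rewrite ?eqxx ?andbF.
move=> ->.
have [wl _] := mls_fun_base_change (w j).
by rewrite (semilinearZ _ _ wl) mls_fun_gen; apply: val_fixedZ.
Qed.

Lemma arr_coord j b : act x (prj [set val j]) (act x b (gen x)) =
  \sum_t phi (coord t (ev (y j) b)) *: act x (coord_elt (c := D j) t) (gen x).
Proof.
have := congr1 (fun n => val (w j n)) (coordE (D j) (ev (y j) b)).
rewrite mls_fun_act /= endo_extend_proj arr_ev act_proj.
have jpt : [set val j] :&: pt j = [set val j].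
  by apply/setP => i; rewrite !inE; case: (i =P val j) => [->|]; rewrite ?eqxx ?orbT.
rewrite jpt => ->.
have [wl _] := mls_fun_base_change (w j).
rewrite (semilinear_sum _ _ wl) [LHS]val_fixed_sum; apply: eq_bigr => t _.
rewrite val_fixedZ arr_ev -[in RHS]coord_eltE act_comp.
by rewrite -{1}coord_eltE act_comp act_proj setIC jpt.
Qed.

Lemma arr_expand b :
  act x b (gen x) = \sum_s phi (Lam s b) *: act x (gen_elt s) (gen x).
Proof.
rewrite sum_gens /= gen_fixed -(arr_chi j0 b) [LHS]act_sum_proj (bigD1 o) //=.
congr (_ + _); rewrite (reindex_omap val (insub : I -> option J)) /=.
  apply: eq_big => [j|j _]; last by rewrite arr_coord.
  by rewrite valK eqxx (valP j).
by move=> i io; rewrite insubT.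
Qed.

(** The functional extends along the base change of its corner and is pulled back by the projection
    of [x] onto that corner. Thus [phi (Lam s b)] depends only on b gen. *)
Lemma Lam_functional s : exists l : {linear x -> A'^o},
  forall b, l (act x b (gen x)) = phi (Lam s b).
Proof.
pose tc j : {linear x -> corner (set21 o (val j)) x} :=
  linear_of (to_corner_linear (pt j) (M := x)).
have tcE j b : tc j (act x b (gen x)) = w j (ev (y j) b).
  by apply: val_inj; rewrite arr_ev.
case: s => [[j t]|].
  have [l lE] := base_change_functional (coord t) (mls_fun_base_change (w j)).
  have ll : linear (fun m => l (tc j m) : A'^o) by move=> a m n; rewrite !linearP.
  by exists (linear_of ll) => b /=; rewrite tcE lE.
have [l lE] :=
  base_change_functional (unit_coord (D j0)) (mls_fun_base_change (w j0)).
have ll : linear (fun m => l (tc j0 m) : A'^o) by move=> a m n; rewrite !linearP.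
by exists (linear_of ll) => b /=; rewrite tcE lE.
Qed.

(** Each [phi (chi j b)] is the coefficient of gen in e_0 b gen in the same module [x]; the second
    condition is the coordinate [s] of b applied to the expansion of b0 gen. *)
Lemma arr_obstruction_vanishes : obstruction_vanishes phi.
Proof.
split=> [j b|s b b0].
  by apply: (scale_gen_inj (M := x)); rewrite -!arr_chi.
have [l lE] := Lam_functional s.
rewrite -lE act_comp [act x b0 _]arr_expand !linear_sum.
by apply: eq_bigr => s' _; rewrite !linearZZ -act_comp lE; apply: mulrC.
Qed.

End Necessity.

(** * Two families with the same corners are isomorphic *)

Section Uniqueness.
Variables (A' : comAlgType k) (phi : {lrmorphism A -> A'}).
Variables x x' : mls_fam E v o A'.
Variable w : forall j, mls_arr phi (y j) (corner (set21 o (val j)) x).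
Variable w' : forall j, mls_arr phi (y j) (corner (set21 o (val j)) x').

(** The coordinates [phi (Lam s b)] depend on [y] alone, so b gen has the same expansion in [x] and
    in [x']. Coordinates taken in [x] and generators taken in [x'] give a well-defined map. *)
Lemma arr_comparison : exists h : {linear x -> x'},
  forall b, h (act x b (gen x)) = act x' b (gen x').
Proof.
have /choice[l lE] := Lam_functional w.
have hl : linear (fun m => \sum_s l s m *: act x' (gen_elt s) (gen x')).
  move=> a m n; rewrite scaler_sumr -big_split; apply: eq_bigr => s _.
  by rewrite linearP scalerDl scalerA.
exists (linear_of hl) => b /=; rewrite (arr_expand w').
by apply: eq_bigr => s _; rewrite lE.
Qed.

End Uniqueness.

Lemma mls_linear_ext (A' : comAlgType k) (x : mls_fam E v o A')
    (N : lmodType A') (g h : {linear x -> N}) :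
  (forall b, g (act x b (gen x)) = h (act x b (gen x))) -> g =1 h.
Proof.
move=> gh m; have [r [a [b ->]]] := gen_generates m.
by rewrite !linear_sum; apply: eq_bigr => i _; rewrite !linearZZ gh.
Qed.

Lemma arr_unique (A' : comAlgType k) (phi : {lrmorphism A -> A'})
    (x x' : mls_fam E v o A') :
  (forall j, mls_arr phi (y j) (corner (set21 o (val j)) x)) ->
  (forall j, mls_arr phi (y j) (corner (set21 o (val j)) x')) ->
  @isomorphic k (mls E v o) A' x x'.
Proof.
move=> w w'; have [g gE] := arr_comparison w w'.
have [h hE] := arr_comparison w' w.
have hg : cancel g h.
  apply: (mls_linear_ext (g := h \o g) (h := idfun)) => b /=.
  by rewrite gE hE.
have gh : cancel h g.
  apply: (mls_linear_ext (g := g \o h) (h := idfun)) => b /=.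
  by rewrite hE gE.
split; exists g.
- exact: (iso_base_change hg gh).
- move=> b; apply: (mls_linear_ext (g := g \o act x b) (h := act x' b \o g)) => c.
  by rewrite /= -act_comp !gE act_comp.
- by rewrite -{1}[gen x]act_id gE act_id.
Qed.

(** * Construction of the glued family *)

Section Sufficiency.
Local Arguments gen_elt : simpl never.
Hypothesis vo : v o = 1%N.
Variables (A' : comAlgType k) (phi : {lrmorphism A -> A'}).
Hypothesis phi0 : obstruction_vanishes phi.

Let W : lmodType A' := {ffun gens -> A'^o}.
Let vec (b : endo E) : W := [ffun s => phi (Lam s b)].

Let vec_add b c : vec (endo_add b c) = vec b + vec c.
Proof. by apply/ffunP => s; rewrite !ffunE Lam_add rmorphD. Qed.

Let vec_scale a b : vec (endo_scale a b) = a%:A *: vec b.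
Proof. by apply/ffunP => s; rewrite !ffunE Lam_scale rmorphM /= rmorph_alg. Qed.

(** The matrix of b has the coordinates of b c_s as its column s. As the c_s gen need not be
    independent, the identity of B acts by an idempotent rather than by the identity matrix; its
    image is the glued module. *)
Definition glue_fun (b : endo E) (z : W) : W :=
  \sum_s z s *: vec (b \b gen_elt s).

Fact glue_linear b : linear (glue_fun b).
Proof.
move=> a z z'; rewrite scaler_sumr -big_split; apply: eq_bigr => s _.
by rewrite !ffunE scalerDl scalerA.
Qed.

Definition glue b : {linear W -> W} := linear_of (glue_linear b).

(** This is the second obstruction equation, read as a matrix product. *)
Lemma glue_vec b c : glue b (vec c) = vec (b \b c).
Proof.
apply/ffunP => s; rewrite sum_ffunE !ffunE phi0.2.
by apply: eq_bigr => s' _; rewrite !ffunE; apply: mulrC.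
Qed.

Lemma glue_comp b c z : glue (b \b c) z = glue b (glue c z).
Proof.
rewrite [glue c z]/(glue_fun c z) linear_sum; apply: eq_bigr => s _.
by rewrite linearZZ glue_vec endo_compA.
Qed.

Lemma glue_add b c z : glue (endo_add b c) z = glue b z + glue c z.
Proof.
rewrite -big_split; apply: eq_bigr => s _.
by rewrite endo_compDl vec_add scalerDr.
Qed.

Lemma glue_scale a b z : glue (endo_scale a b) z = a%:A *: glue b z.
Proof.
rewrite scaler_sumr; apply: eq_bigr => s _.
by rewrite endo_compZl vec_scale !scalerA mulrC.
Qed.

Let X : lmodType A' := fixed (glue (endo_id E)).

Fact glue_fixed b z : glue b z \in fixed_pred (glue (endo_id E)).
Proof. by rewrite inE -glue_comp endo_comp1l. Qed.

Definition glue_act_fun b (z : X) : X :=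
  exist (fun z => z \in fixed_pred (glue (endo_id E))) _ (glue_fixed b (val z)).

Fact glue_act_linear b : linear (glue_act_fun b).
Proof.
move=> a m n; apply: val_inj.
by rewrite -[LHS]/(glue b (val (a *: m + n))) !val_fixedP linearP.
Qed.

Definition glue_act b : {linear X -> X} := linear_of (glue_act_linear b).

Fact vec_fixed b : vec b \in fixed_pred (glue (endo_id E)).
Proof. by rewrite inE glue_vec endo_comp1l. Qed.

Definition glue_elt b : X :=
  exist (fun z => z \in fixed_pred (glue (endo_id E))) _ (vec_fixed b).

Lemma glue_act_elt b c : glue_act b (glue_elt c) = glue_elt (b \b c).
Proof. by apply: val_inj; rewrite /= -glue_vec. Qed.

Lemma glue_elt_projo b : glue_elt (b \b prj [set o]) = glue_elt b.
Proof. by apply: val_inj; apply/ffunP => s; rewrite !ffunE Lam_projo. Qed.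

Lemma glue_expand b (z : X) :
  glue_act b z = \sum_s val z s *: glue_elt (b \b gen_elt s).
Proof.
apply: val_inj; rewrite val_fixed_sum; apply: eq_bigr => s _.
by rewrite val_fixedZ.
Qed.


Let glue_act_comp b c z : glue_act (b \b c) z = glue_act b (glue_act c z).
Proof. by apply: val_inj; apply: glue_comp. Qed.

Let gen_index (s : gens) : I := if s is Some jt then val (tag jt) else o.

Lemma glue_elt_proj (P : {set I}) (s : gens) :
  glue_elt (prj P \b gen_elt s) =
  if gen_index s \in P then glue_elt (gen_elt s) else 0.
Proof.
have sE : prj [set gen_index s] \b gen_elt s = gen_elt s.
  by case: s => [[j t]|] /=; rewrite ?coord_eltE // proj_endo_comp setIid.
rewrite -{1}sE endo_compA proj_endo_comp; case: ifP => sP.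
  rewrite (_ : _ :&: _ = [set gen_index s]) ?sE //.
  by apply/setP => i; rewrite !inE; case: eqP => [->|]; rewrite ?sP ?andbF.
rewrite (_ : _ :&: _ = set0).
  apply: val_inj; apply/ffunP => -[[j t]|]; rewrite !ffunE /=.
    by rewrite coord_proj_set inE rmorph0.
  by rewrite chi_proj inE rmorph0.
by apply/setP => i; rewrite !inE; case: eqP => [->|]; rewrite ?sP ?andbF.
Qed.

Lemma glue_act_projo (z : X) :
  glue_act (prj [set o]) z = val z None *: glue_elt (endo_id E).
Proof.
rewrite glue_expand sum_gens glue_elt_proj inE eqxx /=.
rewrite -(glue_elt_projo (endo_id E)) endo_comp1l big1 ?addr0 // => j _.
by rewrite big1 // => t _; rewrite glue_elt_proj inE /= (negPf (valP j)) scaler0.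
Qed.

Lemma glue_act_proj (j : J) (z : X) : glue_act (prj [set val j]) z =
  \sum_(t : idx (D j)) val z (gen_at t) *: glue_elt (coord_elt t).
Proof.
rewrite glue_expand sum_gens glue_elt_proj inE /= eq_sym (negPf (valP j)).
rewrite scaler0 add0r (bigD1 j) //= [X in _ + X]big1 ?addr0 => [|i ij].
  by apply: eq_bigr => t _; rewrite glue_elt_proj inE eqxx.
rewrite big1 // => t _.
by rewrite glue_elt_proj inE -[gen_index _]/(val i) val_eqE (negPf ij) scaler0.
Qed.

Lemma glue_act_pair (j : J) (z : X) : glue_act (prj (pt j)) z =
  val z None *: glue_elt (prj [set o]) +
  \sum_(t : idx (D j)) val z (gen_at t) *: glue_elt (coord_elt t).
Proof.
rewrite glue_expand sum_gens glue_elt_proj !inE eqxx /=; congr (_ + _).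
rewrite (bigD1 j) //= [X in _ + X]big1 ?addr0 => [|i ij].
  by apply: eq_bigr => t _; rewrite glue_elt_proj !inE eqxx orbT.
rewrite big1 // => t _.
by rewrite glue_elt_proj !inE -[gen_index _]/(val i) val_eqE (negPf ij) (negPf (valP i)) scaler0.
Qed.

(** Written in coordinates, the map respects the relations of [y j] by construction; [glue_map_ev]
    then identifies it as b gen to e b gen. *)
Definition glue_map (j : J) (n : y j) : X :=
  phi (unit_coord (D j) n) *: glue_elt (prj [set o]) +
  \sum_(t : idx (D j)) phi (coord t n) *: glue_elt (coord_elt t).

Lemma glue_map_semilinear j : semilinear phi (@glue_map j).
Proof.
move=> a m n; rewrite /glue_map scalerDr addrACA; congr (_ + _).
  by rewrite linearP rmorphD rmorphM scalerDl scalerA.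
rewrite scaler_sumr -big_split; apply: eq_bigr => t _.
by rewrite linearP rmorphD rmorphM scalerDl scalerA.
Qed.

Lemma glue_map_ev j b : glue_map (ev (y j) b) = glue_elt (prj (pt j) \b b).
Proof.
set c := prj (pt j) \b b.
have -> : glue_elt c = glue_act (prj (pt j)) (glue_elt c).
  by rewrite glue_act_elt endo_compA proj_endo_comp setIid.
rewrite glue_act_pair /glue_map.
(* The entry at [None] was read from the corner [j0]; agreement of the characters lets it be read
   from the corner [j]. *)
have -> : val (glue_elt c) None = phi (unit_coord (D j) (ev (y j) b)).
  by rewrite ffunE -[Lam None _]/(chi j0 c) -(phi0.1 j c) chi_proj set21.
congr (_ + _); apply: eq_bigr => t _; congr (_ *: _).
by rewrite ffunE -[Lam _ _]/(coord t (ev (y j) c)) coord_proj_set set22.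
Qed.

Lemma glue_map_None j n : val (@glue_map j n) None = phi (unit_coord (D j) n).
Proof.
apply: (ev_ext (phi := phi) (Q := A'^o) (u := fun n => val (glue_map n) None)
  (w := fun n => phi (unit_coord (D j) n))) => [a m m'|a m m'|b].
- by rewrite glue_map_semilinear val_fixedP !ffunE.
- by rewrite linearP rmorphD rmorphM.
- by rewrite glue_map_ev ffunE /= -(phi0.1 j) chi_proj set21.
Qed.

Lemma glue_map_Some j (t : idx (D j)) n :
  val (glue_map n) (gen_at t) = phi (coord t n).
Proof.
apply: (ev_ext (phi := phi) (Q := A'^o)
  (u := fun n => val (glue_map n) (gen_at t)) (w := fun n => phi (coord t n))) => [a m m'|a m m'|b].
- by rewrite glue_map_semilinear val_fixedP !ffunE.
- by rewrite linearP rmorphD rmorphM.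
- by rewrite glue_map_ev ffunE /= coord_proj_set set22.
Qed.

Lemma glue_map_act j b n :
  glue_map (act (y j) b n) = glue_act (endo_extend b) (glue_map n).
Proof.
apply: (ev_ext (phi := phi) (u := fun n => glue_map (act (y j) b n))
  (w := fun n => glue_act (endo_extend b) (glue_map n))) => [a m m'|a m m'|c].
- by rewrite linearP glue_map_semilinear.
- by rewrite glue_map_semilinear linearP.
- rewrite -ev_extend !glue_map_ev glue_act_elt.
  by rewrite !endo_compA proj_endo_extend endo_extend_projr.
Qed.

Lemma glue_map_gen j : glue_map (gen (y j)) = glue_elt (endo_id E).
Proof.
rewrite -[gen _]ev_id -ev_projo endo_comp1l glue_map_ev proj_endo_comp.
have -> : pt j :&: [set o] = [set o].
  by apply/setP => i; rewrite !inE; case: eqP => [->|]; rewrite ?eqxx ?andbF.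
by rewrite -[in LHS](endo_comp1l (prj [set o])) glue_elt_projo.
Qed.

Let glue_proj_idem P z :
  glue_act (prj P) (glue_act (prj P) z) = glue_act (prj P) z.
Proof. by rewrite -glue_act_comp proj_endo_comp setIid. Qed.

Lemma glue_rank_o : locally_free (fixed (glue_act (prj [set o]))) (v o).
Proof.
rewrite vo; pose q := to_fixed (glue_proj_idem [set o]).
have zl : linear (fun m : fixed (glue_act (prj [set o])) =>
    const_mx (val (val m) None) : 'rV[A']_1).
  by move=> a m n; apply/rowP => i; rewrite !mxE !val_fixedP !ffunE.
apply: (@coordinates_locally_free _ _ _ 1%N (fun=> 1) (fun=> 1)
  (fun _ _ => q (glue_elt (endo_id E))) (fun=> linear_of zl)).
- by rewrite big_ord1 mulr1.
- move=> _ m; rewrite scale1r /comb big_ord1 mxE; apply: val_inj.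
  rewrite val_fixedZ -[in LHS](fixedE m) glue_act_projo; congr (_ *: _).
  rewrite -[RHS]/(glue_act (prj [set o]) (glue_elt (endo_id E))).
  by rewrite glue_act_elt endo_comp1r -[LHS]glue_elt_projo endo_comp1l.
- move=> _ t; apply/rowP => i; rewrite scale1r !ord1 !mxE !eqxx.
  rewrite -[val (q _)]/(glue_act (prj [set o]) (glue_elt (endo_id E))).
  by rewrite glue_act_elt endo_comp1r ffunE -[Lam _ _]/(chi _ _) chi1 rmorph1.
Qed.

(** The local bases and coordinates of e_j (y j) are transported along [phi]: the bases by [F], the
    coordinates by [z']. *)
Lemma glue_rank_j (j : J) :
  locally_free (fixed (glue_act (prj [set val j]))) (v (val j)).
Proof.
have [r [a [g [b [z [ag gz zb]]]]]] := locally_free_coordinates (mls_rank (y j) (jj j)).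
pose p := to_fixed (act_proj_idem (M := y j) [set jj j]).
pose q := to_fixed (glue_proj_idem [set val j]).
pose F (n : fixed (act (y j) (proj_endo (@Ej j) [set jj j]))) := q (glue_map (val n)).
have Fl : semilinear phi F.
  move=> x m n; rewrite /F val_fixedP glue_map_semilinear.
  by rewrite linearP.
have F_elt (t : idx (D j)) : F (p (ev (y j) (coord_elt t))) = q (glue_elt (coord_elt t)).
  have evj : val (p (ev (y j) (coord_elt t))) = ev (y j) (coord_elt t).
    by rewrite -[RHS](congr1 (ev (y j)) (coord_eltE t)) ev_proj (set_preim1 (jj j)).
  rewrite /F evj glue_map_ev -{1}coord_eltE endo_compA proj_endo_comp.
  rewrite (_ : _ :&: _ = [set val j]) ?coord_eltE //.
  by apply/setP => i; rewrite !inE; case: (i =P val j); rewrite ?orbT ?andbF.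
(* An element of e_j X is the combination of the c_t gen with its own entries as coefficients, so
   its coordinates are those of the c_t gen in [y j], weighted by these entries. *)
pose z' i (m : fixed (glue_act (prj [set val j]))) : 'rV[A']_(v (val j)) :=
  \sum_(t : idx (D j)) val (val m) (gen_at t) *:
    map_mx phi (z i (p (ev (y j) (coord_elt t)))).
have z'l i : linear (z' i).
  move=> x m n; rewrite scaler_sumr -big_split; apply: eq_bigr => t _.
  by rewrite !val_fixedP !ffunE scalerDl scalerA.
apply: (@coordinates_locally_free _ _ _ r (phi \o a) (phi \o g)
  (fun i t => F (b i t)) (fun i => linear_of (z'l i))).
- rewrite -[RHS](rmorph1 phi) -ag rmorph_sum.
  by apply: eq_bigr => i _; rewrite rmorphM.
- move=> i m; rewrite -{1}[m](to_fixedK (glue_proj_idem [set val j])).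
  rewrite -[X in _ *: to_fixed _ X]fixedE glue_act_proj -/q linear_sum.
  rewrite [linear_of (z'l i) m]/(z' i m) comb_sum scaler_sumr.
  apply: eq_bigr => t _.
  rewrite linearZZ scalerA mulrC -scalerA; congr (_ *: _).
  rewrite -F_elt; set n := p _.
  rewrite -(semilinearZ _ _ Fl) gz (semilinear_sum _ _ Fl).
  by apply: eq_bigr => t' _; rewrite mxE.
- move=> i t.
  have bE : val (F (b i t)) = glue_map (val (b i t)).
    rewrite -[LHS]/(glue_act (prj [set val j]) (glue_map (val (b i t)))).
    rewrite -[in RHS](fixedE (b i t)) glue_map_act.
    by rewrite (endo_extend_proj E (jj j)).
  rewrite -[LHS]/(z' i (F (b i t))) /z' bE.
  under eq_bigr do rewrite glue_map_Some.
  have zl : semilinear phi (fun n => map_mx phi (z i (p n))).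
    by move=> x m n; rewrite !linearP map_mxD map_mxZ.
  rewrite -(semilinear_sum _ _ zl) -coordE.
  rewrite (_ : p _ = b i t) ?zb ?map_mxZ ?map_delta_mx //.
  by apply: val_inj; rewrite /= act_proj_idem fixedE.
Qed.

Lemma glue_rank i : locally_free (fixed (glue_act (prj [set i]))) (v i).
Proof.
have [->|io] := eqVneq i o; first exact: glue_rank_o.
exact: (glue_rank_j (exist _ i io)).
Qed.

Definition glue_family : mls_fam E v o A'.
Proof.
exists X glue_act (glue_elt (endo_id E)).
- by move=> m; apply: val_inj; apply: fixedE.
- exact: glue_act_comp.
- by move=> b c m; apply: val_inj; rewrite [LHS]glue_add.
- by move=> c b m; apply: val_inj; rewrite val_fixedZ [LHS]glue_scale.
- exact: glue_rank.
- by rewrite glue_act_elt endo_comp1r -[RHS]glue_elt_projo endo_comp1l.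
- move=> m mo; exists (val m None); split=> [|a]; first by rewrite -glue_act_projo.
  move=> /(congr1 (fun z : X => val z None)) ->; rewrite val_fixedZ !ffunE.
  rewrite -Lam_projo endo_comp1l -[Lam _ _]/(chi _ _) chi1 rmorph1.
  exact: mulr1.
- move=> m; exists #|{: gens}|, (fun i => val m (enum_val i)).
  exists (fun i => gen_elt (enum_val i)).
  rewrite -(big_enum_val (A := {: gens})
    (fun s => val m s *: glue_act (gen_elt s) (glue_elt (endo_id E)))).
  have {1}-> : m = glue_act (endo_id E) m by apply: val_inj; rewrite -[LHS]fixedE.
  rewrite glue_expand; apply: eq_big => // s _.
  by rewrite endo_comp1l glue_act_elt endo_comp1r.
Defined.

Lemma corner_sum j (n : y j) : n = unit_coord (D j) n *: gen (y j) +
  \sum_(t : idx (D j)) coord t n *: ev (y j) (coord_elt t).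
Proof.
rewrite -unit_coordE -coordE -act_projU; last first.
  by rewrite disjoints1 inE -val_eqE /= eq_sym (valP j).
rewrite -[LHS]act_id; congr (act (y j) _ n); apply: endo_ext => B x s [i ij] /=.
by rewrite !inE -!val_eqE /= -in_set2 ij.
Qed.

Lemma glue_map_fixed j n :
  @glue_map j n \in fixed_pred (act glue_family (prj (pt j))).
Proof.
rewrite inE; apply/eqP; rewrite [LHS]glue_act_pair glue_map_None.
by congr (_ + _); apply: eq_bigr => t _; rewrite glue_map_Some.
Qed.

Definition glue_arr_fun j (n : y j) : corner (set21 o (val j)) glue_family :=
  exist _ (glue_map n) (glue_map_fixed n).

Lemma glue_at_linear s : linear (fun z : X => val z s : A'^o).
Proof. by move=> a m n; rewrite val_fixedP !ffunE. Qed.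

Definition glue_coord s (z : glue_family) : A' := val (z : X) s.

Lemma glue_coord_linear s : linear (glue_coord s : glue_family -> A'^o).
Proof. exact: glue_at_linear. Qed.

Definition corner_coord (j : J) s
    (z : corner (set21 o (val j)) glue_family) : A' := glue_coord s (val z).

Lemma corner_coord_linear (j : J) s :
  linear (@corner_coord j s : corner (set21 o (val j)) glue_family -> A'^o).
Proof.
by move=> a m n; rewrite /corner_coord val_fixedP; exact: glue_coord_linear.
Qed.

Lemma glue_arr_semilinear j : semilinear phi (@glue_arr_fun j).
Proof.
move=> a m n; apply: val_inj; rewrite [RHS]val_fixedP.
exact: glue_map_semilinear.
Qed.

Lemma glue_arr_expand j (z : corner (set21 o (val j)) glue_family) :
  z = linear_of (@corner_coord_linear j None) z *: glue_arr_fun (gen (y j)) +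
  \sum_(t : idx (D j)) linear_of (@corner_coord_linear j (gen_at t)) z *:
     glue_arr_fun (ev (y j) (coord_elt t)).
Proof.
apply: val_inj; rewrite val_fixedP val_fixed_sum /=.
rewrite [LHS](_ : _ = glue_act (prj (pt j)) (val z)); last exact/esym/fixedE.
rewrite glue_act_pair; congr (_ + _).
  by rewrite glue_map_gen -[in RHS]glue_elt_projo endo_comp1l.
apply: eq_bigr => t _.
congr (_ *: _); rewrite glue_map_ev -{1}coord_eltE.
rewrite -[in RHS]coord_eltE endo_compA proj_endo_comp.
congr (glue_elt (prj _ \b _)); apply/setP => i; rewrite !inE.
by case: (i =P val j); rewrite ?orbT ?andbF.
Qed.

(** The entries of a vector of the glued module are functionals extending the coordinates of [y j],
    so the generator (index [None]) and the c_t gen form a dual basis on both sides. *)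
Lemma glue_arr j : mls_arr phi (y j) (corner (set21 o (val j)) glue_family).
Proof.
exists (@glue_arr_fun j).
- apply: (projective_base_change (T := option (idx (D j)))
    (l := fun t => if t is Some t then coord t else unit_coord (D j))
    (b := fun t => if t is Some t then ev (y j) (coord_elt t) else gen (y j))
    (l' := fun t => if t is Some t
       then linear_of (@corner_coord_linear j (gen_at t))
       else linear_of (@corner_coord_linear j None))).
  + exact: glue_arr_semilinear.
  + move=> n; rewrite (bigD1 None) //= {1}(corner_sum n); congr (_ + _).
    rewrite (reindex_omap Some id) /=; last by case.
    by apply: eq_big => // t; rewrite eqxx.
  + by case=> [t|] n; [apply: glue_map_Some | apply: glue_map_None].
  + move=> z; rewrite {1}(glue_arr_expand z) (bigD1 None) //=; congr (_ + _).
    rewrite [RHS](reindex_omap Some id) /=; last by case.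
    by apply: eq_big => [t|t _]; first by rewrite eqxx.
- move=> b m; apply: val_inj; exact: glue_map_act.
- by apply: val_inj; exact: glue_map_gen.
Qed.

End Sufficiency.
End Coordinates.

Lemma prod_cornering_closed_immersion (vo : v o = 1%N) (j0 : J) :
  closed_immersion
    (prod_morphism (fun j : J => cornering E v (set21 o (val j)))).
Proof.
move=> A y.
have D j : corner_coordinates (y j).
  have /cid[//] : exists D : corner_coordinates (y j), True.
  by have [D] := corner_coordinates_exist (y j); exists D.
exists (obstruction_ideal j0 D); split; first exact: obstruction_idealP.
move=> A' phi; split=> [|x x' [w] [w']]; last exact: (arr_unique j0 D w w').
rewrite obstruction_idealE; split=> [phi0|[x [w]]].
  by exists (glue_family vo phi0); split=> j; apply: glue_arr.
exact: arr_obstruction_vanishes w.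
Qed.

End ProductOfCornerings.

(** * Test algebras *)

Section PolynomialEvaluation.
Variables (R : comNzRingType) (n : nat).

Definition peval (A : comAlgType R) (p : 'I_n -> A) (f : {mpoly R[n]}) : A :=
  mmap (in_alg A) p f.

Section Morphism.
Variables (A : comAlgType R) (p : 'I_n -> A).

HB.instance Definition _ := GRing.RMorphism.copy (peval p) (mmap (in_alg A) p).

Fact peval_scalable : scalable (peval p).
Proof. by move=> c f; rewrite /peval mmapZ mulr_algl. Qed.

HB.instance Definition _ :=
  GRing.isScalable.Build R {mpoly R[n]} A *:%R (peval p) peval_scalable.

Lemma pevalX i : peval p 'X_i = p i.
Proof. by rewrite /peval mmapX mmap1U. Qed.

Lemma pevalC c : peval p c%:MP = c%:A.
Proof. by rewrite /peval mmapC. Qed.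

End Morphism.

Lemma mpoly_lrmorph_ext (A : comAlgType R) (g h : {lrmorphism {mpoly R[n]} -> A}) :
  (forall i, g 'X_i = h 'X_i) -> g =1 h.
Proof.
move=> gh f; rewrite [f]mpolyE !raddf_sum; apply: eq_bigr => m _ /=.
rewrite !linearZ; congr (_ *: _); rewrite mpolyXE_id !rmorph_prod.
by apply: eq_bigr => i _; rewrite !rmorphXn /= gh.
Qed.

Lemma peval_comp (A A' : comAlgType R) (g : {lrmorphism A -> A'}) p f :
  g (peval p f) = peval (fun i => g (p i)) f.
Proof.
apply: (mpoly_lrmorph_ext (g := g \o peval p) (h := peval (fun i => g (p i)))).
by move=> i /=; rewrite !pevalX.
Qed.

Lemma peval_id (f : {mpoly R[n]}) : peval (fun i => 'X_i) f = f.
Proof.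
apply: (mpoly_lrmorph_ext (g := peval (fun i => 'X_i)) (h := idfun)) => i /=.
exact: pevalX.
Qed.

Lemma eq_peval (A : comAlgType R) (p q : 'I_n -> A) f :
  p =1 q -> peval p f = peval q f.
Proof. by move=> pq; congr peval; apply: funext. Qed.

End PolynomialEvaluation.

(** * Square-zero extensions *)

Section SquareZeroExtension.
Variables (k : comNzRingType) (S T : comAlgType k).

(* The square-zero extension of S by T; phi gives the S-module structure. *)
Record sqext (phi : {lrmorphism S -> T}) := SqExt { body : S; infin : T }.

Variable phi : {lrmorphism S -> T}.
Local Notation ext := (sqext phi).
Implicit Types x y z : ext.

Lemma sqext_eq x y : body x = body y -> infin x = infin y -> x = y.
Proof. by case: x y => [a b] [c d] /= -> ->. Qed.

Fact sqext_pairK : cancel (fun x => (body x, infin x)) (fun p => SqExt phi p.1 p.2).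
Proof. by case. Qed.

HB.instance Definition _ := Choice.copy ext (can_type sqext_pairK).

Definition sqext_add x y : ext := SqExt phi (body x + body y) (infin x + infin y).
Definition sqext_opp x : ext := SqExt phi (- body x) (- infin x).
Definition sqext_zero : ext := SqExt phi 0 0.
Definition sqext_scale (a : k) x : ext := SqExt phi (a *: body x) (a *: infin x).

Fact sqext_addA : associative sqext_add.
Proof. by move=> x y z; apply: sqext_eq; rewrite /= addrA. Qed.
Fact sqext_addC : commutative sqext_add.
Proof. by move=> x y; apply: sqext_eq; rewrite /= addrC. Qed.
Fact sqext_add0 : left_id sqext_zero sqext_add.
Proof. by move=> x; apply: sqext_eq; rewrite /= add0r. Qed.
Fact sqext_addN : left_inverse sqext_zero sqext_opp sqext_add.
Proof. by move=> x; apply: sqext_eq; rewrite /= addNr. Qed.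

HB.instance Definition _ := GRing.isZmodule.Build ext
  sqext_addA sqext_addC sqext_add0 sqext_addN.

Fact sqext_scaleA a b x : sqext_scale a (sqext_scale b x) = sqext_scale (a * b) x.
Proof. by apply: sqext_eq; rewrite /= scalerA. Qed.
Fact sqext_scale1 : left_id 1 sqext_scale.
Proof. by move=> x; apply: sqext_eq; rewrite /= scale1r. Qed.
Fact sqext_scaleDr : right_distributive sqext_scale +%R.
Proof. by move=> a x y; apply: sqext_eq; rewrite /= scalerDr. Qed.
Fact sqext_scaleDl x : {morph sqext_scale^~ x : a b / a + b}.
Proof. by move=> a b; apply: sqext_eq; rewrite /= scalerDl. Qed.

HB.instance Definition _ := GRing.Zmodule_isLmodule.Build k ext
  sqext_scaleA sqext_scale1 sqext_scaleDr sqext_scaleDl.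

Definition sqext_mul x y : ext :=
  SqExt phi (body x * body y) (phi (body x) * infin y + phi (body y) * infin x).

Fact sqext_mulA : associative sqext_mul.
Proof. by move=> x y z; apply: sqext_eq; rewrite /= ?mulrA // !rmorphM; ring. Qed.

Fact sqext_mulC : commutative sqext_mul.
Proof. by move=> x y; apply: sqext_eq; rewrite /= ?[body y * _]mulrC // addrC. Qed.

Fact sqext_mul1 : left_id (SqExt phi 1 0) sqext_mul.
Proof.
by move=> x; apply: sqext_eq; rewrite /= ?rmorph1 ?mul1r ?mulr0 ?addr0.
Qed.

Fact sqext_mulD : left_distributive sqext_mul +%R.
Proof. by move=> x y z; apply: sqext_eq; rewrite /= ?rmorphD /=; ring. Qed.

Fact sqext_1_neq0 : SqExt phi 1 0 != 0.
Proof. by apply/eqP => /(congr1 (@body _))/eqP; rewrite oner_eq0. Qed.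

HB.instance Definition _ := GRing.Zmodule_isComNzRing.Build ext
  sqext_mulA sqext_mulC sqext_mul1 sqext_mulD sqext_1_neq0.

Fact sqext_scaleAl (a : k) x y : a *: (x * y) = (a *: x) * y.
Proof.
apply: sqext_eq; first exact: scalerAl.
rewrite -[RHS]/(phi (a *: body x) * infin y + phi (body y) * (a *: infin x)).
by rewrite linearZ /= -scalerAl -scalerAr -scalerDr.
Qed.

HB.instance Definition _ := GRing.Lmodule_isLalgebra.Build k ext sqext_scaleAl.
HB.instance Definition _ := GRing.Lalgebra_isComAlgebra.Build k ext.

Definition sqbody (x : ext) : S := body x.

Fact sqbody_zmod : zmod_morphism sqbody. Proof. by []. Qed.
Fact sqbody_monoid : monoid_morphism sqbody. Proof. by []. Qed.
Fact sqbody_scalable : scalable sqbody. Proof. by []. Qed.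

HB.instance Definition _ := GRing.isZmodMorphism.Build ext S sqbody sqbody_zmod.
HB.instance Definition _ := GRing.isMonoidMorphism.Build ext S sqbody sqbody_monoid.
HB.instance Definition _ :=
  GRing.isScalable.Build k ext S *:%R sqbody sqbody_scalable.

Lemma infin_sum (J : Type) (s : seq J) (a : J -> k) (x : J -> ext) :
  infin (\sum_(j <- s) a j *: x j) = \sum_(j <- s) a j *: infin (x j).
Proof. by elim/big_rec2: _ => // j y z _ <-. Qed.

End SquareZeroExtension.

(** * The algebra of functions on a finite set *)

Section FunctionAlgebra.
Variables (T : finType) (t0 : T) (A : comNzRingType).

(* t0 witnesses that T is not empty, so that the ring is not zero. *)
Definition funalg (x : T) : Type := {ffun T -> A^o}.
HB.instance Definition _ := GRing.Lmodule.on (funalg t0).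

Fact funalg_mulA : associative (fun f g : funalg t0 => [ffun x => f x * g x] : funalg t0).
Proof. by move=> f g h; apply/ffunP => x; rewrite !ffunE mulrA. Qed.

Fact funalg_mulC : commutative (fun f g : funalg t0 => [ffun x => f x * g x] : funalg t0).
Proof. by move=> f g; apply/ffunP => x; rewrite !ffunE mulrC. Qed.

Fact funalg_mul1 : left_id ([ffun=> 1] : funalg t0)
  (fun f g : funalg t0 => [ffun x => f x * g x] : funalg t0).
Proof. by move=> f; apply/ffunP => x; rewrite !ffunE mul1r. Qed.

Fact funalg_mulD : left_distributive
  (fun f g : funalg t0 => [ffun x => f x * g x] : funalg t0) +%R.
Proof. by move=> f g h; apply/ffunP => x; rewrite !ffunE mulrDl. Qed.

Fact funalg_1_neq0 : ([ffun=> 1] : funalg t0) != 0.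
Proof. by apply/eqP => /ffunP/(_ t0)/eqP; rewrite !ffunE oner_eq0. Qed.

HB.instance Definition _ := GRing.Zmodule_isComNzRing.Build (funalg t0)
  funalg_mulA funalg_mulC funalg_mul1 funalg_mulD funalg_1_neq0.

Fact funalg_scaleAl (a : A) (f g : funalg t0) : a *: (f * g) = (a *: f) * g.
Proof. by apply/ffunP => x; rewrite !ffunE; apply: mulrA. Qed.

HB.instance Definition _ := GRing.Lmodule_isLalgebra.Build A (funalg t0) funalg_scaleAl.
HB.instance Definition _ := GRing.Lalgebra_isComAlgebra.Build A (funalg t0).

Lemma funalgM (f g : funalg t0) x : (f * g) x = f x * g x.
Proof. by rewrite ffunE. Qed.

Lemma funalg1 x : (1 : funalg t0) x = 1.
Proof. by rewrite ffunE. Qed.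

Definition funeval (x : T) (f : funalg t0) : A^o := f x.

Fact funeval_zmod x : zmod_morphism (funeval x).
Proof. by move=> f g; rewrite /funeval !ffunE. Qed.
Fact funeval_monoid x : monoid_morphism (funeval x).
Proof. by split=> [|f g]; rewrite /funeval ?funalg1 ?funalgM. Qed.
Fact funeval_scalable x : scalable (funeval x).
Proof. by move=> a f; rewrite /funeval ffunE. Qed.

HB.instance Definition _ x :=
  GRing.isZmodMorphism.Build (funalg t0) A^o (funeval x) (funeval_zmod x).
HB.instance Definition _ x :=
  GRing.isMonoidMorphism.Build (funalg t0) A^o (funeval x) (funeval_monoid x).
HB.instance Definition _ x :=
  GRing.isScalable.Build A (funalg t0) A^o *:%R (funeval x) (funeval_scalable x).

End FunctionAlgebra.

(** * Localizations of a polynomial ring and Hartogs' lemma *)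

Section Localization.
Variables (k : idomainType) (n : nat).
Local Notation S := {mpoly k[n]}.

Definition fracalg : Type := {fraction S}.
HB.instance Definition _ := GRing.Field.on fracalg.

Definition frac_scale (a : k) (x : fracalg) : fracalg := tofrac (a%:MP : S) * x.

Fact frac_scaleA a b x : frac_scale a (frac_scale b x) = frac_scale (a * b) x.
Proof. by rewrite /frac_scale mpolyCM tofracM mulrA. Qed.
Fact frac_scale1 : left_id 1 frac_scale.
Proof. by move=> x; rewrite /frac_scale mpolyC1 tofrac1 mul1r. Qed.
Fact frac_scaleDr : right_distributive frac_scale +%R.
Proof. by move=> a x y; rewrite /frac_scale mulrDr. Qed.
Fact frac_scaleDl x : {morph frac_scale^~ x : a b / a + b}.
Proof. by move=> a b; rewrite /frac_scale mpolyCD tofracD mulrDl. Qed.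

HB.instance Definition _ := GRing.Zmodule_isLmodule.Build k fracalg
  frac_scaleA frac_scale1 frac_scaleDr frac_scaleDl.

Fact frac_scaleAl (a : k) (x y : fracalg) : a *: (x * y) = (a *: x) * y.
Proof. exact: mulrA. Qed.

HB.instance Definition _ := GRing.Lmodule_isLalgebra.Build k fracalg frac_scaleAl.
HB.instance Definition _ := GRing.Lalgebra_isComAlgebra.Build k fracalg.

Definition infrac (f : S) : fracalg := tofrac f.
HB.instance Definition _ := GRing.RMorphism.copy infrac (@tofrac S).
Fact infrac_scalable : scalable infrac.
Proof. by move=> a f; rewrite /infrac -mul_mpolyC tofracM. Qed.
HB.instance Definition _ :=
  GRing.isScalable.Build k S fracalg *:%R infrac infrac_scalable.

Lemma infrac_inj : injective infrac.
Proof. by move=> f g /eqP; rewrite /infrac tofrac_eq => /eqP. Qed.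

Section Localize.
Variable h : S.

(** The localization at h is realised inside the fraction field, where elements of different
    localizations can be compared. *)
Definition loc_pred : {pred fracalg} :=
  fun x => `[< exists N f, x * infrac h ^+ N = infrac f >].

Fact loc_subalg : subalg_closed loc_pred.
Proof.
split=> [|a x y|x y].
- by apply/asboolP; exists 0%N, 1; rewrite expr0 mulr1 rmorph1.
- move=> /asboolP[N [f xf]] /asboolP[M [g yg]]; apply/asboolP.
  exists (N + M)%N, (a *: (f * h ^+ M) + g * h ^+ N).
  rewrite rmorphD /= infrac_scalable !rmorphM !rmorphXn /= -xf -yg mulrDl -scalerAl exprD.
  by rewrite -!mulrA [_ ^+ M * _]mulrC.
- move=> /asboolP[N [f xf]] /asboolP[M [g yg]]; apply/asboolP.
  exists (N + M)%N, (f * g).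
  by rewrite rmorphM /= -xf -yg exprD mulrACA.
Qed.

HB.instance Definition _ := GRing.isSubalgClosed.Build k fracalg loc_pred loc_subalg.

Definition loc := {x : fracalg | x \in loc_pred}.
HB.instance Definition _ := SubType.on loc.
HB.instance Definition _ := Choice.on loc.
HB.instance Definition _ := [SubChoice_isSubAlgebra of loc by <:].
HB.instance Definition _ := GRing.SubNzRing_isSubComNzRing.Build fracalg loc_pred loc.
End Localize.

End Localization.

Section LocalizationProperties.
Variables (k : idomainType) (n : nat).
Local Notation S := {mpoly k[n]}.

Lemma infracXn_neq0 (h : S) N : h != 0 -> infrac h ^+ N != 0.
Proof. by move=> h0; rewrite expf_neq0 // tofrac_eq0. Qed.

Section Inclusion.
Variable h : S.

Fact loc_in_subproof (f : S) : infrac f \in loc_pred h.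
Proof. by apply/asboolP; exists 0%N, f; rewrite expr0 mulr1. Qed.

Definition loc_in (f : S) : loc h := exist (fun x => x \in loc_pred h) _ (loc_in_subproof f).

Fact loc_in_zmod : zmod_morphism loc_in.
Proof. by move=> f g; apply: val_inj; rewrite rmorphB /= rmorphB. Qed.
Fact loc_in_monoid : monoid_morphism loc_in.
Proof.
split=> [|f g]; apply: val_inj; first by rewrite rmorph1 /= rmorph1.
by rewrite rmorphM /= rmorphM.
Qed.
Fact loc_in_scalable : scalable loc_in.
Proof. by move=> a f; apply: val_inj; rewrite linearZ /= infrac_scalable. Qed.

HB.instance Definition _ := GRing.isZmodMorphism.Build S (loc h) loc_in loc_in_zmod.
HB.instance Definition _ := GRing.isMonoidMorphism.Build S (loc h) loc_in loc_in_monoid.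
HB.instance Definition _ := GRing.isScalable.Build k S (loc h) *:%R loc_in loc_in_scalable.

Lemma loc_unit : h != 0 -> exists u : loc h, u * loc_in h = 1.
Proof.
move=> h0; have uP : (infrac h)^-1 \in loc_pred h.
  apply/asboolP; exists 1%N, 1.
  by rewrite expr1 mulVf ?rmorph1 // -[infrac h]expr1 infracXn_neq0.
exists (exist (fun x => x \in loc_pred h) _ uP); apply: val_inj.
by rewrite rmorphM rmorph1 /= mulVf // -[infrac h]expr1 infracXn_neq0.
Qed.

Definition loc_val (x : loc h) : fracalg k n := val x.

Fact loc_val_zmod : zmod_morphism loc_val.
Proof. exact: rmorphB. Qed.
Fact loc_val_monoid : monoid_morphism loc_val.
Proof. by split; [apply: rmorph1 | apply: rmorphM]. Qed.
Fact loc_val_scalable : scalable loc_val.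
Proof. by move=> a x; rewrite /loc_val linearZ. Qed.

HB.instance Definition _ :=
  GRing.isZmodMorphism.Build (loc h) (fracalg k n) loc_val loc_val_zmod.
HB.instance Definition _ :=
  GRing.isMonoidMorphism.Build (loc h) (fracalg k n) loc_val loc_val_monoid.
HB.instance Definition _ :=
  GRing.isScalable.Build k (loc h) (fracalg k n) *:%R loc_val loc_val_scalable.

End Inclusion.

Section Lift.
Variables (h : S) (L : comAlgType k).
Variables (g : {lrmorphism S -> L}) (u : L) (ug : u * g h = 1).

Let loc_frac (x : loc h) : exists f, exists N, val x * infrac h ^+ N = infrac f.
Proof. by have /asboolP[N [f xf]] := valP x; exists f, N. Qed.

(** The value uses a chosen representation of [x] as a fraction; [loc_liftE] makes it independent of
    that choice. *)
Definition loc_lift (x : loc h) : L :=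
  let: exist f fP := cid (loc_frac x) in
  let: exist N _ := cid fP in g f * u ^+ N.

Lemma loc_liftE (x : loc h) N f :
  val x * infrac h ^+ N = infrac f -> loc_lift x = g f * u ^+ N.
Proof.
rewrite /loc_lift; case: cid => f' fP'; case: cid => M xM xN.
have : f' * h ^+ N = f * h ^+ M.
  apply: infrac_inj; rewrite !rmorphM !rmorphXn /= -xM -xN.
  by rewrite -!mulrA [_ ^+ M * _]mulrC.
move=> /(congr1 g); rewrite !rmorphM !rmorphXn /= => fg.
transitivity (g f' * g h ^+ N * (u ^+ M * u ^+ N)).
  by rewrite -[LHS]mulr1 -(expr1n _ N) -ug exprMn; ring.
rewrite fg -[RHS]mulr1 -(expr1n _ M) -ug exprMn; ring.
Qed.

Fact loc_lift_zmod : zmod_morphism loc_lift.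
Proof.
move=> x y; have /asboolP[N [f xf]] := valP x; have /asboolP[M [f' yf]] := valP y.
rewrite (loc_liftE xf) (loc_liftE yf).
rewrite (@loc_liftE (x - y) (N + M) (f * h ^+ M - f' * h ^+ N)).
  rewrite rmorphB !rmorphM !rmorphXn /= exprD.
  transitivity (g f * u ^+ N * (u * g h) ^+ M - g f' * u ^+ M * (u * g h) ^+ N).
    by rewrite !exprMn; ring.
  by rewrite ug !expr1n !mulr1.
rewrite !rmorphB !rmorphM !rmorphXn /= -xf -yf exprD.
by transitivity ((val x - val y) * (infrac h ^+ N * infrac h ^+ M)) => //; ring.
Qed.

Fact loc_lift_monoid : monoid_morphism loc_lift.
Proof.
split=> [|x y].
  by rewrite (@loc_liftE _ 0 1) ?rmorph1 ?mul1r // expr0 mulr1 !rmorph1.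
have /asboolP[N [f xf]] := valP x; have /asboolP[M [f' yf]] := valP y.
rewrite (loc_liftE xf) (loc_liftE yf) (@loc_liftE (x * y) (N + M) (f * f')).
  by rewrite rmorphM exprD mulrACA.
by rewrite !rmorphM /= -xf -yf exprD mulrACA.
Qed.

Fact loc_lift_scalable : scalable loc_lift.
Proof.
move=> a x; have /asboolP[N [f xf]] := valP x.
rewrite (loc_liftE xf) (@loc_liftE (a *: x) N (a *: f)).
  by rewrite linearZ /= scalerAl.
by rewrite infrac_scalable -xf linearZ /= scalerAl.
Qed.

HB.instance Definition _ := GRing.isZmodMorphism.Build (loc h) L loc_lift loc_lift_zmod.
HB.instance Definition _ := GRing.isMonoidMorphism.Build (loc h) L loc_lift loc_lift_monoid.
HB.instance Definition _ :=
  GRing.isScalable.Build k (loc h) L *:%R loc_lift loc_lift_scalable.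

Lemma loc_lift_in f : loc_lift (loc_in h f) = g f.
Proof. by rewrite (@loc_liftE _ 0 f) ?expr0 ?mulr1. Qed.

Definition loc_lift_morphism : {lrmorphism loc h -> L} := loc_lift.

End Lift.

Lemma mcoeff_mulX_small (f : S) (i : 'I_n) N (m : 'X_{1..n}) :
  (m i < N)%N -> (f * 'X_i ^+ N)@_m = 0.
Proof.
move=> miN; rewrite [f]mpolyE mulr_suml raddf_sum big1 // => m' _ /=.
rewrite -scalerAl mpolyXn -mpolyXD mcoeffZ mcoeffX.
case: eqP => [mm'|_]; last by rewrite mulr0.
by move: miN; rewrite -mm' mnmDE mulmnE mnmE eqxx mul1n ltnNge leq_addl.
Qed.

Lemma mpoly_divX (f : S) (i : 'I_n) N :
  (forall m : 'X_{1..n}, (m i < N)%N -> f@_m = 0) -> exists g, f = g * 'X_i ^+ N.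
Proof.
move=> fN; exists (\sum_(m <- msupp f) f@_m *: 'X_[m - U_(i) *+ N]).
rewrite {1}[f]mpolyE mulr_suml; apply: eq_big_seq => m mf.
rewrite -scalerAl mpolyXn -mpolyXD submK //.
apply/mnm_lepP => j; rewrite mulmnE mnmE; case: eqP => [<-|] //; rewrite mul1n.
by rewrite leqNgt; apply: contraTN mf => /fN fm; rewrite mcoeff_msupp fm eqxx.
Qed.

(* Hartogs: a fraction without poles off X_i = 0 and off X_j = 0 is a
   polynomial. *)
Lemma mpoly_divX_coprime (f g : S) (i j : 'I_n) N M : i != j ->
  f * 'X_j ^+ M = g * 'X_i ^+ N -> exists f', f = f' * 'X_i ^+ N.
Proof.
move=> ij fg; apply: mpoly_divX => m miN.
rewrite -(mcoeffMX f (U_(j) *+ M)) -mpolyXn fg mcoeff_mulX_small //.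
by rewrite mnmDE mulmnE mnmE eq_sym (negPf ij) mul0n.
Qed.

End LocalizationProperties.

(** * Free orbits *)

Section Orbits.
Variables (k : closedFieldType) (gT : finGroupType).
Variable V : mx_representation k [set: gT] 2.

Definition move (A : comAlgType k) (p : 'I_2 -> A) (g : gT) (i : 'I_2) : A :=
  \sum_j V g i j *: p j.

Lemma move1 (A : comAlgType k) (p : 'I_2 -> A) : move p 1%g = p.
Proof.
apply: funext => i; rewrite /move repr_mx1 (bigD1 i) //= mxE eqxx scale1r.
by rewrite big1 ?addr0 // => j /negPf ji; rewrite mxE eq_sym ji scale0r.
Qed.

Lemma moveM (A : comAlgType k) (p : 'I_2 -> A) g h :
  move (move p g) h = move p (h * g)%g.
Proof.
apply: funext => i; rewrite /move repr_mxM ?inE //.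
under [RHS]eq_bigr do rewrite mxE scaler_suml.
rewrite exchange_big; apply: eq_bigr => j _; rewrite scaler_sumr.
by apply: eq_bigr => l _; rewrite scalerA.
Qed.

Lemma move_morph (A A' : comAlgType k) (psi : {lrmorphism A -> A'}) p g i :
  psi (move p g i) = move (fun j => psi (p j)) g i.
Proof. by rewrite raddf_sum; apply: eq_bigr => j _; rewrite /= linearZ. Qed.

Section Family.
Variables (A : comAlgType k) (p : 'I_2 -> A) (P : {mpoly A[2]}).

(** [P] is 1 at p and 0 at the other translates of p: it witnesses over [A] that the orbit is
    free. *)
Definition separates : Prop :=
  forall g, peval (A := A^o) (move p g) P = (g == 1%g)%:R.

Hypothesis PE : separates.

Let Gam : comAlgType A := funalg A (1%g : gT).

Definition orbit_quo : {mpoly A[2]} -> Gam :=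
  peval (fun i => [ffun g => move p g i] : Gam).

HB.instance Definition _ := GRing.LRMorphism.on orbit_quo.

Lemma orbit_quoE f g : orbit_quo f g = peval (A := A^o) (move p g) f.
Proof.
rewrite -[LHS]/(funeval g (orbit_quo f)) [LHS]peval_comp.
by apply: eq_peval => i; apply: ffunE.
Qed.

Definition orbit_gact (g : gT) (f : Gam) : Gam := [ffun h => f (g^-1 * h)%g].

Lemma orbit_gact_quo g f : orbit_gact g (orbit_quo f) = orbit_quo (coord_act V g f).
Proof.
apply/ffunP => h; rewrite [LHS]ffunE [LHS]orbit_quoE [RHS]orbit_quoE /coord_act.
set t := [tuple _ | _ < _].
rewrite (mpoly_lrmorph_ext (g := peval (A := A^o) (move p (g^-1 * h)))
  (h := peval (A := A^o) (move p h) \o comp_mpoly t)) // => i /=.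
rewrite comp_mpolyXU -tnth_nth tnth_mktuple pevalX -moveM raddf_sum.
apply: eq_bigr => j _ /=; rewrite linearZ /= pevalX.
by rewrite -[RHS]/(_ * _) mulr_algl.
Qed.

Lemma orbit_quoP g h : orbit_gact g (orbit_quo P) h = (h == g)%:R.
Proof.
rewrite ffunE orbit_quoE PE; congr ((_ : bool)%:R).
by rewrite -eq_invg_mul invgK eq_sym.
Qed.

Lemma orbit_expand (m : Gam) : m = \sum_g m g *: orbit_gact g (orbit_quo P).
Proof.
apply/ffunP => h; rewrite sum_ffunE (bigD1 h) //= ffunE orbit_quoP eqxx.
rewrite [X in X + _]mulr1 big1 ?addr0 // => g gh.
by rewrite ffunE orbit_quoP eq_sym (negPf gh); apply: mulr0.
Qed.

(** Functions on a free orbit are functions on G. The translates of [P] become the indicator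
    functions, which gives both surjectivity and a basis permuted simply transitively by G. *)
Definition orbit_family : ghilb_fam V A.
Proof.
exists Gam orbit_quo orbit_gact.
- move=> m; exists (\sum_g m g *: coord_act V g P).
  rewrite raddf_sum [RHS]orbit_expand; apply: eq_bigr => g _ /=.
  by rewrite linearZ /= orbit_gact_quo.
- exact: orbit_gact_quo.
- exists (fun f => f = 1); split.
    exists 1%N, (fun=> 1), (fun=> 1); split=> //.
    by rewrite big_ord1 mulr1.
  move=> _ ->; exists (orbit_quo P); split=> [m|c c0].
    by exists 0%N, m; rewrite expr0 scale1r; apply: orbit_expand.
  exists 0%N => h; rewrite expr0 mul1r.
  have /ffunP/(_ h) := c0; rewrite sum_ffunE ffunE (bigD1 h) //=.
  rewrite ffunE orbit_quoP eqxx [X in X + _]mulr1 big1 ?addr0 // => g gh.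
  by rewrite ffunE orbit_quoP eq_sym (negPf gh); apply: mulr0.
Defined.

End Family.

Lemma peval_map (A A' : comAlgType k) (psi : {lrmorphism A -> A'})
    (p : 'I_2 -> A) f :
  psi (peval (A := A^o) p f) =
  peval (A := A'^o) (fun i => psi (p i)) (map_mpoly psi f).
Proof.
elim/mpolyind: f => [|c m f _ _ IHf]; first by rewrite !raddf0.
rewrite !raddfD /= IHf; congr (_ + _).
rewrite map_mpolyZ map_mpolyX !linearZ /=.
rewrite -[_ *: peval _ _]/(_ * _) -[RHS]/(_ * _) rmorphM; congr (_ * _).
rewrite !mpolyXE_id !rmorph_prod; apply: eq_bigr => i _.
by rewrite !rmorphXn /= !pevalX.
Qed.

Section Arrow.
Variables (A A' : comAlgType k) (psi : {lrmorphism A -> A'}) (a : gT).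
Variables (p : 'I_2 -> A) (P : {mpoly A[2]}) (PE : separates p P).
Variables (p' : 'I_2 -> A') (P' : {mpoly A'[2]}) (PE' : separates p' P').
Hypothesis pp' : forall i, p' i = psi (move p a i).

Definition orbit_arr_fun (f : orbit_family PE) : orbit_family PE' :=
  [ffun h => psi ((f : {ffun gT -> A}) (h * a)%g)].

(** The point h p' is the image of h a p, whence the right translation by [a]. For [psi] the
    identity this compares the orbits of p and of a p. *)
Lemma orbit_arr : ghilb_arr psi (orbit_family PE) (orbit_family PE').
Proof.
exists orbit_arr_fun.
- have coordl (t : gT) : linear (fun f : orbit_family PE' =>
      (f : {ffun gT -> A'}) (t * a^-1)%g : A'^o).
    by move=> c f f'; rewrite !ffunE.
  apply: (projective_base_change (T := gT)
    (l := fun t (f : orbit_family PE) => (f : {ffun gT -> A}) t)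
    (b := fun t => orbit_gact t (orbit_quo p P))
    (l' := fun t => linear_of (coordl t))).
  + by move=> c f f'; apply/ffunP => h; rewrite !ffunE rmorphD rmorphM.
  + move=> f; exact: orbit_expand.
  + by move=> t f; rewrite /= ffunE mulgKV.
  + move=> z; apply/ffunP => h; rewrite sum_ffunE (bigD1 (h * a)%g) //= big1.
      rewrite addr0 ffunE ffunE orbit_quoP // eqxx rmorph1 mulgK.
      exact/esym/mulr1.
    move=> g gh; rewrite ffunE ffunE orbit_quoP // eq_sym (negPf gh) rmorph0.
    exact: mulr0.
- move=> f; apply/ffunP => h; rewrite ffunE [LHS](congr1 psi (orbit_quoE _ _ _)).
  rewrite [RHS]orbit_quoE peval_map; apply: eq_peval => i.
  by rewrite -moveM move_morph; congr (move _ h i); apply: funext => j.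
Qed.

End Arrow.

End Orbits.

(** * Endomorphisms of the trivial bundle as invariant polynomials *)

Section OrbitFunctions.
Variables (k : closedFieldType) (gT : finGroupType).
Variable V : mx_representation k [set: gT] 2.
Hypothesis V_free : forall g, g != 1%g -> V g - 1%:M \in unitmx.

(** The row [c g] solves c (V g - 1) = e_i, so the affine form [F g] vanishes at g p and takes the
    value p_i at p. The product over all g other than 1 separates p, up to a power of p_i. *)
Lemma orbit_separated_pow (A : comAlgType k) (p : 'I_2 -> A) i : exists N P,
  forall g, peval (A := A^o) (move V p g) P = if g == 1%g then p i ^+ N else 0.
Proof.
pose c g : 'rV[k]_2 := delta_mx 0 i *m invmx (V g - 1%:M).
pose F g : {mpoly A[2]} :=
  \sum_j (c g 0 j)%:A *: ((move V p g j)%:MP - 'X_j).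
have FE g (q : 'I_2 -> A) : peval (A := A^o) q (F g) =
    \sum_j c g 0 j *: (move V p g j - q j).
  rewrite raddf_sum; apply: eq_bigr => j _ /=.
  rewrite linearZ /= raddfB /= pevalX -[LHS]/(_ * _) mulr_algl.
  by rewrite pevalC (_ : (move V p g j)%:A = move V p g j :> A^o) //; apply: mulr1.
exists #|[pred g : gT | g != 1%g]|, (\prod_(g | g != 1%g) F g) => h.
rewrite rmorph_prod /=; have [->|h1] := eqVneq h 1%g; last first.
  rewrite (bigD1 h) //= FE big1 ?mul0r // => j _.
  by rewrite subrr scaler0.
rewrite -prodr_const; apply: eq_bigr => g g1; rewrite FE move1.
transitivity (\sum_j \sum_l (c g 0 j * (V g - 1%:M) j l) *: p l).
  apply: eq_bigr => j _; under [RHS]eq_bigr do rewrite -scalerA.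
  rewrite -scaler_sumr (_ : move V p g j - p j = \sum_l (V g - 1%:M) j l *: p l) //.
  under [RHS]eq_bigr do rewrite !mxE scalerBl.
  rewrite sumrB; congr (_ - _); rewrite (bigD1 j) //= eqxx scale1r.
  by rewrite big1 ?addr0 // => l /negPf lj; rewrite eq_sym lj scale0r.
rewrite exchange_big /=; transitivity (\sum_l (c g *m (V g - 1%:M)) 0 l *: p l).
  by apply: eq_bigr => l _; rewrite mxE scaler_suml.
rewrite /c mulmxKV ?V_free // (bigD1 i) //= mxE !eqxx scale1r.
by rewrite big1 ?addr0 // => l /negPf li; rewrite mxE li andbF scale0r.
Qed.

Lemma orbit_separated (A : comAlgType k) (p : 'I_2 -> A) i u :
  u * p i = 1 -> exists P, separates V p P.
Proof.
move=> upi; have [N [P PE]] := orbit_separated_pow p i.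
exists (u ^+ N *: P) => g; rewrite linearZ /= PE -[LHS]/(_ * _).
by case: eqP => _; rewrite ?mulr0 // -exprMn upi expr1n.
Qed.

Variables (I : finType) (n : I -> nat).
Variable W : forall i, mx_representation k [set: gT] (n i).
Hypothesis W_trivial : forall i g, W i g = 1%:M.
Variables (i0 : I) (j0 : 'I_(n i0)).
Hypothesis I_unique : forall i, i = i0.
Hypothesis j_unique : forall j, j = j0.

Let E i := taut V (W i).

Lemma equivariant_invariant (A : comAlgType k) (Z : ghilb_fam V A) i
    (s : E i A Z) g j : gact g (val s j) = val s j.
Proof.
have /forallP/(_ g)/forallP/(_ j)/eqP := valP s; rewrite W_trivial => ->.
rewrite (bigD1 j) //= mxE eqxx !scale1r big1 ?addr0 // => l /negPf lj.
by rewrite mxE lj scale0r scale0r.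
Qed.

Lemma gact1 (A : comAlgType k) (Z : ghilb_fam V A) g : gact g (1 : Z) = 1.
Proof. by rewrite -(rmorph1 (quo Z)) gact_quo /coord_act comp_mpoly1. Qed.

Fact unit_section_subproof (A : comAlgType k) (Z : ghilb_fam V A) i :
  [ffun=> 1] \in @equivariant k gT V (n i) (W i) A Z.
Proof.
rewrite inE; apply/forallP => g; apply/forallP => j.
rewrite ffunE gact1 W_trivial (bigD1 j) //= mxE eqxx ffunE !scale1r.
by rewrite big1 ?addr0 // => l /negPf lj; rewrite mxE lj scale0r scale0r.
Qed.

Definition unit_section (A : comAlgType k) (Z : ghilb_fam V A) : dsum_sec E Z :=
  fun i => exist (fun s => s \in @equivariant k gT V (n i) (W i) A Z) _
             (unit_section_subproof Z i).

Section OrbitValues.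
Variables (A : comAlgType k) (p : 'I_2 -> A) (P : {mpoly A[2]}).
Variable PE : separates V p P.
Let Z := orbit_family PE.

(** An invariant function on a free orbit is constant, so b multiplies the unit section by a scalar:
    the value at p of the regular function b. *)
Definition orbit_value (b : endo E) : A :=
  ((val (b A Z (unit_section Z) i0) j0 : Z) : {ffun gT -> A}) 1%g.

Lemma orbit_section_const (s : dsum_sec E Z) i j :
  val (s i) j = ((val (s i) j : {ffun gT -> A}) 1%g) *: (1 : Z).
Proof.
apply/ffunP => g; rewrite ffunE -[RHS]/(_ * _) funalg1 mulr1.
have := equivariant_invariant (s i) g j.
by move=> /(congr1 (fun f : Z => (f : {ffun gT -> A}) g)); rewrite ffunE mulVg.
Qed.

Lemma orbit_valueE (b : endo E) i :
  b A Z (unit_section Z) i = orbit_value b *: unit_section Z i.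
Proof.
rewrite (I_unique i); apply: val_inj; apply/ffunP => j.
rewrite linearZ /= !ffunE (j_unique j) /=; exact: orbit_section_const.
Qed.

Lemma orbit_value_unit (b : endo E) a :
  (forall i, b A Z (unit_section Z) i = a *: unit_section Z i) ->
  orbit_value b = a.
Proof.
move=> /(_ i0) bE; rewrite /orbit_value bE linearZ /= !ffunE.
exact: mulr1.
Qed.

Lemma endoZ (b : endo E) a (s : dsum_sec E Z) i :
  b A Z (fun j => a *: s j) i = a *: b A Z s i.
Proof.
have b0 j : b A Z (fun=> 0) j = 0.
  have := endo_linear b 1 (fun j => 0 : E j A Z) (fun=> 0) j.
  under [X in b A Z X]functional_extensionality_dep do rewrite scaler0 addr0.
  by rewrite scale1r => /esym/(canRL (addrK _)); rewrite subrr.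
rewrite -[RHS]addr0 -(b0 i) -endo_linear; congr (b A Z _ i).
by apply: functional_extensionality_dep => j; rewrite addr0.
Qed.

Lemma orbit_value_comp b c :
  orbit_value (endo_comp b c) = orbit_value b * orbit_value c.
Proof.
apply: orbit_value_unit => i /=.
rewrite (_ : c A Z _ = fun j => orbit_value c *: unit_section Z j).
  by rewrite endoZ orbit_valueE scalerA mulrC.
by apply: functional_extensionality_dep => j; apply: orbit_valueE.
Qed.

Lemma orbit_value_add b c :
  orbit_value (endo_add b c) = orbit_value b + orbit_value c.
Proof. by apply: orbit_value_unit => i /=; rewrite !orbit_valueE scalerDl. Qed.

Lemma orbit_value_scale a b :
  orbit_value (endo_scale a b) = a%:A * orbit_value b.
Proof. by apply: orbit_value_unit => i /=; rewrite orbit_valueE scalerA. Qed.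

Lemma orbit_value_id : orbit_value (endo_id E) = 1.
Proof. by apply: orbit_value_unit => i /=; rewrite scale1r. Qed.

End OrbitValues.

Lemma res_unit_section (A A' : comAlgType k) (psi : {lrmorphism A -> A'})
    (Z : ghilb_fam V A) (Z' : ghilb_fam V A') (u : arr (m := ghilb V) psi Z Z') i :
  res u (unit_section Z i) = unit_section Z' i.
Proof.
apply: val_inj; apply/ffunP => j; rewrite /= !ffunE.
by rewrite -(rmorph1 (quo Z)) (ghilb_fun_quo u) !rmorph1.
Qed.

Lemma orbit_value_arr (A A' : comAlgType k) (psi : {lrmorphism A -> A'}) a
    (p : 'I_2 -> A) (P : {mpoly A[2]}) (PE : separates V p P)
    (p' : 'I_2 -> A') (P' : {mpoly A'[2]}) (PE' : separates V p' P')
    (pp' : forall i, p' i = psi (move V p a i)) (b : endo E) :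
  orbit_value PE' b = psi (orbit_value PE b).
Proof.
pose u : arr (m := ghilb V) psi (orbit_family PE) (orbit_family PE') :=
  orbit_arr PE PE' pp'.
 apply: orbit_value_unit => i.
have -> : unit_section (orbit_family PE') = fun j => res u (unit_section (orbit_family PE) j).
  by apply: functional_extensionality_dep => j; rewrite res_unit_section.
by rewrite endo_res orbit_valueE res_scale res_unit_section.
Qed.

(** The value at the tautological point is defined over the localizations at X_0 and at X_1, and
    both map to the same fraction; Hartogs makes it a polynomial. *)
Lemma orbit_value_polynomial (b : endo E) : exists F : {mpoly k[2]},
  forall (A : comAlgType k) (p : 'I_2 -> A) i u (P : {mpoly A[2]})
    (PE : separates V p P), u * p i = 1 -> orbit_value PE b = peval p F.
Proof.
pose X (i : 'I_2) : {mpoly k[2]} := 'X_i.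
have X0 i : X i != 0.
  apply/eqP => /(congr1 (fun f => f@_U_(i))).
  by rewrite mcoeffX eqxx mcoeff0 => /eqP; rewrite oner_eq0.
have [PK PKE] : exists P, separates V (fun j => infrac (X j)) P.
  by apply: (@orbit_separated _ _ 0 (infrac (X 0))^-1); rewrite mulVf // tofrac_eq0.
have loc_sep i : exists P, separates V (fun j => loc_in (X i) (X j)) P.
  by have [w wE] := loc_unit (X0 i); apply: (orbit_separated wE).
have locE i Q (QE : separates V (fun j => loc_in (X i) (X j)) Q) :
    orbit_value PKE b = loc_val (orbit_value QE b).
  apply: (orbit_value_arr (psi := loc_val (h := X i)) (a := 1%g)) => j.
  by rewrite move1.
have locP i : exists N f, orbit_value PKE b * infrac (X i) ^+ N = infrac f.
  have [Q QE] := loc_sep i; rewrite (locE i Q QE).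
  by have /asboolP[N [f]] := valP (orbit_value QE b); exists N, f.
have [N [f fE]] := locP 0; have [M [g gE]] := locP 1.
have [|F FE] := @mpoly_divX_coprime _ _ f g 0 1 N M isT.
  apply: infrac_inj; rewrite !rmorphM !rmorphXn /= -fE -gE.
  by rewrite -!mulrA [_ ^+ M * _]mulrC.
have KF : orbit_value PKE b = infrac F.
  apply: (mulIf (infracXn_neq0 N (X0 0))).
  by rewrite fE FE rmorphM rmorphXn.
(* A point with p_i invertible is a specialization of the tautological point over the localization
   at X_i, and [orbit_value] is compatible with specialization. *)
exists F => A p i u P PE upi.
have gp : u * peval p (X i) = 1 by rewrite pevalX.
have [Q QE] := loc_sep i.
have lF : orbit_value QE b = loc_in (X i) F.
  by apply: val_inj; rewrite -[LHS]/(loc_val _) -locE.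
rewrite (orbit_value_arr (psi := loc_lift_morphism gp) (a := 1%g) QE).
- by rewrite lF; apply: loc_lift_in.
- by move=> j; rewrite move1; apply/esym; rewrite [LHS]loc_lift_in; [apply: pevalX | exact: gp].
Qed.

Definition invariant_poly (r : {mpoly k[2]}) : Prop :=
  forall g, peval (move V (fun i => 'X_i) g) r = r.

(** The source is [k^o], that is k as an algebra over itself, so that [coord_act] and
    [coord_act_map] apply to polynomials over k. *)
Definition const_alg (A : comAlgType k) (c : k^o) : A := c%:A.

Fact const_alg_zmod A : zmod_morphism (@const_alg A).
Proof. by move=> c d; rewrite /const_alg scalerBl. Qed.
Fact const_alg_monoid A : monoid_morphism (@const_alg A).
Proof. by split=> [|c d]; rewrite /const_alg ?scale1r // -scalerAl mul1r scalerA. Qed.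
Fact const_alg_scalable A : scalable (@const_alg A).
Proof. by move=> c d; rewrite /const_alg -scalerA. Qed.

HB.instance Definition _ (A : comAlgType k) :=
  GRing.isZmodMorphism.Build k^o A (@const_alg A) (@const_alg_zmod A).
HB.instance Definition _ (A : comAlgType k) :=
  GRing.isMonoidMorphism.Build k^o A (@const_alg A) (@const_alg_monoid A).
HB.instance Definition _ (A : comAlgType k) :=
  GRing.isScalable.Build k k^o A *:%R (@const_alg A) (@const_alg_scalable A).

Lemma coord_act_const g (r : {mpoly k[2]}) :
  @coord_act k gT V k^o g r = peval (move V (fun i => 'X_i) g^-1%g) r.
Proof.
rewrite /coord_act; set t := [tuple _ | _ < _].
apply: (mpoly_lrmorph_ext (g := comp_mpoly t)
  (h := peval (move V (fun i => 'X_i : {mpoly k[2]}) g^-1%g))) => i.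
rewrite /= comp_mpolyXU -tnth_nth tnth_mktuple pevalX; apply: eq_bigr => j _.
by congr (_ *: _); apply: mulr1.
Qed.

Lemma map_const_alg (A A' : comAlgType k) (phi : {lrmorphism A -> A'}) (r : {mpoly k[2]}) :
  map_mpoly phi (map_mpoly (@const_alg A) r) = map_mpoly (@const_alg A') r.
Proof.
elim/mpolyind: r => [|c m q _ _ IHq]; first by rewrite !raddf0.
rewrite !raddfD /= IHq; congr (_ + _).
rewrite !map_mpolyZ !map_mpolyX; congr (_ *: _); exact: rmorph_alg.
Qed.

Lemma peval_const_alg (A : comAlgType k) (p : 'I_2 -> A) (r : {mpoly k[2]}) :
  peval (A := A^o) p (map_mpoly (@const_alg A) r) = peval p r.
Proof.
elim/mpolyind: r => [|c m q _ _ IHq]; first by rewrite !raddf0.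
rewrite !raddfD /= IHq; congr (_ + _).
rewrite map_mpolyZ map_mpolyX !linearZ /= -[LHS]/(_ * _) mulr_algl.
rewrite (_ : peval (A := A^o) p 'X_[m] = peval p 'X_[m]) //.
rewrite !mpolyXE_id !rmorph_prod; apply: eq_bigr => i _.
by rewrite !rmorphXn /= !pevalX.
Qed.

Section Multiplication.
Variables (r : {mpoly k[2]}) (r_inv : invariant_poly r).

Definition mult_elt (A : comAlgType k) (Z : ghilb_fam V A) : Z :=
  quo Z (map_mpoly (@const_alg A) r).

Lemma gact_mult_elt (A : comAlgType k) (Z : ghilb_fam V A) g (x : Z) :
  gact g (mult_elt Z * x) = mult_elt Z * gact g x.
Proof.
have [f <-] := quo_surj x.
have coordM : coord_act V g (map_mpoly (@const_alg A) r * f) =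
    map_mpoly (@const_alg A) r * coord_act V g f.
  have {2}-> : map_mpoly (@const_alg A) r = coord_act V g (map_mpoly (@const_alg A) r).
    by rewrite -[RHS]coord_act_map coord_act_const r_inv.
  by rewrite /coord_act rmorphM.
by rewrite /mult_elt -rmorphM !gact_quo -rmorphM coordM.
Qed.

Fact mult_sec_subproof (A : comAlgType k) (Z : ghilb_fam V A) i (s : E i A Z) :
  [ffun j => mult_elt Z * val s j] \in @equivariant k gT V (n i) (W i) A Z.
Proof.
rewrite inE; apply/forallP => g; apply/forallP => j.
rewrite ffunE gact_mult_elt equivariant_invariant W_trivial.
rewrite (bigD1 j) //= mxE eqxx ffunE !scale1r big1 ?addr0 // => l /negPf lj.
by rewrite mxE lj scale0r scale0r.
Qed.

Definition mult_sec (A : comAlgType k) (Z : ghilb_fam V A) i (s : E i A Z) : E i A Z :=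
  exist (fun s => s \in @equivariant k gT V (n i) (W i) A Z) _ (mult_sec_subproof s).

Lemma mult_secE (A : comAlgType k) (Z : ghilb_fam V A) i (s : E i A Z) j :
  val (mult_sec s) j = mult_elt Z * val s j.
Proof. by rewrite ffunE. Qed.

Definition mult_endo : endo E.
Proof.
exists (fun A Z s i => mult_sec (s i)) => [A Z a s t i|A A' phi Z Z' u s i];
  apply: val_inj; apply/ffunP => j; rewrite mult_secE.
  rewrite [in RHS]val_tautP [in LHS]val_tautP !ffunE.
  by rewrite mulrDr scalerAr.
rewrite [LHS](_ : _ = mult_elt Z' * u (val (s i) j)); last by rewrite ffunE.
rewrite [RHS](_ : _ = u (val (mult_sec (s i)) j)); last by rewrite ffunE.
rewrite mult_secE; have [f <-] := quo_surj (val (s i) j).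
rewrite /mult_elt -(map_const_alg phi) -[in RHS]rmorphM !(ghilb_fun_quo u).
by rewrite !rmorphM.
Defined.

Lemma orbit_value_mult (A : comAlgType k) (p : 'I_2 -> A) P (PE : separates V p P) :
  orbit_value PE mult_endo = peval p r.
Proof.
have -> : orbit_value PE mult_endo =
    (mult_elt (orbit_family PE) : {ffun gT -> A}) 1%g * (1 : funalg A (1%g : gT)) 1%g.
  rewrite /orbit_value mult_secE (_ : val (unit_section _ i0) j0 = 1); last by rewrite ffunE.
  by rewrite [LHS]ffunE.
rewrite funalg1 mulr1 [LHS]orbit_quoE peval_const_alg.
by apply: eq_peval => i; rewrite move1.
Qed.

End Multiplication.

Lemma mult_endoD r s (rI : invariant_poly r) (sI : invariant_poly s)
    (rsI : invariant_poly (r + s)) :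
  mult_endo rsI = endo_add (mult_endo rI) (mult_endo sI).
Proof.
apply: endo_ext => A Z x i; apply: val_inj; apply/ffunP => j.
rewrite mult_secE [RHS]ffunE !mult_secE -mulrDl; congr (_ * _).
by rewrite /mult_elt -rmorphD -raddfD.
Qed.

Lemma mult_endoM r s (rI : invariant_poly r) (sI : invariant_poly s)
    (rsI : invariant_poly (r * s)) :
  mult_endo rsI = endo_comp (mult_endo rI) (mult_endo sI).
Proof.
apply: endo_ext => A Z x i; apply: val_inj; apply/ffunP => j.
rewrite mult_secE [RHS]mult_secE mult_secE mulrA; congr (_ * _).
by rewrite /mult_elt -rmorphM -[in RHS]rmorphM.
Qed.

Lemma mult_endoC c (cI : invariant_poly c%:MP) :
  mult_endo cI = endo_scale c (endo_id E).
Proof.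
apply: endo_ext => A Z x i; apply: val_inj; apply/ffunP => j.
transitivity (val ((c%:A : A) *: x i) j) => //.
rewrite mult_secE linearZ /= ffunE.
rewrite (_ : mult_elt c%:MP Z = (c%:A : A)%:A) ?mulr_algl //.
rewrite /mult_elt /map_mpoly mmapC /= -[_%:MP]mulr1 mul_mpolyC linearZ.
by rewrite rmorph1.
Qed.

(** All identities are checked at the tautological point X over the fraction field, where
    [orbit_value] of b is [F b]. Invariance holds because X and g X have the same orbit. *)
Lemma invariant_function_poly : exists F : endo E -> {mpoly k[2]},
  [/\ F (endo_id E) = 1, forall b c, F (endo_comp b c) = F b * F c,
      forall b c, F (endo_add b c) = F b + F c,
      forall a b, F (endo_scale a b) = a *: F b
    & (forall b, invariant_poly (F b)) /\
      forall r (r_inv : invariant_poly r), F (mult_endo r_inv) = r].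
Proof.
have [F FE] := choice orbit_value_polynomial.
pose X (i : 'I_2) : fracalg k 2 := infrac 'X_i.
have X0 i : X i != 0.
  rewrite tofrac_eq0; apply/eqP => /(congr1 (fun f => f@_U_(i))).
  by rewrite mcoeffX eqxx mcoeff0 => /eqP; rewrite oner_eq0.
have inX i : (X i)^-1 * X i = 1 by rewrite mulVf.
have [P PE] := orbit_separated (inX 0).
have FX b : infrac (F b) = orbit_value PE b.
  rewrite (FE b _ _ _ _ _ PE (inX 0)) -[in LHS](peval_id (F b)).
  exact: peval_comp.
exists F; split=> [|b c|b c|a b|]; try apply: infrac_inj.
- by rewrite FX orbit_value_id rmorph1.
- by rewrite rmorphM /= !FX orbit_value_comp.
- by rewrite rmorphD /= !FX orbit_value_add.
- by rewrite infrac_scalable !FX orbit_value_scale mulr_algl.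
split=> [b g|r r_inv]; apply: infrac_inj; last first.
  rewrite FX orbit_value_mult -[in RHS](peval_id r); exact/esym/peval_comp.
(* The formula for values requires an invertible coordinate of the point g X; row 0 of the
   invertible matrix [V g] is not zero, so coordinate 0 will do. *)
have gX0 : move V X g 0 != 0.
  rewrite -[move _ _ _ _]/(\sum_j V g 0 j *: infrac 'X_j).
  under eq_bigr do rewrite -infrac_scalable.
  rewrite -rmorph_sum tofrac_eq0; apply/eqP => gX.
  have Vg0 j : V g 0 j = 0.
    have := congr1 (fun f => f@_U_(j)) gX; rewrite mcoeff0 raddf_sum (bigD1 j) //=.
    rewrite mcoeffZ mcoeffXU eqxx mulr1 big1 ?addr0 // => l /negPf lj.
    by rewrite mcoeffZ mcoeffXU lj mulr0.
  have := congr1 (fun M : 'M_2 => M 0 0) (repr_mxK V (in_setT g) 1%:M).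
  rewrite /= mul1mx !mxE big1 => [/eqP|j _]; last by rewrite Vg0 mul0r.
  by rewrite eq_sym oner_eq0.
have gX1 : (move V X g 0)^-1 * move V X g 0 = 1 by rewrite mulVf.
have [Q QE] := orbit_separated gX1.
rewrite [RHS]FX; have := orbit_value_arr (psi := idfun) (a := g) PE QE.
move=> /(_ (fun i => erefl) b) /= <-; rewrite (FE b _ _ _ _ _ QE gX1).
rewrite peval_comp; apply: eq_peval => i; exact: move_morph.
Qed.

End OrbitFunctions.

(** * Derivations of invariant polynomials *)

Lemma mpoly_ring_ind (R : nzRingType) (n : nat) (Q : {mpoly R[n]} -> Prop) :
  (forall c, Q c%:MP) -> (forall i, Q 'X_i) ->
  (forall f g, Q f -> Q g -> Q (f + g)) ->
  (forall f g, Q f -> Q g -> Q (f * g)) -> forall f, Q f.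
Proof.
move=> QC QX QD QM f; rewrite [f]mpolyE.
elim/big_ind: _ => [|//|m _]; first by rewrite -mpolyC0.
rewrite -mul_mpolyC; apply: (QM _ _) => //; rewrite mpolyXE_id.
elim/big_ind: _ => [|//|i _]; first by rewrite -mpolyC1.
elim: (m i) => [|e IHe]; first by rewrite expr0 -mpolyC1.
by rewrite exprS; apply: (QM _ _).
Qed.

Section AlgebraicDependence.
Variable k : fieldType.
Local Notation S := {mpoly k[2]}.

(* There are N^3 monomials of partial degrees less than N in the r j, and
   their values have total degree at most 3 e N, where e bounds the degrees
   of the r j. *)
Lemma algebraically_dependent (r : 'I_3 -> S) :
  exists2 P : {mpoly k[3]}, P != 0 & peval r P = 0.
Proof.
pose e := (\max_j msize (r j)).+1.
(* [N] is chosen so that N^3 > ((3e + 1) N)^2 >= (L + 1)^2: there are more monomials than exponents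
   in a box that contains every degree up to [L]. *)
pose N := ((3 * e).+1 ^ 2).+1; pose L := (3 * e * N)%N.
pose T1 := {ffun 'I_3 -> 'I_N}; pose T2 := {ffun 'I_2 -> 'I_L.+1}.
pose mon (t : T1) : 'X_{1..3} := [multinom (t j : nat) | j < 3].
pose cof (t : T2) : 'X_{1..2} := [multinom (t j : nat) | j < 2].
(* Row a lists the coefficients of the value at r of the a-th monomial, so a vector of the left
   kernel is a polynomial relation between the r j. *)
pose M : 'M[k]_(#|T1|, #|T2|) :=
  \matrix_(a, b) (peval r 'X_[mon (enum_val a)])@_(cof (enum_val b)).
have card : (#|T2| < #|T1|)%N.
  rewrite !card_ffun !card_ord /L.
  have le : ((3 * e * N).+1 <= (3 * e).+1 * N)%N.
    by rewrite [((3 * e).+1 * N)%N]mulSn -add1n leq_add2r.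
  apply: (@leq_ltn_trans (((3 * e).+1 * N) ^ 2)%N); first by rewrite leq_exp2r.
  by rewrite expnMn [(N ^ 3)%N]expnS ltn_mul2r expn_gt0 /= /N.
have : (0 < \rank (kermx M))%N.
  rewrite mxrank_ker subn_gt0; exact: leq_ltn_trans (rank_leq_col M) card.
case: (eqVneq (kermx M) 0) => [->|/rowV0Pn[z /sub_kermxP zM z0] _].
  by rewrite mxrank0.
exists (\sum_a z 0 a *: 'X_[mon (enum_val a)]).
  apply: contraNneq z0 => P0; apply/eqP/rowP => a; rewrite mxE.
  have := congr1 (fun P => P@_(mon (enum_val a))) P0.
  rewrite mcoeff0 raddf_sum (bigD1 a) //= mcoeffZ mcoeffX eqxx mulr1.
  rewrite big1 ?addr0 // => b ba; rewrite mcoeffZ mcoeffX.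
  case: eqP => [mab|_]; last by rewrite mulr0.
  case/eqP: ba; apply: enum_val_inj; apply/ffunP => j; apply: val_inj.
  by have := congr1 (fun m : 'X_{1..3} => m j) mab; rewrite /mon !mnmE.
rewrite raddf_sum; apply/mpolyP => m; rewrite mcoeff0 raddf_sum /=.
under eq_bigr do rewrite linearZ /= mcoeffZ.
have [mL|Lm] := leqP (mdeg m) L.
  have mlt j : (m j < L.+1)%N.
    by rewrite ltnS (leq_trans _ mL) // mdegE (bigD1 j) //= leq_addr.
  pose t : T2 := [ffun j => Ordinal (mlt j)].
  have mt : m = cof (enum_val (enum_rank t)).
    by apply/mnmP => j; rewrite mnmE enum_rankK ffunE.
  have := congr1 (fun M : 'rV_ _ => M 0 (enum_rank t)) zM; rewrite mxE [RHS]mxE => zM0.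
  rewrite -[RHS]zM0.
  by apply: eq_bigr => a _; rewrite mxE -mt.
rewrite big1 // => a _; rewrite [_@_m](_ : _ = 0) ?mulr0 //.
apply: memN_msupp_eq0; apply: msize_mdeg_ge; apply: leq_trans Lm.
have size_mul (p q : S) c d : (msize p <= c.+1)%N -> (msize q <= d.+1)%N ->
    (msize (p * q) <= (c + d).+1)%N.
  have [->|p0] := eqVneq p 0; first by rewrite mul0r msize0.
  have [->|q0] := eqVneq q 0; first by rewrite mulr0 msize0.
  rewrite msizeM // => pc qd.
  by rewrite -subn1 leq_subLR add1n (leq_trans (leq_add pc qd)) // addSn addnS.
have size_pow j c : (msize (r j ^+ c) <= (e * c).+1)%N.
  elim: c => [|c IHc]; first by rewrite expr0 msize1.
  rewrite exprS mulnS; apply: size_mul => //.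
  by rewrite ltnW // ltnS ltnW // ltnS (leq_bigmax (F := fun j => msize (r j))).
have size_prod (s : seq 'I_3) : (msize (\prod_(j <- s) r j ^+ mon (enum_val a) j)
    <= (e * N * size s).+1)%N.
  elim: s => [|j s IHs]; first by rewrite big_nil msize1.
  rewrite big_cons /= mulnS; apply: size_mul => //.
  by rewrite (leq_trans (size_pow _ _)) // ltnS leq_mul2l mnmE ltnW ?orbT.
rewrite mpolyXE_id rmorph_prod /=; under eq_bigr do rewrite rmorphXn /= pevalX.
have := size_prod (enum 'I_3); rewrite big_enum size_enum_ord /=.
by rewrite /L mulnC mulnA.
Qed.
End AlgebraicDependence.

(** The matrix with rows u, v, w kills the nonzero vector (a, b, c), so its determinant is 0; the
    conclusion is the expansion along u. Cramer's combinations of the equations show that a, b and c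
    each annihilate the determinant. *)
Lemma det3_eq0 (R : idomainType) (a b c u0 u1 u2 v0 v1 v2 w0 w1 w2 : R) :
  [|| a != 0, b != 0 | c != 0] ->
  a * u0 + (b * u1 + c * u2) = 0 -> a * v0 + (b * v1 + c * v2) = 0 ->
  a * w0 + (b * w1 + c * w2) = 0 ->
  u0 * (v1 * w2 - w1 * v2) =
  u1 * (v0 * w2 - w0 * v2) + u2 * (v1 * w0 - w1 * v0).
Proof.
move=> abc u v w; apply/eqP; rewrite -subr_eq0.
set d := (X in X == 0).
have da : a * d = 0.
  transitivity ((a * u0 + (b * u1 + c * u2)) * (v1 * w2 - w1 * v2)
    - (a * v0 + (b * v1 + c * v2)) * (u1 * w2 - u2 * w1)
    + (a * w0 + (b * w1 + c * w2)) * (u1 * v2 - u2 * v1)); first by rewrite /d; ring.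
  by rewrite u v w !mul0r subr0 addr0.
have db : b * d = 0.
  transitivity (- (a * u0 + (b * u1 + c * u2)) * (v0 * w2 - v2 * w0)
    + (a * v0 + (b * v1 + c * v2)) * (u0 * w2 - u2 * w0)
    - (a * w0 + (b * w1 + c * w2)) * (u0 * v2 - u2 * v0)); first by rewrite /d; ring.
  by rewrite u v w oppr0 !mul0r subr0 addr0.
have dc : c * d = 0.
  transitivity ((a * u0 + (b * u1 + c * u2)) * (v0 * w1 - v1 * w0)
    - (a * v0 + (b * v1 + c * v2)) * (u0 * w1 - u1 * w0)
    + (a * w0 + (b * w1 + c * w2)) * (u0 * v1 - u1 * v0)); first by rewrite /d; ring.
  by rewrite u v w !mul0r subr0 addr0.
case/or3P: abc => nz.
- by move/eqP: da; rewrite mulf_eq0 (negPf nz).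
- by move/eqP: db; rewrite mulf_eq0 (negPf nz).
- by move/eqP: dc; rewrite mulf_eq0 (negPf nz).
Qed.

Section Derivations.
Variable k : fieldType.
Hypothesis char0 : [pchar k] =i pred0.
Local Notation S := {mpoly k[2]}.

Definition subalgebra (Inv : S -> Prop) : Prop :=
  [/\ forall c, Inv c%:MP, forall f g, Inv f -> Inv g -> Inv (f + g)
    & forall f g, Inv f -> Inv g -> Inv (f * g)].

(** This encodes a derivation from the subalgebra [Inv] to S; off [Inv] the values of D are
    arbitrary. *)
Definition derivation (Inv : S -> Prop) (D : S -> S) : Prop :=
  [/\ forall c, D c%:MP = 0,
      forall f g, Inv f -> Inv g -> D (f + g) = D f + D g
    & forall f g, Inv f -> Inv g -> D (f * g) = f * D g + g * D f].

Lemma mderiv_derivation Inv l : derivation Inv (mderiv l).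
Proof.
split=> [c|f g _ _|f g _ _]; rewrite ?mderivC ?mderivD ?mderivM //; ring.
Qed.

Lemma mderiv_var n (i j : 'I_n) : ('X_i : {mpoly k[n]})^`M(j) = (i == j)%:R.
Proof.
rewrite mderivX mnmE; case: eqP => [->|_]; last by rewrite scale0r.
rewrite scale1r (_ : (U_(j) - U_(j) = 0)%MM) ?mpolyX0 //.
by apply/mnmP => l; rewrite mnmBE subnn mnmE.
Qed.

Lemma derivation_chain Inv D n (r : 'I_n -> S) (P : {mpoly k[n]}) :
  subalgebra Inv -> derivation Inv D -> (forall j, Inv (r j)) ->
  Inv (peval r P) /\ D (peval r P) = \sum_j peval r P^`M(j) * D (r j).
Proof.
move=> [IC ID IM] [DC DD DM] rI; elim/mpoly_ring_ind: P => [c|i|f g [fI Df] [gI Dg]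
  |f g [fI Df] [gI Dg]].
- rewrite pevalC -[c%:A]/(c *: 1) -mul_mpolyC mulr1 DC; split=> //.
  by rewrite big1 // => j _; rewrite mderivC raddf0 mul0r.
- rewrite pevalX; split=> //; rewrite (bigD1 i) //= mderiv_var eqxx rmorph1 mul1r.
  by rewrite big1 ?addr0 // => j /negPf ji; rewrite mderiv_var eq_sym ji rmorph0 mul0r.
- rewrite rmorphD /=; split; first exact: ID.
  under eq_bigr do rewrite mderivD rmorphD mulrDl.
  by rewrite big_split DD //= Df Dg.
- rewrite rmorphM /=; split; first exact: IM.
  under eq_bigr do rewrite mderivM rmorphD !rmorphM mulrDl.
  rewrite big_split DM //= Df Dg [RHS]addrC !mulr_sumr.
  by congr (_ + _); apply: eq_bigr => j _; ring.
Qed.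

Lemma msize_mderiv n (P : {mpoly k[n]}) j : P^`M(j) != 0 -> (msize P^`M(j) < msize P)%N.
Proof.
move=> Pj0; rewrite -[msize P^`M(j)]mlead_deg //.
have := mlead_supp Pj0; rewrite mcoeff_msupp mcoeff_mderiv => cP.
have : (mlead P^`M(j) + U_(j))%MM \in msupp P.
  by rewrite mcoeff_msupp; apply: contraNneq cP => ->; rewrite mul0rn.
by move/msize_mdeg_lt; rewrite mdegD mdeg1 addn1.
Qed.

Lemma mderiv_all0 n (P : {mpoly k[n]}) : (forall j, P^`M(j) = 0) -> P = (P@_0)%:MP.
Proof.
move=> P0; apply/mpolyP => m; rewrite mcoeffC.
have [->|m0] := eqVneq m 0%MM; first by rewrite mulr1.
have [j mj] : exists j, (0 < m j)%N.
  apply/existsP; apply: contraNT m0; rewrite negb_exists => /forallP m0.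
  by apply/eqP/mnmP => j; rewrite mnm0E; apply/eqP; rewrite -leqn0 leqNgt.
have := congr1 (fun f => f@_(m - U_(j))) (P0 j); rewrite mcoeff_mderiv mcoeff0.
rewrite submK; last by rewrite lep1mP -lt0n.
move/eqP; rewrite mulr0 -mulr_natr mulf_eq0 => /orP[/eqP//|].
by have /pcharf0P -> := char0.
Qed.

(* A minimal algebraic relation P between r 0, r 1, r 2 yields, by the chain
   rule, a nontrivial linear relation between the columns of the matrix of
   the three derivations D, d/dX_0, d/dX_1 applied to the r j. *)
Lemma derivation_jacobian Inv D (f r s : S) :
  subalgebra Inv -> derivation Inv D -> Inv f -> Inv r -> Inv s ->
  D f * (r^`M(0) * s^`M(1) - r^`M(1) * s^`M(0)) =
  D r * (f^`M(0) * s^`M(1) - f^`M(1) * s^`M(0)) +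
  D s * (r^`M(0) * f^`M(1) - r^`M(1) * f^`M(0)).
Proof.
move=> IS DD fI rI sI.
pose q (j : 'I_3) := tnth [tuple f; r; s] j.
have qI j : Inv (q j).
  by rewrite /q; case: j => [[|[|[|//]]] jP].
pose rel n := `[< exists P : {mpoly k[3]}, [/\ P != 0, peval q P = 0 & msize P = n] >].
have exrel : exists n, rel n.
  have [P P0 qP] := algebraically_dependent q.
  by exists (msize P); apply/asboolP; exists P.
case: (ex_minnP exrel) => _ /asboolP[P [P0 qP <-]] Pmin.
(* By minimality of P, a partial derivative vanishing at q is 0; if all are 0, then P is constant in
   characteristic 0, and a constant relation is 0. *)
have [j qj] : exists j, peval q P^`M(j) != 0.
  apply/existsP; apply: contraNT P0; rewrite negb_exists => /forallP Pj.
  have Pj0 j : P^`M(j) = 0.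
    apply: contraTeq isT => Pj0; have := msize_mderiv Pj0.
    rewrite ltnNge Pmin //; apply/asboolP; exists P^`M(j); split=> //.
    by have := Pj j; rewrite negbK => /eqP.
  have PC := mderiv_all0 Pj0; move: qP; rewrite PC pevalC => /eqP.
  by rewrite scaler_eq0 oner_eq0 orbF => /eqP ->; rewrite mpolyC0.
have lin d : derivation Inv d -> \sum_j peval q P^`M(j) * d (q j) = 0.
  move=> dD; have [_ <-] := derivation_chain P IS dD qI.
  by rewrite qP -mpolyC0; have [-> _ _] := dD.
have := lin _ DD; have := lin _ (mderiv_derivation Inv 0).
have := lin _ (mderiv_derivation Inv 1).
rewrite !big_ord_recl !big_ord0 !addr0 /q !(tnth_nth 0) /=.
move=> e1 e0 eD; apply: (det3_eq0 _ eD e0 e1).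
case: j qj => [[|[|[|//]]] jP] qj; apply/or3P.
- by apply: Or31; rewrite (_ : ord0 = Ordinal jP) //; apply: val_inj.
- by apply: Or32; rewrite (_ : lift _ _ = Ordinal jP) //; apply: val_inj.
- by apply: Or33; rewrite (_ : lift _ _ = Ordinal jP) //; apply: val_inj.
Qed.

End Derivations.

(** * Derivations from the invariants to the polynomial ring *)

Section InvariantDerivations.
Variables (k : closedFieldType) (gT : finGroupType).
Hypothesis char0 : [pchar k] =i pred0.
Variable V : mx_representation k [set: gT] 2.
Hypothesis V_free : forall g, g != 1%g -> V g - 1%:M \in unitmx.

Local Notation S := {mpoly k[2]}.
Local Notation X := (fun i : 'I_2 => 'X_i : S).
Local Notation gm g := (peval (move V X g)).
Local Notation Inv := (invariant_poly V).

Lemma invariant_subalgebra : subalgebra Inv.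
Proof.
split=> [c|f f' fI fI'|f f' fI fI'] g.
- by rewrite pevalC -[c%:A]/(c *: 1) -mul_mpolyC mulr1.
- by rewrite rmorphD /= fI fI'.
- by rewrite rmorphM /= fI fI'.
Qed.

Lemma gm_comp g h (f : S) : gm h (gm g f) = gm (g * h)%g f.
Proof.
rewrite peval_comp; apply: eq_peval => i.
rewrite move_morph -moveM; congr (move V _ g i); apply: funext => j.
exact: pevalX.
Qed.

Definition trace (f : S) : S := \sum_g gm g f.

Lemma trace_invariant f : Inv (trace f).
Proof.
move=> h; rewrite raddf_sum /=; under eq_bigr do rewrite gm_comp.
by rewrite /trace [RHS](reindex_inj (mulIg h)).
Qed.

Let idS : {lrmorphism S^o -> S^o} := idfun.
Let sq : comAlgType S := @sqext S S^o S^o idS.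

(** This is f(X + eps e_l), a ring morphism that is not S-linear for the S-algebra structure of
    [sq]. *)
Definition diff_hom (l : 'I_2) (f : S) : sq := @SqExt S S^o S^o idS f f^`M(l).

Fact diff_hom_monoid l : monoid_morphism (diff_hom l).
Proof.
split=> [|f f']; apply: sqext_eq => //=; first by rewrite -mpolyC1 mderivC.
by rewrite mderivM addrC; congr (_ + _); rewrite mulrC.
Qed.

Lemma diff_homX l f e : diff_hom l (f ^+ e) = diff_hom l f ^+ e.
Proof.
have [h1 hM] := diff_hom_monoid l.
by elim: e => [|e IHe]; rewrite ?expr0 // !exprS hM IHe.
Qed.

Lemma diff_hom_prod l (T : finType) (F : T -> S) :
  diff_hom l (\prod_t F t) = \prod_t diff_hom l (F t).
Proof. by have [h1 hM] := diff_hom_monoid l; apply: big_morph. Qed.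

(* Over S itself, the point (g X_0, g X_1) together with its derivative in
   the direction X_l: the infinitesimal part of [jet g l Q] is the derivative,
   with the coefficients of Q held constant, of Q along the g-th branch. *)
Definition jet g l : {lrmorphism {mpoly S[2]} -> sq} :=
  peval (A := sq) (fun j => diff_hom l (move V X g j)).

Lemma jetX g l i : jet g l 'X_i = diff_hom l (move V X g i).
Proof. exact: pevalX. Qed.

Lemma jetC g l c : jet g l c%:MP = c%:A.
Proof. exact: pevalC. Qed.

Lemma jet_body g l Q : body (jet g l Q) = peval (A := S^o) (move V X g) Q.
Proof. exact: (peval_comp (@sqbody S S^o S^o idS)). Qed.

Lemma jet_infin g l Q :
  infin (jet g l Q) = \sum_(m <- msupp Q) Q@_m * (gm g 'X_[m])^`M(l).
Proof.
rewrite {1}[Q]mpolyE linear_sum /=.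
under eq_bigr do rewrite linearZ /=.
rewrite infin_sum; apply: eq_bigr => m _; congr (_ * _).
rewrite mpolyXE_id [gm g _](_ : _ = \prod_i move V X g i ^+ m i).
  rewrite -[RHS]/(infin (diff_hom l _)) diff_hom_prod; congr infin.
  rewrite rmorph_prod; apply: eq_bigr => i _.
  by rewrite diff_homX -(jetX g l i); apply: rmorphXn.
by rewrite mpolyXE_id rmorph_prod; apply: eq_bigr => i _; rewrite rmorphXn /= pevalX.
Qed.

(** Off X_i = 0 the differentials of invariants generate all differentials. Replacing each monomial
    of Q by its trace sums the derivatives of Q over all branches g X; Q is built so that only the
    branch g = 1 contributes. *)
Lemma invariant_jets (i : 'I_2) : exists N, forall l0, exists s : seq (S * S),
  (forall p, p \in s -> Inv p.2) /\
  forall l, \sum_(p <- s) p.1 * p.2^`M(l) = if l == l0 then X i ^+ N else 0.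
Proof.
have [M [P PE]] := orbit_separated_pow V_free X i.
(* P vanishes on the branches other than 1, and its square also has zero derivative there. On the
   branch 1 the last factor vanishes with derivative dX_l0, and P * P contributes X_i^(2M). *)
exists (M + M)%N => l0; pose Q := P * P * ('X_l0 - (X l0)%:MP).
exists [seq (Q@_m, trace 'X_[m]) | m <- msupp Q]; split=> [p|l].
  by case/mapP => m _ ->; apply: trace_invariant.
rewrite big_map /=.
transitivity (\sum_g infin (jet g l Q)).
  under [RHS]eq_bigr do rewrite jet_infin.
  rewrite exchange_big; apply: eq_bigr => m _.
  by rewrite /trace raddf_sum mulr_sumr.
have jetQ g : jet g l Q = jet g l P * jet g l P *
    (jet g l 'X_l0 - jet g l (X l0)%:MP).
  by rewrite -rmorphB -!rmorphM.
rewrite (bigD1 1%g) //= [X in _ + X]big1 => [|g g1]; last first.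
  have : body (jet g l P) = 0 by rewrite jet_body PE (negPf g1).
  rewrite jetQ; case: (jet g l P) => b c /= ->.
  by rewrite -[LHS]/(0 * 0 * _ + _ * (0 * c + 0 * c)) !mul0r addr0 mulr0 add0r.
have := jet_body 1%g l P; rewrite PE eqxx addr0 jetQ jetX jetC.
case: (jet _ l P) => b c /= ->; rewrite move1.
rewrite (_ : ('X_l0 : S)%:A = 'X_l0 :> S^o) ?subrr ?mul0r ?addr0; last exact: mulr1.
rewrite mderiv_var scaler0 subr0 eq_sym exprD.
by case: eqP => _; rewrite ?mulr1 ?mulr0.
Qed.

(** Constant terms are carried through the induction because the product rule for the gradient at 0
    involves them. *)
Lemma move_mcoeff0 g (f : S) :
  (gm g f)@_0 = f@_0 /\
  forall j, ((gm g f)^`M(j))@_0 = \sum_l (f^`M(l))@_0 * V g l j.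
Proof.
elim/mpoly_ring_ind: f => [c|i|f f' [IH0 IH] [IH0' IH']|f f' [IH0 IH] [IH0' IH']].
- rewrite pevalC -[c%:A]/(c *: 1) -mul_mpolyC mulr1; split=> // j.
  by rewrite mderivC mcoeff0 big1 // => l _; rewrite mderivC mcoeff0 mul0r.
- rewrite pevalX; split=> [|j].
    rewrite mcoeffX mnm1_eq0 raddf_sum big1 // => j _ /=.
    by rewrite mcoeffZ mcoeffX mnm1_eq0 mulr0.
  have -> : (move V X g i)^`M(j) = (V g i j)%:MP.
    rewrite /move linear_sum /=; under eq_bigr do rewrite mderivZ mderiv_var.
    rewrite (bigD1 j) //= eqxx big1 ?addr0 => [|l /negPf ->]; last exact: scaler0.
    by rewrite -mul_mpolyC mulr1.
  rewrite mcoeffC eqxx mulr1.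
  rewrite (bigD1 i) //= mderiv_var eqxx mcoeff1 eqxx mul1r big1 ?addr0 // => l /negPf li.
  by rewrite mderiv_var eq_sym li mcoeff0 mul0r.
- rewrite rmorphD /= !mcoeffD IH0 IH0'; split=> // j.
  under eq_bigr do rewrite mderivD mcoeffD mulrDl.
  by rewrite big_split mderivD mcoeffD /= IH IH'.
- rewrite rmorphM /= !rmorphM /= IH0 IH0'; split=> // j.
  under eq_bigr do rewrite mderivM mcoeffD !rmorphM /= mulrDl.
  rewrite big_split mderivM mcoeffD !rmorphM /= IH IH' IH0 IH0' mulr_suml mulr_sumr.
  by congr (_ + _); apply: eq_bigr => l _; ring.
Qed.

Hypothesis nontrivial : (1 < #|gT|)%N.

Lemma invariant_gradient f l : Inv f -> (f^`M(l))@_0 = 0.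
Proof.
move=> fI; have [g g1] : exists g : gT, g != 1%g.
  apply/existsP; apply: contraTT nontrivial; rewrite negb_exists -leqNgt.
  move/forallP => g1; rewrite -(cards1 (1%g : gT)) -cardsT subset_leq_card //.
  by apply/subsetP => g _; have := g1 g; rewrite negbK inE.
pose c : 'rV[k]_2 := \row_j (f^`M(j))@_0.
suff c0 : c = 0 by have := congr1 (fun c : 'rV_2 => c 0 l) c0; rewrite !mxE.
rewrite -[c](mulmxK (V_free g1)) mulmxBr mulmx1 (_ : c *m V g = c) ?subrr ?mul0mx //.
apply/rowP => j; have [_ /(_ j)] := move_mcoeff0 g f; rewrite fI !mxE => ->.
by apply: eq_bigr => i _; rewrite mxE.
Qed.

(** If all invariants were constant, [invariant_jets] would give X_0^N = 0. *)
Lemma invariant_nonconstant : exists f m, [/\ Inv f, f@_m != 0 & (0 < mdeg m)%N].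
Proof.
have [N /(_ 0)[s [sI /(_ 0)]]] := invariant_jets 0; rewrite eqxx => sX.
apply: contrapT => H.
have : 'X_0 ^+ N == 0 :> S.
  rewrite -sX big_seq big1 // => p /sI pI; rewrite (_ : p.2^`M(0) = 0) ?mulr0 //.
  apply/mpolyP => m; rewrite mcoeff0 mcoeff_mderiv (_ : p.2@_ _ = 0) ?mul0rn //.
  apply/eqP; apply: contraT => pm; case: H; exists p.2, (m + U_(0%R))%MM.
  by split=> //; rewrite mdegD mdeg1 addn1.
rewrite expf_eq0 => /andP[_ /eqP/(congr1 (fun f : S => f@_U_(0)))].
by rewrite mcoeffXU eqxx mcoeff0 => /eqP; rewrite oner_eq0.
Qed.

Section Derivation.
Variables (D : S -> S) (DD : derivation Inv D).

Let grad (u : seq (S * S)) l := \sum_(p <- u) p.1 * p.2^`M(l).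
Let Dsum (u : seq (S * S)) := \sum_(p <- u) p.1 * D p.2.

(** The Jacobian identity is linear in (D r, grad r) and in (D s, grad s), so it extends to S-linear
    combinations, which need not come from a single invariant. *)
Lemma derivation_jacobian_sum f (u w : seq (S * S)) : Inv f ->
  (forall p, p \in u -> Inv p.2) -> (forall p, p \in w -> Inv p.2) ->
  D f * (grad u 0 * grad w 1 - grad u 1 * grad w 0) =
  Dsum u * (f^`M(0) * grad w 1 - f^`M(1) * grad w 0) +
  Dsum w * (grad u 0 * f^`M(1) - grad u 1 * f^`M(0)).
Proof.
move=> fI; rewrite /grad /Dsum; elim: w => [|r w IHw] uI wI.
  by rewrite !big_nil; ring.
have rI : Inv r.2 by apply: wI; rewrite mem_head.
have {}IHw := IHw uI (fun p pw => wI p (@mem_behead _ (r :: w) p pw)).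
have ur : D f * (grad u 0 * r.2^`M(1) - grad u 1 * r.2^`M(0)) =
    Dsum u * (f^`M(0) * r.2^`M(1) - f^`M(1) * r.2^`M(0)) +
    D r.2 * (grad u 0 * f^`M(1) - grad u 1 * f^`M(0)).
  rewrite /grad /Dsum; elim: u uI {IHw} => [|p u IHu] uI.
    by rewrite !big_nil; ring.
  have pI : Inv p.2 by apply: uI; rewrite mem_head.
  have {}IHu := IHu (fun q qu => uI q (@mem_behead _ (p :: u) q qu)).
  rewrite !big_cons.
  have J := derivation_jacobian char0 invariant_subalgebra DD fI pI rI.
  set a0 := \sum_(_ <- _) _ in IHu *; set a1 := \sum_(_ <- _) _ in IHu *.
  set aD := \sum_(_ <- _) _ in IHu *.
  transitivity (p.1 * (D f * (p.2^`M(0) * r.2^`M(1) - p.2^`M(1) * r.2^`M(0)))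
    + D f * (a0 * r.2^`M(1) - a1 * r.2^`M(0))); first by ring.
  by rewrite J IHu; ring.
rewrite /grad /Dsum in ur; rewrite !big_cons.
set a0 := \sum_(_ <- u) _ * _^`M(0) in IHw ur *.
set a1 := \sum_(_ <- u) _ * _^`M(1) in IHw ur *.
set aD := \sum_(_ <- u) _ * D _ in IHw ur *.
set b0 := \sum_(_ <- w) _ * _^`M(0) in IHw *.
set b1 := \sum_(_ <- w) _ * _^`M(1) in IHw *.
set bD := \sum_(_ <- w) _ * D _ in IHw *.
transitivity (r.1 * (D f * (a0 * r.2^`M(1) - a1 * r.2^`M(0)))
  + D f * (a0 * b1 - a1 * b0)); first by ring.
by rewrite ur IHw; ring.
Qed.

(* Hartogs: the jets give coefficients with poles only along X_0 = 0, and
   coefficients with poles only along X_1 = 0, and these agree. *)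
Lemma invariant_derivation_extends : exists A : 'I_2 -> S,
  forall f, Inv f -> D f = A 0 * f^`M(0) + A 1 * f^`M(1).
Proof.
have [N jN] := choice invariant_jets.
have /choice[s sP] i : exists s : 'I_2 -> seq (S * S), forall l0,
    (forall p, p \in s l0 -> Inv p.2) /\
    forall l, grad (s l0) l = if l == l0 then X i ^+ N i else 0.
  by have [s sP] := choice (jN i); exists s.
have sI i l : forall p, p \in s i l -> Inv p.2 by have [] := sP i l.
have s_grad i l l' : grad (s i l) l' = if l' == l then X i ^+ N i else 0.
  by have [_] := sP i l.
pose A i l := Dsum (s i l).
have XN0 i : X i ^+ N i != 0.
  rewrite expf_neq0 //; apply/eqP => /(congr1 (fun f : S => f@_U_(i))).
  by rewrite mcoeffXU eqxx mcoeff0 => /eqP; rewrite oner_eq0.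
(* The combined gradients of [s i 0] and [s i 1] are X_i^N e_0 and X_i^N e_1, so the Jacobian is
   X_i^(2N); one factor X_i^N cancels. *)
have DA i f : Inv f -> X i ^+ N i * D f = A i 0 * f^`M(0) + A i 1 * f^`M(1).
  move=> fI; apply: (mulfI (XN0 i)).
  have := derivation_jacobian_sum fI (sI i 0) (sI i 1).
  rewrite !s_grad /= !mulr0 !subr0 mul0r subr0 -/(A i 0) -/(A i 1) => E.
  transitivity (D f * (X i ^+ N i * X i ^+ N i)); first by ring.
  by rewrite E; ring.
(* Apply [DA j] to the invariants occurring in [s i l], whose combined gradient is X_i^N e_l. *)
have AA i j l : A i l * X j ^+ N j = A j l * X i ^+ N i.
  transitivity (A j 0 * grad (s i l) 0 + A j 1 * grad (s i l) 1).
    transitivity (\sum_(p <- s i l)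
        (A j 0 * (p.1 * p.2^`M(0)) + A j 1 * (p.1 * p.2^`M(1)))).
      rewrite [A i l]/Dsum mulr_suml big_seq [RHS]big_seq.
      apply: eq_bigr => p /sI pI; have := DA j _ pI => E.
      transitivity (p.1 * (X j ^+ N j * D p.2)); first by ring.
      by rewrite E; ring.
    by rewrite big_split -!mulr_sumr.
  have [->|->] : l = 0 \/ l = 1.
    by case: l => [[|[|//]] lP]; [left|right]; apply: val_inj.
  - by rewrite !s_grad /= mulr0 addr0.
  - by rewrite !s_grad /= mulr0 add0r.
have AX l : exists a, A 0 l = a * X 0 ^+ N 0.
  exact: (mpoly_divX_coprime (i := 0) (j := 1) (M := N 1) _ (AA 0 1 l)).
have [a aE] := choice AX; exists a => f fI.
apply: (mulfI (XN0 0)); rewrite DA // !aE; ring.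
Qed.

Theorem invariant_derivation_vanishes f : Inv f -> (D f)@_0 = 0.
Proof.
move=> fI; have [A DA] := invariant_derivation_extends.
rewrite DA // mcoeffD !rmorphM /= !invariant_gradient //.
by rewrite !mulr0 addr0.
Qed.

End Derivation.

End InvariantDerivations.

(** * The case of a single special representation *)

Section Deformation.
Variables (k : closedFieldType) (gT : finGroupType).
Hypothesis char0 : [pchar k] =i pred0.
Variable V : mx_representation k [set: gT] 2.
Hypothesis V_free : forall g, g != 1%g -> V g - 1%:M \in unitmx.
Hypothesis nontrivial : (1 < #|gT|)%N.
Variables (I : finType) (n : I -> nat).
Variable W : forall i, mx_representation k [set: gT] (n i).
Hypothesis W_trivial : forall i g, W i g = 1%:M.
Variables (i0 : I) (j0 : 'I_(n i0)).
Hypothesis I_unique : forall i, i = i0.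
Hypothesis j_unique : forall j, j = j0.
Variables (v : I -> nat) (v1 : v i0 = 1%N).

Local Notation S := {mpoly k[2]}.
Local Notation E := (fun i => taut V (W i)).
Local Notation Inv := (invariant_poly V).

Lemma minimal_invariant_monomial : exists f m, [/\ Inv f, f@_m != 0, (0 < mdeg m)%N
  & forall f' m', Inv f' -> f'@_m' != 0 -> (0 < mdeg m')%N -> (mdeg m <= mdeg m')%N].
Proof.
pose deg d := `[< exists f m, [/\ Inv f, f@_m != 0, (0 < mdeg m)%N & mdeg m = d] >].
have degP : exists d, deg d.
  have [f [m [fI fm m0]]] := invariant_nonconstant V_free.
  by exists (mdeg m); apply/asboolP; exists f, m.
case: (ex_minnP degP) => d /asboolP[f [m [fI fm m0 md]]] dmin.
exists f, m; split=> // f' m' fI' fm' m0'; rewrite md; apply: dmin.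
by apply/asboolP; exists f', m'.
Qed.

(* The coefficient of a monomial of least positive degree among those of the
   invariants is a derivation at the origin. *)
Lemma mcoeff_minimalM (f g : S) (m : 'X_{1..2}) : (0 < mdeg m)%N ->
  (forall m', f@_m' != 0 -> (0 < mdeg m')%N -> (mdeg m <= mdeg m')%N) ->
  (forall m', g@_m' != 0 -> (0 < mdeg m')%N -> (mdeg m <= mdeg m')%N) ->
  (f * g)@_m = f@_0 * g@_m + g@_0 * f@_m.
Proof.
move=> m0 fm gm; pose red (h : S) := h - (h@_0)%:MP.
have redE (h : S) m' : (red h)@_m' = if m' == 0%MM then 0 else h@_m'.
  rewrite mcoeffB mcoeffC; case: eqP => [->|_]; last by rewrite mulr0 subr0.
  by rewrite mulr1 subrr.
have mn0 : m != 0%MM by rewrite -mdeg_eq0 -lt0n.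
have fg0 : (red f * red g)@_m = 0.
  rewrite mcoeffM big1 // => -[k1 k2] /= /eqP mk; rewrite !redE.
  case: eqP => [|/eqP k10]; first by rewrite mul0r.
  case: eqP => [|/eqP k20]; first by rewrite mulr0.
  have [->|fk1] := eqVneq f@_k1 0; first by rewrite mul0r.
  have md : mdeg m = (mdeg k1 + mdeg k2)%N by rewrite -mdegD -mk.
  have le1 : (mdeg k1 + mdeg k2 <= mdeg k1)%N by rewrite -md fm // lt0n mdeg_eq0.
  by move: le1; rewrite -{2}[mdeg k1]addn0 leq_add2l leqn0 mdeg_eq0 (negPf k20).
have -> : f * g = red f * red g + (f@_0 *: g + g@_0 *: f) - (f@_0 * g@_0)%:MP.
  by rewrite /red -!mul_mpolyC mpolyCM; ring.
by rewrite mcoeffB mcoeffD fg0 add0r mcoeffD !mcoeffZ mcoeffC (negPf mn0) mulr0 subr0.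
Qed.

Definition at_origin : {lrmorphism S -> k^o} := peval (fun=> 0 : k^o).

Lemma at_originE f : at_origin f = f@_0.
Proof.
elim/mpoly_ring_ind: f => [c|i|f g IHf IHg|f g IHf IHg].
- rewrite [LHS]pevalC mcoeffC eqxx [RHS]mulr1; exact: mulr1.
- by rewrite [LHS]pevalX mcoeffX mnm1_eq0.
- by rewrite [LHS]rmorphD [RHS]mcoeffD -IHf -IHg.
- by rewrite [LHS]rmorphM [RHS]rmorphM /= -IHf -IHg.
Qed.

Let idS : {lrmorphism S -> S} := idfun.
Let B : comAlgType k := sqext idS.
Let B' : comAlgType k := sqext at_origin.

(** The map from S + S eps to S + k eps evaluates the eps-part at the origin. Lifting along it turns
    a derivation with values in k, at the origin, into one with values in S. *)
Definition restrict (x : B) : B' := SqExt at_origin (body x) (at_origin (infin x)).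

Fact restrict_zmod : zmod_morphism restrict.
Proof. by move=> x y; apply: sqext_eq => //=; rewrite rmorphB. Qed.
Fact restrict_monoid : monoid_morphism restrict.
Proof.
split=> [|x y]; apply: sqext_eq => //=; first by rewrite rmorph0.
by rewrite rmorphD !rmorphM.
Qed.
Fact restrict_scalable : scalable restrict.
Proof. by move=> a x; apply: sqext_eq => //=; rewrite linearZ. Qed.

HB.instance Definition _ := GRing.isZmodMorphism.Build B B' restrict restrict_zmod.
HB.instance Definition _ := GRing.isMonoidMorphism.Build B B' restrict restrict_monoid.
HB.instance Definition _ := GRing.isScalable.Build k B B' *:%R restrict restrict_scalable.

Lemma proj_endo_single i : proj_endo E [set i] = endo_id E.
Proof. by apply: endo_ext => A Z s j /=; rewrite inE (I_unique i) (I_unique j) eqxx. Qed.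

Section CharacterFamily.
Variables (A : comAlgType k) (psi : endo E -> A).
Hypothesis psi1 : psi (endo_id E) = 1.
Hypothesis psiM : forall b c, psi (endo_comp b c) = psi b * psi c.
Hypothesis psiD : forall b c, psi (endo_add b c) = psi b + psi c.
Hypothesis psiZ : forall a b, psi (endo_scale a b) = a%:A * psi b.

Fact character_act_linear b : linear (fun m : A^o => psi b * m : A^o).
Proof. by move=> a m m'; rewrite mulrDr; congr (_ + _); apply: mulrCA. Qed.

(** With one summand of rank 1, an algebra morphism from B to [A] is a point of the linear series:
    the module is [A] itself, generated by 1. *)
Definition character_family : mls_fam E v i0 A.
Proof.
exists A^o (fun b => linear_of (character_act_linear b)) 1.
- by move=> m; rewrite /= psi1 mul1r.
- by move=> b c m; rewrite /= psiM mulrA.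
- by move=> b c m; rewrite /= psiD mulrDl.
- by move=> c b m; rewrite /= psiZ -mulrA.
- move=> i; rewrite (I_unique i) v1.
  set e := linear_of _.
  have eE m : e m = m by rewrite /e /= proj_endo_single psi1 mul1r.
  have e1 : (1 : A^o) \in fixed_pred e by rewrite inE eE.
  have zl : linear (fun m : fixed e => const_mx (val m) : 'rV[A]_1).
    by move=> a m m'; apply/rowP => j; rewrite !mxE val_fixedP.
  apply: (@coordinates_locally_free A (fixed e) 1%N 1%N (fun=> 1) (fun=> 1)
    (fun _ _ => exist (fun m => m \in fixed_pred e) _ e1) (fun=> linear_of zl)).
  + by rewrite big_ord1 mulr1.
  + move=> _ m; rewrite scale1r /comb big_ord1 mxE; apply: val_inj.
    by rewrite val_fixedZ; apply/esym/mulr1.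
  + by move=> _ t; apply/rowP => j; rewrite scale1r !ord1 !mxE !eqxx.
- by rewrite /= proj_endo_single psi1 mul1r.
- move=> m _; exists m; split=> [|a ->]; last exact: mulr1.
  exact/esym/mulr1.
- move=> m; exists 1%N, (fun=> m), (fun=> endo_id E).
  by rewrite big_ord1 /= psi1 mul1r; apply/esym/mulr1.
Defined.

End CharacterFamily.

Theorem trivial_series_not_smooth : ~ formally_smooth (mls E v i0).
Proof.
have [F [F1 FM FD FZ [FI Fmult]]] :=
  invariant_function_poly V_free W_trivial I_unique j_unique.
have [f0 [m0 [f0I f0m m0_gt0 m0_min]]] := minimal_invariant_monomial.
(* The tangent vector at the origin is the coefficient of [m0]; minimality of its degree makes [psi]
   multiplicative. *)
pose psi b : B' := SqExt at_origin (F b) (F b)@_m0.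
have m0_min' b m' : (F b)@_m' != 0 -> (0 < mdeg m')%N -> (mdeg m0 <= mdeg m')%N.
  exact: m0_min.
have psi1 : psi (endo_id E) = 1.
  apply: sqext_eq; rewrite /= F1 // mcoeff1.
  by rewrite -mdeg_eq0 -leqn0 leqNgt m0_gt0.
have psiM b c : psi (endo_comp b c) = psi b * psi c.
  apply: sqext_eq; rewrite /= FM // mcoeff_minimalM //; try exact: m0_min'.
  by rewrite !at_originE.
have psiD b c : psi (endo_add b c) = psi b + psi c.
  by apply: sqext_eq; rewrite /= FD // mcoeffD.
have psiZ a b : psi (endo_scale a b) = a%:A * psi b.
  by rewrite mulr_algl; apply: sqext_eq; rewrite /= FZ // mcoeffZ.
pose x' := character_family psi1 psiM psiD psiZ.
move=> /(_ B B' restrict) smooth.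
have [x [w]] : exists x : mls_fam E v i0 B, inhabited (mls_arr restrict x x').
  apply: smooth => [y|a b ra rb].
    exists (SqExt idS (body y) (infin y)%:MP); apply: sqext_eq => //=.
    by rewrite at_originE mcoeffC eqxx mulr1.
  apply: sqext_eq; have := congr1 (@body _ _ _ _) ra;
    have := congr1 (@body _ _ _ _) rb; rewrite /= => -> ->; first exact: mulr0.
  by rewrite -[LHS]/(0 * _ + 0 * _) !mul0r addr0.
have [l lE] := mls_coordinate x.
(* As e_0 is the identity, the lifted module is a line on gen, and [beta] is the character of B on
   it. *)
pose beta b : B := l (act x b (gen x)).
have betaE b : act x b (gen x) = beta b *: gen x.
  by rewrite -lE proj_endo_single act_id.
have beta_uniq b a : act x b (gen x) = a *: gen x -> beta b = a.
  by rewrite betaE => /scale_gen_inj.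
have betaM b c : beta (endo_comp b c) = beta b * beta c.
  by apply: beta_uniq; rewrite act_comp betaE linearZZ betaE scalerA mulrC.
have betaD b c : beta (endo_add b c) = beta b + beta c.
  by apply: beta_uniq; rewrite act_add !betaE scalerDl.
have betaZ a b : beta (endo_scale a b) = a *: beta b.
  by apply: beta_uniq; rewrite act_scale betaE scalerA mulr_algl.
have beta_psi b : restrict (beta b) = psi b.
  have [wl _] := mls_fun_base_change w.
  have := mls_fun_act w b (gen x); rewrite betaE (semilinearZ _ _ wl) mls_fun_gen.
  by rewrite -[RHS]/(psi b * 1) mulr1 => <-; apply/esym/mulr1.
(* The eps-part of [beta] on multiplication by r is a derivation because its body part is r. The
   value 0 off the invariants is only a default. *)
pose D r : S := if pselect (Inv r) is left rI then
  infin (beta (mult_endo W_trivial rI)) else 0.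
have DE r (rI : Inv r) : D r = infin (beta (mult_endo W_trivial rI)).
  by rewrite /D; case: pselect => // rI'; rewrite (Prop_irrelevance rI' rI).
have beta_body r (rI : Inv r) : body (beta (mult_endo W_trivial rI)) = r.
  by have := congr1 (@body _ _ _ _) (beta_psi (mult_endo W_trivial rI)); rewrite /= Fmult.
have [IC ID IM] := invariant_subalgebra V.
have DD : derivation Inv D.
  split=> [c|r s rI sI|r s rI sI].
  - rewrite (DE _ (IC c)) mult_endoC betaZ (beta_uniq _ 1) ?act_id ?scale1r //.
    exact: scaler0.
  - by rewrite (DE _ (ID _ _ rI sI)) (mult_endoD W_trivial rI sI) betaD !DE.
  - rewrite (DE _ (IM _ _ rI sI)) (mult_endoM W_trivial rI sI) betaM !DE.
    by rewrite -[LHS]/(body _ * _ + body _ * _) !beta_body.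
(* Since [beta] lifts [psi], the value of D f0 at the origin is the coefficient of [m0] in f0, which
   is not 0. *)
have := invariant_derivation_vanishes char0 V_free nontrivial DD f0I.
rewrite (DE _ f0I) -at_originE.
have := congr1 (@infin _ _ _ _) (beta_psi (mult_endo W_trivial f0I)).
by rewrite /= Fmult => -> /eqP; rewrite (negPf f0m).
Qed.

End Deformation.

(** The rank of V g - 1 is at most 2; faithfulness excludes 0 and the absence of pseudo-reflections
    excludes 1. *)
Lemma small_free (k : fieldType) (gT : finGroupType)
    (V : mx_representation k [set: gT] 2) : mx_faithful V ->
  (forall g, \rank (V g - 1%:M) <> 1%N) ->
  forall g, g != 1%g -> V g - 1%:M \in unitmx.
Proof.
move=> faithful small g g1; rewrite -row_free_unit /row_free.
have := small g; have := rank_leq_row (V g - 1%:M); have : \rank (V g - 1%:M) != 0%N.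
  apply: contraNneq g1 => /eqP; rewrite mxrank_eq0 subr_eq0 => /eqP Vg.
  apply/eqP/set1P; apply: (subsetP faithful).
  by apply/rkerP; rewrite inE.
by case: (\rank _) => [|[|[|]]].
Qed.

Theorem corollary1p2 (R : realType) (gT : finGroupType)
    (V : mx_representation R[i] [set: gT] 2)
    (faithful : mx_faithful V)
    (nontrivial : (1 < #|gT|)%N)
    (small : no_pseudoreflections V)
    (rho0 : Sp V) (rho0_trivial : val rho0 = [1 (Irr R[i] gT)]%irr)
    (CIK_smooth :
      formally_smooth (mls (taut_Sp (V := V)) (rank_Sp (V := V)) rho0)) :
  closed_immersion
    (prod_morphism (fun rho : {rho : Sp V | rho != rho0} =>
       cornering (taut_Sp (V := V)) (rank_Sp (V := V))
         (set21 rho0 (val rho)))).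
Proof.
have rank1 : rank_Sp rho0 = 1%N by rewrite /rank_Sp rho0_trivial degree_irr1.
(* A second special representation serves as the reference corner [j0]; otherwise the product is
   empty and the smoothness of the series is contradicted. *)
have [rho rho_neq|all_trivial] := pickP (fun rho : Sp V => rho != rho0).
  exact (prod_cornering_closed_immersion (E := taut_Sp (V := V)) rank1 (exist _ rho rho_neq)).
have unique rho : rho = rho0 by apply/eqP; rewrite -[_ == _]negbK all_trivial.
have trivial (rho : Sp V) g : irr_repr (val rho) g = 1%:M.
  by rewrite (unique rho) rho0_trivial irr1_repr ?inE.
have degree_unique (j j' : 'I_(irr_degree (val rho0))) : j = j'.
  by move: j j'; rewrite -[irr_degree _]/(rank_Sp rho0) rank1 => j j'; rewrite !ord1.
have j0 : 'I_(irr_degree (val rho0)) := Ordinal (irr_degree_gt0 _).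
case: (trivial_series_not_smooth _ _ nontrivial trivial unique
  (degree_unique ^~ j0) rank1 CIK_smooth).
- exact: Num.Theory.pchar_num.
- exact: small_free faithful small.
Qed.
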